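(* Let $A,B,G$ be filtered differential graded algebras (FDGAs), $B$ with the constant filtration. Let $A$ and $B$ carry traces $\operatorname{tr}_A\colon A_{\operatorname{tr}}\to\mathbb K_I$ and $\operatorname{tr}_B\colon B_{\operatorname{tr}}\to\mathbb K_c$, and let $\phi\colon A\to B$ be a morphism of FDGAs with trace whose map on trace targets is the canonical map $\mathbb K_I\to\mathbb K_c$ (the identity of $\mathbb K$). Let $\rho\colon G\otimes A\to A$, $g\otimes a\mapsto g\cdot a$, be an action of $G$ on the filtered dg-module underlying $A$ and $i\colon G\to B$ a morphism of FDGAs such that $\phi(g\cdot a)=i(g)\,\phi(a)$ for all $g\in G$, $a\in A$. For $j=0,1$ let $g_j\in C^\omega_{\mathcal R}(G)$ and let $F_j=i(g_j)\in C^\omega_{\mathcal R}(B)$. Assume there is a semigroup homomorphism $H\colon(\mathbb R_{>0},+)\to (C^\omega_{\mathcal R}(A_{\operatorname{tr}}),\cdot)$, $\tau\mapsto H_\tau$, such that $\phi(H_\tau)=e^{\tau F_0}$ for all $\tau>0$. Assume that the action of $g_1$ on $C^\omega_{\mathcal R}(A)$ is graded-central and let $\gamma=z_{g_1}\in Z(\widehat{\operatorname{gr}}A)$ be the corresponding central element. Put $h=H_1|_0\in\widehat{\operatorname{gr}}A$ and $f_j=F_j|_1\in B$. Assume that the element $$\sum_{n=0}^\infty\int_{\Delta_n}e^{\tau_0F_0}F_1e^{\tau_1F_0}\cdots F_1e^{\tau_nF_0}\,d\sigma_n$$ of $C^\omega_{\mathcal R}(B)$ (which equals $e^{F_0+F_1}$)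 has constant trace, and that $e^{f_0+f_1}$ exists in $B$. Then $$\operatorname{tr}_B\left(e^{f_0+f_1}\right)=\operatorname{tr}_{\widehat{\operatorname{gr}}A}\left(e^{\gamma}h\right).$$
   Context: $\mathbb K$ is a commutative $\mathbb R$-algebra (ground ring), $\otimes=\otimes_{\mathbb K}$. Complexes are cochain complexes of $\mathbb K$-modules (differential of degree $+1$). A filtered complex $(C,F)$ is a complex with an increasing $\mathbb Z$-indexed filtration by subcomplexes $F^aC$; morphisms are filtration-preserving cochain maps; tensor products carry $F^a(C\otimes D)=\sum_i F^iC\otimes F^{a-i}D$. The constant filtration on $C$ is $F^aC=C$ for all $a$. $\mathbb K_I$ is $\mathbb K$ in degree $0$ with $I^a\mathbb K=0$ for $a<0$, $I^a\mathbb K=\mathbb K$ for $a\ge0$; $\mathbb K_c$ is $\mathbb K$ with the constant filtration. An FDGA is a (not necessarily unital) filtered complex $A$ with an associative product given by a morphism of filtered complexes $A\otimes A\to A$. Commutators are graded: $\{x,y\}=xy-(-1)^{|x||y|}yx$. Whenever smooth maps into a module are considered, its underlying real vector space is assumed to be a separated locally convex space. FDGA with trace: an FDGA $A$, a two-sided differential ideal $A_{\operatorname{tr}}\subseteq A$ (filtered by $F^nA_{\operatorname{tr}}=A_{\operatorname{tr}}\cap F^nA$), a filtered complex $P$ and a continuous filtered cochain map $\operatorname{tr}_A\colon A_{\operatorname{tr}}\to P$ vanishing on $\{A,A_{\operatorname{tr}}\}$. A morphism $(A,A_{\operatorname{tr}},P,\operatorname{tr}_A)\to(B,B_{\operatorname{tr}},Q,\operatorname{tr}_B)$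 is an FDGA morphism $\phi\colon A\to B$ with $\phi(A_{\operatorname{tr}})\subseteq B_{\operatorname{tr}}$ together with a filtered cochain map $\bar\phi\colon P\to Q$ with $\bar\phi\circ\operatorname{tr}_A=\operatorname{tr}_B\circ\phi$ on $A_{\operatorname{tr}}$. Smooth Rees module: $C^\omega_{\mathcal R}(C)$ is the complex of smooth maps $a\colon\mathbb R_{>0}\to C$ for which there are $\varepsilon>0$, $N\in\mathbb Z$ and $a_n\in F^nC$ with $a(t)=\sum_{n\ge N}a_nt^n$ for $0<t<\varepsilon$. Products, actions and morphisms (still denoted $\rho,\phi,i$) are applied pointwise in $t$. $C^\omega_{\mathcal R,\operatorname{tr}}(A)\subseteq C^\omega_{\mathcal R}(A)$ is the ideal of those $a$ with $a(t)\in A_{\operatorname{tr}}$ for all $t>0$. An element $a$ of $C^\omega_{\mathcal R,\operatorname{tr}}(A)$ (or of its subset $C^\omega_{\mathcal R}(A_{\operatorname{tr}})$) has constant trace if $\operatorname{tr}_A(a(t))$ is independent of $t>0$. Associated graded: $\operatorname{gr}^nA=F^nA/F^{n-1}A$, and $\widehat{\operatorname{gr}}A=\bigoplus_{n<0}\operatorname{gr}^nA\oplus\prod_{n\ge0}\operatorname{gr}^nA$ (Laurent series associated graded), with induced product. Evaluations: $a|_s=a(s)$ for $s>0$, and $a|_0=([a_n])_n\in\widehat{\operatorname{gr}}A$ for $a=\sum a_nt^n$. The action $\rho$ induces an action of $\widehat{\operatorname{gr}}G$ on $\widehat{\operatorname{gr}}A$ with $(g\cdot a)|_0=g|_0\cdot_0a|_0$.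 The action of $g\in C^\omega_{\mathcal R}(G)$ on $C^\omega_{\mathcal R}(A)$ is graded-central if the induced action (of $g|_0$) on $\widehat{\operatorname{gr}}A$ is a morphism of $\widehat{\operatorname{gr}}A$-bimodules; equivalently, it is left multiplication by a central element $z_g\in Z(\widehat{\operatorname{gr}}A)$. Since $\widehat{\operatorname{gr}}\,\mathbb K_I=\mathbb K$ in filtration degree $0$, the induced trace is $\operatorname{tr}_{\widehat{\operatorname{gr}}A}\colon\widehat{\operatorname{gr}}A_{\operatorname{tr}}\to\mathbb K$, $y\mapsto\operatorname{tr}_{\operatorname{gr}^0A}(y_0)$, where $\operatorname{tr}_{\operatorname{gr}^0A}([a])=\operatorname{tr}_A(a)$ for $a\in F^0A_{\operatorname{tr}}$. The notation $e^\gamma h$ means $\sum_{n\ge0}\frac1{n!}\gamma^nh$. Exponentials: a (one-parameter) semigroup in a unital Banach algebra $R$ (here $R=B$ or $R=C^\omega_{\mathcal R}(B)$) is a strongly continuous map $u\mapsto H_u$, $u\ge0$, with $H_{u+v}=H_uH_v$, $H_0=1$; its generator is $\lim_{u\to0^+}(H_u-H_0)/u$ when it exists. An element $X$ is exponentiable (''$e^X$ exists'') if it generates a semigroup, which is then unique and denoted $e^{uX}$. $\Delta_n=\{(\tau_0,\dots,\tau_n):\tau_i\ge0,\sum\tau_i=1\}$ with measure $d\sigma_n=d\tau_1\cdots d\tau_n$, so $\int_{\Delta_n}d\sigma_n=1/n!$.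
   Formalization: The convergence of the series defining e^γ h, to an element of the Laurent associated graded of A_tr, is assumed, since it can fail and the right side is then undefined; products, the action and morphisms are taken to be continuous so that their pointwise use on smooth maps makes sense. *)

(* Defs.v *)
From HB Require Import structures.
From mathcomp Require Import all_boot all_order all_algebra.
From mathcomp Require Import all_classical all_reals all_analysis.

Set Implicit Arguments.
Unset Strict Implicit.
Unset Printing Implicit Defensive.

Import Order.TTheory GRing.Theory Num.Theory.
Import numFieldNormedType.Exports.

Local Open Scope classical_set_scope.
Local Open Scope ring_scope.

(* The ground ring: a commutative R-algebra whose underlying real vector space
   is locally convex (separation is a separate hypothesis). *)
#[short(type="tvsComAlgType")]
HB.structure Definition TvsComAlgebra (R : numDomainType) :=
  {K of Tvs R K & GRing.ComAlgebra R K}.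

Section FilteredComplexes.
Context (R : realType) (K : tvsComAlgType R).

(* A filtered cochain complex of K-modules carried by the locally convex space
   C. The K-action extends the real scaling of C. The grading is internal:
   [prj n] is the projection onto the degree n summand of C = \bigoplus_n C^n,
   so that an element x has degree n iff [prj n x = x]. *)
Record filtered_complex (C : tvsType R) := FilteredComplex {
  kact : K -> C -> C ;
  kactDl : forall a b x, kact (a + b) x = kact a x + kact b x ;
  kactDr : forall a x y, kact a (x + y) = kact a x + kact a y ;
  kactA : forall a b x, kact (a * b) x = kact a (kact b x) ;
  kact_real : forall (r : R) x, kact r%:A x = r *: x ;
  prj : int -> C -> C ;
  prjD : forall n x y, prj n (x + y) = prj n x + prj n y ;
  prjZ : forall n a x, prj n (kact a x) = kact a (prj n x) ;
  prj_prj : forall m n x, prj m (prj n x) = if m == n then prj n x else 0 ;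
  prj_fin : forall x, finite_set [set n | prj n x != 0] ;
  prj_sum : forall x, \sum_(n \in [set: int]) prj n x = x ;
  dif : C -> C ;
  difD : forall x y, dif (x + y) = dif x + dif y ;
  difZ : forall a x, dif (kact a x) = kact a (dif x) ;
  dif_prj : forall n x, dif (prj n x) = prj (n + 1) (dif x) ;
  dif_dif : forall x, dif (dif x) = 0 ;
  fil : int -> set C ;
  fil0 : forall a, fil a 0 ;
  filD : forall a x y, fil a x -> fil a y -> fil a (x + y) ;
  filZ : forall a k x, fil a x -> fil a (kact k x) ;
  fil_prj : forall a n x, fil a x -> fil a (prj n x) ;
  fil_dif : forall a x, fil a x -> fil a (dif x) ;
  fil_le : forall a b, a <= b -> fil a `<=` fil b
}.

Definition has_degree C (SC : filtered_complex C) (n : int) (x : C) :=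
  prj SC n x = x.

Definition constant_filtration C (SC : filtered_complex C) :=
  forall a, fil SC a = setT.

Definition filtered_morphism C D (SC : filtered_complex C)
    (SD : filtered_complex D) (f : C -> D) : Prop :=
  [/\ forall x y, f (x + y) = f x + f y,
      forall a x, f (kact SC a x) = kact SD a (f x),
      forall n x, f (prj SC n x) = prj SD n (f x),
      forall x, f (dif SC x) = dif SD (f x)
    & forall a x, fil SC a x -> fil SD a (f x)].

(* The sign (-1)^n for an integer n. *)
Definition signz (n : int) : R := (-1) ^+ `|n|%N.

(* A morphism of filtered complexes C \otimes_K D -> E, given as a bilinear map,
   which is moreover continuous, so that it can be applied pointwise to smooth
   maps and to convergent series. *)
Definition filtered_pairing C D E (SC : filtered_complex C)
    (SD : filtered_complex D) (SE : filtered_complex E) (m : C -> D -> E) :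
    Prop :=
  [/\ [/\ forall x x' y, m (x + x') y = m x y + m x' y,
          forall x y y', m x (y + y') = m x y + m x y',
          forall a x y, m (kact SC a x) y = kact SE a (m x y)
        & forall a x y, m x (kact SD a y) = kact SE a (m x y)],
      forall i j x y, has_degree SC i x -> has_degree SD j y ->
        has_degree SE (i + j) (m x y),
      forall i x y, has_degree SC i x ->
        dif SE (m x y) = m (dif SC x) y + signz i *: m x (dif SD y),
      forall i j x y, fil SC i x -> fil SD j y -> fil SE (i + j) (m x y)
    & continuous (fun z : C * D => m z.1 z.2)].

Record fdga (A : tvsType R) := FDGA {
  fdga_cpx :> filtered_complex A ;
  fmul : A -> A -> A ;
  fmul_pairing : filtered_pairing fdga_cpx fdga_cpx fdga_cpx fmul ;
  fmul_assoc : forall x y z, fmul x (fmul y z) = fmul (fmul x y) z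
}.

Definition fdga_morphism A B (SA : fdga A) (SB : fdga B) (f : A -> B) : Prop :=
  [/\ filtered_morphism SA SB f,
      forall x y, f (fmul SA x y) = fmul SB (f x) (f y)
    & continuous f].

(* An action of G on the filtered dg-module underlying A. *)
Definition fdga_action G A (SG : fdga G) (SA : filtered_complex A)
    (rho : G -> A -> A) : Prop :=
  filtered_pairing SG SA SA rho /\
  forall g g' a, rho (fmul SG g g') a = rho g (rho g' a).

(* A trace on A with values in P: its domain [trdom] is A_tr, with the subspace
   topology, and the values of [trf] outside of [trdom] are irrelevant. *)
Record fdga_trace A (SA : fdga A) P (SP : filtered_complex P) := FDGATrace {
  trdom : set A ;
  trdom0 : trdom 0 ;
  trdomD : forall x y, trdom x -> trdom y -> trdom (x + y) ;
  trdomZ : forall a x, trdom x -> trdom (kact SA a x) ;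
  trdom_prj : forall n x, trdom x -> trdom (prj SA n x) ;
  trdom_dif : forall x, trdom x -> trdom (dif SA x) ;
  trdom_mull : forall a x, trdom x -> trdom (fmul SA a x) ;
  trdom_mulr : forall a x, trdom x -> trdom (fmul SA x a) ;
  trf : A -> P ;
  trfD : forall x y, trdom x -> trdom y -> trf (x + y) = trf x + trf y ;
  trfZ : forall a x, trdom x -> trf (kact SA a x) = kact SP a (trf x) ;
  trf_prj : forall n x, trdom x -> trf (prj SA n x) = prj SP n (trf x) ;
  trf_dif : forall x, trdom x -> trf (dif SA x) = dif SP (trf x) ;
  trf_fil : forall a x, trdom x -> fil SA a x -> fil SP a (trf x) ;
  trf_comm : forall i j x y, has_degree SA i x -> has_degree SA j y ->
    trdom y -> trf (fmul SA x y - signz (i * j) *: fmul SA y x) = 0 ;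
  trf_cont : {within trdom, continuous trf}
}.

(* F^n A_tr = A_tr \cap F^n A *)
Definition trfil A (SA : fdga A) P (SP : filtered_complex P)
  (TA : fdga_trace SA SP) (n : int) : set A := trdom TA `&` fil SA n.

Definition trace_morphism A B (SA : fdga A) (SB : fdga B) P Q
    (SP : filtered_complex P) (SQ : filtered_complex Q)
    (TA : fdga_trace SA SP) (TB : fdga_trace SB SQ)
    (phi : A -> B) (phibar : P -> Q) : Prop :=
  [/\ fdga_morphism SA SB phi,
      forall x, trdom TA x -> trdom TB (phi x),
      filtered_morphism SP SQ phibar
    & forall x, trdom TA x -> phibar (trf TA x) = trf TB (phi x)].

End FilteredComplexes.

Section GroundRing.
Context (R : realType) (K : tvsComAlgType R).

Let prjK (n : int) (x : K) : K := if n == 0 then x else 0.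
Let difK (x : K) : K := 0.
Let filI (a : int) : set K := [set x | 0 <= a \/ x = 0].

Let prjKD n x y : prjK n (x + y) = prjK n x + prjK n y.
Proof. by rewrite /prjK; case: ifP => // _; rewrite addr0. Qed.

Let prjKZ n a x : prjK n (a * x) = a * prjK n x.
Proof. by rewrite /prjK; case: ifP => // _; rewrite mulr0. Qed.

Let prjK_prj m n x : prjK m (prjK n x) = if m == n then prjK n x else 0.
Proof.
rewrite /prjK; case: (eqVneq m n) => [->|/eqP mn]; first by case: (n == 0).
case: (eqVneq n 0) => [n0|_]; last by case: ifP.
by case: (eqVneq m 0) => // m0; case: mn; rewrite m0 n0.
Qed.

Let prjK_fin x : finite_set [set n | prjK n x != 0].
Proof.
apply: (@sub_finite_set _ _ [set 0]); last exact: finite_set1.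
by move=> n /=; rewrite /prjK; case: (eqVneq n 0) => //; rewrite eqxx.
Qed.

Let prjK_sum x : \sum_(n \in [set: int]) prjK n x = x.
Proof.
rewrite -(@fsbig_widen _ _ _ _ [set 0]) ?fsbig_set1 //.
by move=> n [_ /= /eqP n0]; rewrite /prjK (negbTE n0).
Qed.

Let difK_prj n x : difK (prjK n x) = prjK (n + 1) (difK x).
Proof. by rewrite /prjK /difK; case: ifP. Qed.

Let act_realK (r : R) (x : K) : r%:A * x = r *: x.
Proof. by rewrite -scalerAl mul1r. Qed.

Let mulDrK (a x y : K) : a * (x + y) = a * x + a * y.
Proof. exact: mulrDr. Qed.

Let difKD x y : difK (x + y) = difK x + difK y.
Proof. by rewrite /difK addr0. Qed.

Let difKZ a x : difK (a * x) = a * difK x.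
Proof. by rewrite /difK mulr0. Qed.

Let filI0 a : filI a 0. Proof. by right. Qed.

Let filID a x y : filI a x -> filI a y -> filI a (x + y).
Proof. by case=> [|->]; [left|rewrite add0r]. Qed.

Let filIZ a k x : filI a x -> filI a (k * x).
Proof. by case=> [|->]; [left|rewrite mulr0; right]. Qed.

Let filI_prj a n x : filI a x -> filI a (prjK n x).
Proof. by rewrite /prjK; case: ifP => // _ _; right. Qed.

Let filI_dif a x : filI a x -> filI a (difK x).
Proof. by move=> _; right. Qed.

Let filI_le a b : a <= b -> filI a `<=` filI b.
Proof. by move=> ab x [/le_trans/(_ ab)|->]; [left|right]. Qed.

(* K in degree 0, with I^a K = 0 for a < 0 and I^a K = K for 0 <= a *)
Definition ground_I : filtered_complex K K :=
  @FilteredComplex R K K (fun a x => a * x)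
    (@mulrDl K) mulDrK (fun a b x => esym (mulrA a b x)) act_realK
    prjK prjKD prjKZ prjK_prj prjK_fin prjK_sum
    difK difKD difKZ difK_prj (fun=> erefl)
    filI filI0 filID filIZ filI_prj filI_dif filI_le.

(* K in degree 0, with the constant filtration *)
Definition ground_c : filtered_complex K K :=
  @FilteredComplex R K K (fun a x => a * x)
    (@mulrDl K) mulDrK (fun a b x => esym (mulrA a b x)) act_realK
    prjK prjKD prjKZ prjK_prj prjK_fin prjK_sum
    difK difKD difKZ difK_prj (fun=> erefl)
    (fun=> setT) (fun=> I) (fun _ _ _ _ _ => I) (fun _ _ _ _ => I)
    (fun _ _ _ _ => I) (fun _ _ _ => I) (fun _ _ _ _ _ => I).

End GroundRing.

Section Rees.
Context (R : realType) (C : tvsType R).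

(* a : R_{>0} -> S is smooth, where S \subseteq C has the subspace topology:
   D k is the k-th derivative. Values at t <= 0 are irrelevant. *)
Definition smooth_into (S : set C) (a : R -> C) : Prop :=
  exists D : nat -> R -> C, (forall t, 0 < t -> D 0%N t = a t) /\
    forall k t, 0 < t -> S (D k t) /\
      (h^-1 *: (D k (t + h) - D k t) @[h --> 0^'] --> D k.+1 t).

(* The Laurent series associated graded \hat{gr} of an increasing filtration F.
   An element is represented by a family y with y n \in F^n for all n and
   y n = 0 for n << 0; its component in gr^n is the class of y n modulo
   F^(n-1), so that two families represent the same element iff [gr_eq]. *)
Definition grhat (F : int -> set C) (y : int -> C) : Prop :=
  (forall n, F n (y n)) /\ exists N : int, forall n, n < N -> y n = 0.

Definition gr_eq (F : int -> set C) (y z : int -> C) : Prop :=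
  forall n, F (n - 1) (y n - z n).

(* a(t) = \sum_(n >= N) c_n t^n for 0 < t < eps with c_n \in F^n; then c
   represents a|_0. *)
Definition symbol (F : int -> set C) (a : R -> C) (c : int -> C) : Prop :=
  (forall n, F n (c n)) /\
  exists N : int, exists2 eps : R, 0 < eps &
    (forall n, n < N -> c n = 0) /\
    forall t, 0 < t < eps ->
      (\sum_(k < m) t ^ (N + k%:Z) *: c (N + k%:Z)) @[m --> \oo] --> a t.

(* The smooth Rees module of the subspace S of C with filtration F *)
Definition rees_of (S : set C) (F : int -> set C) (a : R -> C) : Prop :=
  smooth_into S a /\ exists c, symbol F a c.

(* Convergence of u to y in \hat{gr}: componentwise, each F^n / F^(n-1)
   carrying the quotient topology of the subspace topology of F^n. *)
Definition gr_cvg (F : int -> set C) (u : nat -> int -> C) (y : int -> C) :=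
  forall n (U : set C), nbhs (y n) U ->
    \forall m \near \oo, exists2 z, F (n - 1) z & U (u m n + z).

End Rees.

(* The pairing induced on \hat{gr}: (y * z)_n = \sum_i y_i z_(n-i). *)
Definition gr_conv (U V W : zmodType) (m : U -> V -> W)
    (y : int -> U) (z : int -> V) (n : int) : W :=
  \sum_(i \in [set: int]) m (y i) (z (n - i)).

Section ReesAlgebras.
Context (R : realType) (K : tvsComAlgType R).

Definition Rees (C : tvsType R) (SC : filtered_complex K C) : set (R -> C) :=
  rees_of setT (fil SC).

(* The Rees module of the complex A_tr *)
Definition Rees_of_trdom (A : tvsType R) (SA : fdga K A) (P : tvsType R)
    (SP : filtered_complex K P) (TA : fdga_trace SA SP) : set (R -> A) :=
  rees_of (trdom TA) (trfil TA).

(* The ideal of the elements of the Rees module of A with values in A_tr *)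
Definition Rees_tr (A : tvsType R) (SA : fdga K A) (P : tvsType R)
    (SP : filtered_complex K P) (TA : fdga_trace SA SP) : set (R -> A) :=
  [set a | Rees SA a /\ forall t, 0 < t -> trdom TA (a t)].

Definition constant_trace (A : tvsType R) (SA : fdga K A) (P : tvsType R)
    (SP : filtered_complex K P) (TA : fdga_trace SA SP) (a : R -> A) : Prop :=
  forall s t, 0 < s -> 0 < t -> trf TA (a s) = trf TA (a t).

(* The action of an element of \hat{gr} G represented by c is a morphism of
   \hat{gr} A-bimodules. *)
Definition graded_central (G A : tvsType R) (SA : fdga K A)
    (rho : G -> A -> A) (c : int -> G) : Prop :=
  forall x a, grhat (fil SA) x -> grhat (fil SA) a ->
    gr_eq (fil SA) (gr_conv rho c (gr_conv (fmul SA) x a))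
                   (gr_conv (fmul SA) x (gr_conv rho c a)) /\
    gr_eq (fil SA) (gr_conv rho c (gr_conv (fmul SA) a x))
                   (gr_conv (fmul SA) (gr_conv rho c a) x).

Definition gr_center (A : tvsType R) (SA : fdga K A) (z : int -> A) : Prop :=
  grhat (fil SA) z /\
  forall x, grhat (fil SA) x ->
    gr_eq (fil SA) (gr_conv (fmul SA) z x) (gr_conv (fmul SA) x z).

(* z is the central element z_g through which c = g|_0 acts. *)
Definition acts_as_central (G A : tvsType R) (SA : fdga K A)
    (rho : G -> A -> A) (c : int -> G) (z : int -> A) : Prop :=
  gr_center SA z /\
  forall a, grhat (fil SA) a ->
    gr_eq (fil SA) (gr_conv rho c a) (gr_conv (fmul SA) z a).

(* y = e^gamma h := \sum_k gamma^k h / k! in \hat{gr} A_tr *)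
Definition is_exp_times (A : tvsType R) (SA : fdga K A) (P : tvsType R)
    (SP : filtered_complex K P) (TA : fdga_trace SA SP)
    (gamma h y : int -> A) : Prop :=
  grhat (trfil TA) y /\
  gr_cvg (trfil TA)
    (fun m n => \sum_(k < m) (k`!%:R^-1 : R) *:
       iter k (gr_conv (fmul SA) gamma) h n) y.

(* The trace \hat{gr} A_tr -> K induced by a trace with values in K_I: on the
   element represented by y it is tr_(gr^0 A) [y_0] = tr_A (y_0), which does not
   depend on the representative since tr_A maps F^(-1) A_tr to I^(-1) K = 0. *)
Definition gr_tr (A : tvsType R) (SA : fdga K A)
    (TA : fdga_trace SA (ground_I K)) (y : int -> A) : K := trf TA (y 0).

(* The norm of B makes it a unital Banach algebra with unit e. *)
Definition unital_banach_algebra (B : completeNormedModType R) (SB : fdga K B)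
    (e : B) : Prop :=
  (forall x, fmul SB e x = x /\ fmul SB x e = x) /\
  forall x y, `|fmul SB x y| <= `|x| * `|y|.

(* E u = e^(u X) for 0 <= u *)
Definition generates (B : completeNormedModType R) (SB : fdga K B) (e : B)
    (X : B) (E : R -> B) : Prop :=
  [/\ E 0 = e,
      forall u v, 0 <= u -> 0 <= v -> E (u + v) = fmul SB (E u) (E v),
      {within `[0, +oo[, continuous E}
    & u^-1 *: (E u - E 0) @[u --> 0^'+] --> X].

(* E u = e^(u F) in the smooth Rees algebra of B, with the topology of
   pointwise convergence in t *)
Definition rees_generates (B : completeNormedModType R) (SB : fdga K B) (e : B)
    (F : R -> B) (E : R -> R -> B) : Prop :=
  (forall u, 0 <= u -> Rees SB (E u)) /\
  forall t, 0 < t -> generates SB e (F t) (fun u => E u t).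

(* E(tau_0) F E(tau_1) F ... F E(tau_n), for taus = [:: tau_1; ...; tau_n] *)
Fixpoint dyson_word (B : tvsType R) (SB : fdga K B) (E : R -> B) (F : B)
    (tau0 : R) (taus : seq R) : B :=
  if taus is tau1 :: taus' then
    fmul SB (E tau0) (fmul SB F (dyson_word SB E F tau1 taus'))
  else E tau0.

(* The integral of f over the simplex of all tau_0, ..., tau_n >= 0 with
   tau_0 + ... + tau_n = s, with respect to d tau_1 ... d tau_n *)
Fixpoint simplex_int (n : nat) (s : R) (f : R -> seq R -> R) : R :=
  if n is n'.+1 then
    \int[lebesgue_measure]_(x in `[0, s])
      simplex_int n' (s - x) (fun tau0 taus => f tau0 (x :: taus))
  else f s [::].

(* v is the (weak) integral of the B-valued function f over \Delta_n. *)
Definition is_simplex_int (B : tvsType R) (n : nat) (f : R -> seq R -> B)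
    (v : B) : Prop :=
  forall l : {linear B -> R^o}, continuous l ->
    l v = simplex_int n 1 (fun tau0 taus => l (f tau0 taus)).

(* S = \sum_n \int_(\Delta_n) E(tau_0) F ... F E(tau_n) d sigma_n in B *)
Definition is_dyson_sum (B : completeNormedModType R) (SB : fdga K B)
    (E : R -> B) (F S : B) : Prop :=
  exists2 v : nat -> B, forall n, is_simplex_int n (dyson_word SB E F) (v n) &
    series v @ \oo --> S.

End ReesAlgebras.

(* Main.v *)
Require Import Defs.
From HB Require Import structures.
From mathcomp Require Import all_boot all_order all_algebra.
From mathcomp Require Import all_classical all_reals all_analysis.
From mathcomp Require Import measurable_realfun zify ring lra.

(** Two elements of K are equal if every continuous real linear form [lam] of K
   takes the same value on them ([separating_form]). Fix [lam]. The domain of the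
   trace of B is an ideal that contains [e^(u F_0(t)) = phi (H_u(t))], which is
   invertible for small u; so it is all of B ([trdom_full]), and
   [l = lam o tr_B] is a continuous linear form on B.

   All exponentials are expanded into words in the letters [X = F_0(t)] and
   [Y = F_1(t)]. A semigroup is the exponential series of its generator
   ([semigroup_bexp]), so [e^(tau_0 X) Y e^(tau_1 X) ... Y e^(tau_n X)] is the sum
   of the words [X^k_0 Y X^k_1 ... Y X^k_n] with coefficients
   [prod_i tau_i^(k_i) / k_i!], and the integral of such a coefficient over the
   simplex is [1 / j!], where j is the length of the word (Dirichlet's integral).
   Regrouping words by their number of letters Y ([sum_simplex_int]) shows that
   [l (S t)] is the sum of [l (w) / |w|!] over all words w. At [t = 1] this is
   [l (e^(f_0 + f_1))] ([form_exp_dyson]).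

   By hypothesis [l (S t)] does not depend on t. Compare coefficients of [t^0] in
   its expansion into words. A word of length j may have a pole of order j M at
   [t = 0], so all the words together form a two-sided Laurent series, known only
   for real t. Its coefficients are nevertheless determined by its values
   ([laurent_coef0]), and this justifies expanding word by word
   ([laurent_word_coef]). Hence [l (e^(f_0 + f_1))] is also the sum of
   [l (w_0) / |w|!], where [w_0] is the coefficient of [t^0] in w. Now read the
   regrouping of words backwards: this number is the sum over n of the integrals
   of the coefficients of [t^0] in the Dyson integrands.

   Such an integrand is the image under phi of
   [H_tau_0 (g_1 . (H_tau_1 ... (g_1 . H_tau_n)))]. In the associated graded
   algebra [g_1] acts as the central element [gamma], which can be moved to the
   front ([word_coef_gamma]), and the factors [H_tau_i] multiply to [H_1]. Up to
   [F^(-1) A_tr], where a trace with values in [K_I] vanishes, the coefficient of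
   [t^0] is therefore that of [gamma^n h], whatever the times [tau_i] are
   ([form_word_coef]). Integrating this constant over the simplex divides it by
   [n!], and the sum over n is [lam] of the trace of [e^gamma h]
   ([sum_kappa], [sum_kappa_exp_times]). *)

Set Implicit Arguments.
Unset Strict Implicit.
Unset Printing Implicit Defensive.

Import Order.TTheory GRing.Theory Num.Theory.
Import numFieldNormedType.Exports.

Local Open Scope classical_set_scope.
Local Open Scope ring_scope.

(** * Separation of points by continuous linear forms *)

Section HahnBanach.
Context (R : realType) (V : lmodType R) (p : V -> R).
Hypothesis p_subadd : forall x y, p (x + y) <= p x + p y.
Hypothesis p_homog : forall (a : R) x, 0 <= a -> p (a *: x) = a * p x.

(** Partial linear functionals are handled through their graphs, so that the
   union of a chain of extensions is again an extension. *)
Let linear_graph (G : set (V * R)) :=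
  forall (a : R) z w, G z -> G w -> G (a *: z.1 + w.1, a * z.2 + w.2).

Let dominated (G : set (V * R)) := forall z, G z -> z.2 <= p z.1.

Let p0 : p 0 = 0.
Proof. by rewrite -(scale0r (0 : V)) p_homog// mul0r. Qed.

Let graph0 G z : linear_graph G -> G z -> G (0, 0).
Proof.
move=> lG Gz; have := lG (-1) z z Gz Gz.
by rewrite scaleN1r mulN1r !addNr.
Qed.

Let graphZ G a z : linear_graph G -> G z -> G (a *: z.1, a * z.2).
Proof.
by move=> lG Gz; have := lG a _ _ Gz (graph0 lG Gz); rewrite !addr0.
Qed.

Let graph_fun G x r s : linear_graph G -> dominated G ->
  G (x, r) -> G (x, s) -> r = s.
Proof.
move=> lG dG Gr Gs; apply/eqP; rewrite eq_le -subr_le0 -(subr_le0 r s).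
have := lG (-1) _ _ Gr Gs; have := lG (-1) _ _ Gs Gr => /=.
rewrite !scaleN1r !mulN1r !addNr => /dG /= h1 /dG /= h2.
by move: h1 h2; rewrite p0 addrC => -> /=; rewrite addrC.
Qed.

(** One-dimensional extension step of the Hahn-Banach theorem: the admissible
   values at a new vector [x] form the nonempty interval between the supremum
   of [r - p (y - x)] and the infimum of [p (y + x) - r]. *)
Let graph_extend G z0 x : linear_graph G -> dominated G -> G z0 ->
  exists c, dominated [set z | exists2 w, G w &
    exists t : R, z = (w.1 + t *: x, w.2 + t * c)].
Proof.
move=> lG dG Gz0.
pose A := [set r | exists2 w, G w & r = w.2 - p (w.1 - x)].
have Aub w : G w -> ubound A (p (w.1 + x) - w.2).
  move=> Gw _ [w' Gw' ->].
  have := lG 1 _ _ Gw Gw' => /=; rewrite scale1r mul1r => /dG /= h.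
  have := p_subadd (w.1 + x) (w'.1 - x); rewrite addrACA subrr addr0.
  by move: h; rewrite addrC [in p _]addrC; lra.
have A0 : A (z0.2 - p (z0.1 - x)) by exists z0.
have supA : has_sup A by split; [eexists; exact: A0|eexists; exact: Aub Gz0].
exists (sup A) => _ [w Gw [t ->]] /=.
have [t0|t0|->] := ltgtP t 0.
- have s0 : 0 < - t by rewrite oppr_gt0.
  have Gs := graphZ ((- t)^-1) lG Gw.
  have : A ((- t)^-1 * w.2 - p ((- t)^-1 *: w.1 - x)) by exists (((- t)^-1 *: w.1, (- t)^-1 * w.2)).
  move/(sup_upper_bound supA); rewrite lerBlDr => h.
  have := ler_wpM2l (ltW s0) h; rewrite mulrA divff ?gt_eqF// mul1r mulrDr.
  rewrite -(p_homog _ (ltW s0)) scalerBr scalerA divff ?gt_eqF// scale1r.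
  by rewrite mulNr scaleNr opprK; lra.
- have Gs := graphZ (t^-1) lG Gw.
  have h : sup A <= p (t^-1 *: w.1 + x) - t^-1 * w.2.
    by apply: ge_sup; [eexists; exact: A0|exact: (Aub _ Gs)].
  have := ler_wpM2l (ltW t0) h; rewrite mulrBr mulrA divff ?gt_eqF// mul1r.
  rewrite -(p_homog _ (ltW t0)) scalerDr scalerA divff ?gt_eqF// scale1r.
  by lra.
- by rewrite scale0r mul0r !addr0; exact: dG.
Qed.

(** A maximal dominated linear graph through [(x0, p x0)] is total, as it admits
   no one-dimensional extension; Zorn's lemma provides it. *)
Theorem hahn_banach (x0 : V) : exists lam : V -> R,
  [/\ forall (a : R) x y, lam (a *: x + y) = a * lam x + lam y,
      forall x, lam x <= p x & lam x0 = p x0].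
Proof.
(* The empty graph, the union of the empty chain, has to be admitted. *)
pose P (G : set (V * R)) := [/\ linear_graph G, dominated G &
  forall z, G z -> G (x0, p x0)].
have [F FP totF|G [[lG dG xG] maxG]] := @Zorn_bigcup _ P.
  split.
  - move=> a z w [X FX Xz] [Y FY Yw].
    by have [XY|YX] := totF _ _ FX FY; [exists Y|exists X] => //;
      [have [lY _ _] := FP _ FY; apply: lY => //; exact: XY
      |have [lX _ _] := FP _ FX; apply: lX => //; exact: YX].
  - by move=> z [X FX Xz]; have [_ dX _] := FP _ FX; exact: dX.
  - by move=> z [X FX Xz]; exists X => //; have [_ _ h] := FP _ FX; exact: h Xz.
have Gx0 : G (x0, p x0).
  apply: contrapT => nG.
  have G0 z : ~ G z by move=> /xG.
  apply: (maxG [set z | exists t : R, z = (t *: x0, t * p x0)]).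
    split; last by move=> h; apply: (G0 (x0, p x0)); apply: h; exists 1;
      rewrite scale1r mul1r.
    by move=> z /G0.
  split.
  - move=> a _ _ [t ->] [s ->] /=; exists (a * t + s).
    by rewrite !(scalerDl, mulrDl) scalerA mulrA.
  - move=> _ [t ->] /=; have [t0|t0] := leP 0 t; first by rewrite p_homog.
    have nt0 : 0 <= - t by rewrite oppr_ge0 ltW.
    have := p_subadd (t *: x0) ((- t) *: x0).
    by rewrite -scalerDl subrr scale0r p0 (p_homog x0 nt0); lra.
  - by move=> _ _; exists 1; rewrite scale1r mul1r.
have Gtot x : exists r, G (x, r).
  have [c dc] := graph_extend x lG dG Gx0.
  set G' := [set z | _] in dc.
  have GG' : G `<=` G'.
    by move=> z Gz; exists z => //; exists 0; rewrite scale0r mul0r !addr0 -surjective_pairing.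
  apply: contrapT => nx; apply: (maxG G'); first split => //.
    move=> G'G; apply: nx; exists c; apply: G'G; exists (0, 0).
      exact: graph0 lG Gx0.
    by exists 1; rewrite scale1r mul1r !add0r.
  split => //; last by move=> _ _; exact: GG'.
  move=> a _ _ [z Gz [t ->]] [w Gw [s ->]] /=.
  exists (a *: z.1 + w.1, a * z.2 + w.2); first exact: lG.
  exists (a * t + s) => /=; congr (_, _); last by ring.
  by rewrite !scalerDr !scalerDl scalerA addrACA.
have [lam lamG] := choice Gtot.
exists lam; split.
- move=> a x y; apply: (graph_fun lG dG (lamG _)).
  exact: (lG a _ _ (lamG x) (lamG y)).
- by move=> x; exact: dG (lamG x).
- exact: (graph_fun lG dG (lamG _)).
Qed.

End HahnBanach.

Section Separation.
Context (R : realType) (V : tvsType R).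

Lemma convex_nbhs0 (U : set V) : nbhs 0 U -> exists W : set V,
  [/\ nbhs 0 W, W `<=` U & forall (a : R) x y, 0 <= a <= 1 ->
    W x -> W y -> W (a *: x + (1 - a) *: y)].
Proof.
move=> U0; have [B Bconv [Bopen Bbase]] := @locally_convex R V.
have [W [BW W0] WU] := Bbase _ _ U0; exists W; split => //.
  by apply: open_nbhs_nbhs; split => //; exact: Bopen.
move=> a x y a01 Wx Wy.
have := Bconv W (mem_set BW) x y (@Itv01 R a (proj1 (andP a01)) (proj2 (andP a01))).
by move=> /(_ (mem_set Wx) (mem_set Wy)); rewrite inE.
Qed.

(** If [lam <= 1] on [W], then [|lam (x - y)| <= e] as soon as both
   [(y - x) / e] and [(x - y) / e] lie in [W]. *)
Lemma continuous_linear0 (lam : V -> R) :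
  (forall (a : R) x y, lam (a *: x + y) = a * lam x + lam y) ->
  (exists2 W : set V, nbhs 0 W & forall x, W x -> lam x <= 1) ->
  continuous lam.
Proof.
move=> lin [W W0 Wle] x.
have lam0 : lam 0 = 0.
  by have := lin 1 0 0; rewrite scale1r mul1r addr0; lra.
have lamZ a y : lam (a *: y) = a * lam y by have := lin a y 0; rewrite lam0 !addr0.
have lamD y z : lam (y + z) = lam y + lam z by have := lin 1 y z; rewrite scale1r mul1r.
apply/cvgrPdist_le => e e0.
have e1 : e^-1 != 0 by rewrite invr_neq0// gt_eqF.
have sc (c : R) : \forall y \near x, W (c *: (y - x)).
  have : {for x, continuous (fun y : V => c *: (y - x))}.
    have -> : (fun y : V => c *: (y - x)) = (fun y : V => c *: y - c *: x) by apply/funext =>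
        y; rewrite scalerBr.
    have h1 : {for x, continuous (fun y : V => (c, y) : R^o * V)}.
      by apply: (@cvg_pair _ _ _ _ (nbhs (c : R^o))); [exact: cvg_cst|exact: cvg_id].
    have h2 := @continuous_comp _ _ _ (fun y : V => (c, y) : R^o * V) (fun z : R^o * V => z.1
        *: z.2) x h1 (@scale_continuous R V _).
    have h3 : {for x, continuous (fun y : V => (c *: y, c *: x))}.
      by apply: cvg_pair; [exact: h2|exact: cvg_cst].
    exact: (@continuous_comp _ _ _ _ (fun z : V * V => z.1 - z.2) x h3 (@sub_continuous V _)).
  by move=> /(_ W); rewrite /continuous_at /= subrr scaler0 => /(_ W0).
near=> y.
have h1 : W (e^-1 *: (y - x)) by near: y; exact: sc.
have h2 : W (- e^-1 *: (y - x)) by near: y; exact: sc.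
have lamN z : lam (- z) = - lam z by rewrite -scaleN1r lamZ mulN1r.
move: (Wle _ h1) (Wle _ h2); rewrite !lamZ lamD lamN.
rewrite mulNr => a b.
have -> : lam x - lam y = e * - (e^-1 * (lam y - lam x)).
  by rewrite mulrN mulrA divff ?gt_eqF// mul1r opprB.
rewrite normrM normrN gtr0_norm// ler_piMr ?(ltW e0)// ler_norml.
by apply/andP; split => //; lra.
Unshelve. all: by end_near. Qed.

(** The gauge [p] of a convex neighborhood [W] of 0 that avoids [v] is sublinear
   with [p v >= 1]; a linear form below [p] that attains it at [v] is bounded by
   1 on [W], hence continuous. *)
Theorem separating_form (v : V) : hausdorff_space V -> v != 0 ->
  exists lam : V -> R, [/\ forall (a : R) x y, lam (a *: x + y) = a * lam x + lam y,
    continuous lam & lam v != 0].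
Proof.
move=> hV v0.
have [U U0 Uv] : exists2 U : set V, nbhs 0 U & ~ U v.
  apply: contrapT => h; move/eqP: v0; apply; apply: esym; apply: hV => A B A0 Bv.
  exists v; split; last exact: nbhs_singleton.
  by apply: contrapT => nAv; apply: h; exists A.
have [W [W0 WU Wconv]] := convex_nbhs0 U0.
have Wv : ~ W v by move/WU.
have W00 : W 0 := nbhs_singleton W0.
(* The gauge of [W] at [x] is the infimum of [A x]. *)
pose A x := [set r : R | 0 < r /\ W (r^-1 *: x)].
have A0 x : exists r, A x r.
  have : {for (0 : R), continuous (fun c : R^o => c *: x)}.
    have h1 : {for (0:R), continuous (fun c : R^o => (c, x) : R^o * V)}.
      by apply: (@cvg_pair _ _ _ _ (nbhs (0 : R^o))); [exact: cvg_id|exact: cvg_cst].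
    exact: (@continuous_comp _ _ _ (fun c : R^o => (c, x) : R^o * V) (fun z : R^o * V => z.1 *:
        z.2) 0 h1 (@scale_continuous R V _)).
  move=> /(_ W); rewrite /continuous_at scale0r => /(_ W0) /nbhs_ballP[e /= e0 He].
  exists (2 / e); split; first by rewrite divr_gt0.
  rewrite invf_div; apply: He; rewrite /ball /= sub0r normrN gtr0_norm ?divr_gt0//.
  by rewrite ltr_pdivrMr// ltr_pMr// ltr1n.
have Alb x : lbound (A x) 0 by move=> r [/ltW].
have Ainf x : has_inf (A x) by split; [exact: A0|exists 0; exact: Alb].
pose p x := inf (A x).
have Aup x r s : A x r -> r <= s -> A x s.
  move=> [r0 Wr] rs; have s0 := lt_le_trans r0 rs; split => //.
  have := Wconv (r / s) (r^-1 *: x) 0; rewrite scalerA mulrAC divff ?gt_eqF// mul1r.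
  rewrite scaler0 addr0; apply => //; apply/andP; split.
    by rewrite divr_ge0// ltW.
  by rewrite ler_pdivrMr// mul1r.
have pge x r : A x r -> p x <= r by move=> Ar; apply: ge_inf => //; exists 0; exact: Alb.
have plt x r : p x < r -> A x r.
  move=> pr; have [s As sr] := inf_lt (A0 x) pr.
  exact: Aup As (ltW sr).
have psub x y : p (x + y) <= p x + p y.
  apply/ler_addgt0Pr => e e0.
  have [r0 Wr] : A x (p x + e / 2) by apply: plt; rewrite ltrDl divr_gt0.
  have [s0 Ws] : A y (p y + e / 2) by apply: plt; rewrite ltrDl divr_gt0.
  set r := p x + e / 2 in r0 Wr; set s := p y + e / 2 in s0 Ws.
  have -> : p x + p y + e = r + s by rewrite /r /s; lra.
  apply: pge; split; first exact: addr_gt0.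
  have rsp : 0 < r + s by exact: addr_gt0.
  have rs0 : r + s != 0 by rewrite gt_eqF.
  have := Wconv (r / (r + s)) (r^-1 *: x) (s^-1 *: y); rewrite !scalerA.
  have -> : r / (r + s) / r = (r + s)^-1 by field; rewrite rs0 gt_eqF.
  have -> : (1 - r / (r + s)) / s = (r + s)^-1 by field; rewrite rs0 gt_eqF.
  rewrite -scalerDr; apply => //.
  apply/andP; split; first by rewrite divr_ge0// ltW.
  by rewrite ler_pdivrMr// mul1r lerDl ltW.
have p00 : p 0 = 0.
  apply/eqP; rewrite eq_le; apply/andP; split; last by apply: lb_le_inf; [exact: A0|exact: Alb].
  apply/ler_addgt0Pr => e e0; rewrite add0r; apply: pge; split => //.
  by rewrite scaler0.
have phom (a : R) x : 0 <= a -> p (a *: x) = a * p x.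
  rewrite le_eqVlt => /predU1P[<-|a0]; first by rewrite scale0r mul0r p00.
  have half (b : R) y : 0 < b -> p (b *: y) <= b * p y.
    move=> b0; rewrite -ler_pdivrMl//; apply/ler_addgt0Pr => e e0.
    have [r0 Wr] : A y (p y + e) by apply: plt; rewrite ltrDl.
    rewrite ler_pdivrMl//; apply: pge; split; first exact: mulr_gt0.
    by rewrite scalerA invfM mulrAC mulVf ?gt_eqF// mul1r.
  apply/eqP; rewrite eq_le half//= -ler_pdivlMl//.
  have := half a^-1 (a *: x); rewrite scalerA mulVf ?gt_eqF// scale1r invr_gt0.
  exact.
have [lam [lin lamp lamv]] := hahn_banach psub phom v.
exists lam; split => //.
  apply: continuous_linear0 => //; exists W => // x Wx.
  apply: le_trans (lamp x) _; apply: pge; split => //.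
  by rewrite invr1 scale1r.
rewrite lamv gt_eqF//; apply: (@lt_le_trans _ _ 1) => //.
apply: lb_le_inf => // r Ar; rewrite leNgt; apply/negP => r1.
by have [_] := Aup _ _ _ Ar (ltW r1); rewrite invr1 scale1r.
Qed.

End Separation.

(** * Dominated series and iterated sums *)

Section DominatedSeries.
Context (R : realType) (V : completeNormedModType R).
Implicit Types (f g : nat -> V) (D : nat -> R).

Lemma is_cvg_series_dominated f D :
  (forall j, `|f j| <= D j) -> cvgn (series D) -> cvgn (series f).
Proof.
move=> fD cD; apply: normed_cvg.
apply: (series_le_cvg _ _ _ cD) => n; [exact: normr_ge0| |exact: fD].
exact: le_trans (normr_ge0 (f n)) (fD n).
Qed.

Lemma dominated_series_tail f D s d N : (forall j, `|f j| <= D j) ->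
  series f @ \oo --> s -> series D @ \oo --> d ->
  `|s - series f N| <= d - series D N.
Proof.
move=> fD fs Dd.
have fN : (fun n => `|series f n - series f N|) @ \oo --> `|s - series f N|.
  by apply: cvg_norm; apply: cvgB => //; exact: cvg_cst.
have DN : (fun n => series D n - series D N) @ \oo --> d - series D N.
  by apply: cvgB => //; exact: cvg_cst.
apply: ler_cvg_to fN DN _; near=> n.
have Nn : (N <= n)%N by near: n; exists N.
rewrite /= !sub_series_geq//;  apply: le_trans (ler_norm_sum _ _ _) _.
by apply: ler_sum => i _; exact: fD.
Unshelve. all: by end_near. Qed.

Lemma dominated_series_norm f D s d : (forall j, `|f j| <= D j) ->
  series f @ \oo --> s -> series D @ \oo --> d -> `|s| <= d.
Proof.
move=> fD fs Dd; have := dominated_series_tail 0 fD fs Dd.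
by rewrite /series /= !big_nil !subr0.
Qed.

(** Tannery's theorem: the tails of all the series [a n] are bounded by the
   tails of [D], and the partial sums converge. *)
Lemma dominated_series_cvg (a : nat -> nat -> V) f D (s : nat -> V) :
  (forall j, a n j @[n --> \oo] --> f j) -> (forall n j, `|a n j| <= D j) ->
  cvgn (series D) -> (forall n, series (a n) @ \oo --> s n) ->
  exists2 t : V, series f @ \oo --> t & s @ \oo --> t.
Proof.
move=> af aD cD as_.
have fD j : `|f j| <= D j.
  have h : (fun n => `|a n j|) @ \oo --> `|f j| by apply: cvg_norm; exact: af.
  by apply: ler_cvg_to h (@cvg_cst _ (D j) _ _ _) _; exact: nearW.
have cf := is_cvg_series_dominated fD cD.
exists (limn (series f)) => //.
set t := limn _; have ft : series f @ \oo --> t by [].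
set d := limn (series D); have Dd : series D @ \oo --> d by [].
apply/cvgrPdist_lt => e e0.
have e3 : 0 < e / 3 by rewrite divr_gt0.
have [N _ HN] := (iffLR (@cvgrPdist_lt _ _ _ _ _ _ _) Dd) _ e3.
have dN : d - series D N < e / 3.
  by apply: le_lt_trans (HN N (leqnn N)); exact: ler_norm.
have aN : (fun n => series (a n) N) @ \oo --> series f N.
  by apply: cvg_big => [|i _]; [exact: (@add_continuous V)|exact: af].
near=> n.
have -> : t - s n = (t - series f N) + (series f N - series (a n) N) - (s n - series (a n) N).
  by rewrite [X in _ = X - _]addrA subrK opprB addrA subrK.
have -> : e = e / 3 + e / 3 + e / 3 by field.
apply: le_lt_trans (ler_normB _ _) _; apply: ltrD; last first.
  exact: le_lt_trans (dominated_series_tail N (aD n) (as_ n) Dd) dN.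
apply: le_lt_trans (ler_normD _ _) _; apply: ltrD.
  exact: le_lt_trans (dominated_series_tail N fD ft Dd) dN.
near: n; have := (iffLR (@cvgrPdist_lt _ _ _ _ _ _ _) aN) _ e3.
exact.
Unshelve. all: by end_near. Qed.

End DominatedSeries.

Section ExpBounds.
Context (R : realType).
Implicit Types x y h : R.

Lemma expR_ge1 x : 0 <= x -> 1 <= expR x.
Proof. by rewrite -[X in X <= expR _]expR0 ler_expR. Qed.

Lemma pow_le_fact_expR x n : 0 <= x -> x ^+ n <= n`!%:R * expR x.
Proof.
move=> x0; case: n => [|n]; first by rewrite expr0 fact0 mul1r expR_ge1.
have f0 : 0 < (n.+1)`!%:R :> R by rewrite ltr0n fact_gt0.
rewrite -ler_pdivrMl// mulrC; apply: le_trans (expR_ge1Dxn n x0).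
by rewrite lerDr.
Qed.

Lemma norm_expRB1_le y : `|expR y - 1| <= `|y| * expR `|y|.
Proof.
have h1 := expR_ge1Dx y; have := expR_ge1Dx (- y); rewrite expRN => h2.
have ey := expR_gt0 y.
have h3 : expR y - 1 <= y * expR y.
  have := ler_wpM2l (ltW ey) h2; rewrite divff ?gt_eqF//; lra.
have [y0|y0] := leP 0 y.
  by rewrite (ger0_norm y0) ger0_norm// subr_ge0 expR_ge1.
have e1 : expR y <= 1 by rewrite -expR0 ler_expR ltW.
rewrite (ler0_norm (ltW y0)) ler0_norm ?subr_le0//.
have : - y <= - y * expR (- y) by rewrite ler_peMr ?expR_ge1 ?oppr_ge0 ?ltW.
by lra.
Qed.

Lemma norm_expRB1D_le y : `|expR y - 1 - y| <= `|y| ^+ 2 * expR `|y|.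
Proof.
have h1 := expR_ge1Dx y; have := expR_ge1Dx (- y); rewrite expRN => h2.
have ey := expR_gt0 y.
have h3 : expR y - 1 <= y * expR y.
  have := ler_wpM2l (ltW ey) h2; rewrite divff ?gt_eqF//; lra.
rewrite ger0_norm; last by lra.
apply: (@le_trans _ _ (`|y * (expR y - 1)|)).
  by apply: le_trans (ler_norm _); lra.
by rewrite normrM expr2 -mulrA ler_wpM2l// norm_expRB1_le.
Qed.

Lemma expRB1_quotient_cvg (h : nat -> R) x : (forall n, 0 < h n <= 1) ->
  h @ \oo --> 0 -> (fun n => (expR (h n * x) - 1) / h n) @ \oo --> x.
Proof.
move=> h01 h0; apply/cvgrPdist_le => e e0.
pose C := `|x| ^+ 2 * expR `|x| + 1.
have C0 : 0 < C by rewrite ltr_wpDl// mulr_ge0// expR_ge0.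
have /cvgrPdist_le /(_ (e / C)) := h0; rewrite divr_gt0// => /(_ isT).
apply: filterS => n; rewrite sub0r normrN.
have /andP[hn0 hn1] := h01 n; rewrite gtr0_norm// => hC.
have -> : x - (expR (h n * x) - 1) / h n = - ((expR (h n * x) - 1 - h n * x) / h n).
  by field; rewrite gt_eqF.
rewrite normrN normrM normfV (gtr0_norm hn0) ler_pdivrMr//.
apply: le_trans (norm_expRB1D_le _) _.
rewrite normrM (gtr0_norm hn0) exprMn.
have : h n ^+ 2 * `|x| ^+ 2 * expR (h n * `|x|) <= h n * (h n * C).
  rewrite mulrA -expr2 -mulrA ler_wpM2l ?sqr_ge0//.
  apply: (@le_trans _ _ (`|x| ^+ 2 * expR `|x|)); last by rewrite /C lerDl.
  by rewrite ler_wpM2l ?sqr_ge0// ler_expR ler_piMl.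
move=> /le_trans; apply; rewrite [leRHS]mulrC.
have hCe : h n * C <= e by rewrite -ler_pdivlMr.
by rewrite ler_wpM2l// ltW.
Qed.

End ExpBounds.

Section DoubleSum.
Context (R : realType).
Implicit Types (f g D : nat -> nat -> R).

(** Iterated sum, rows first. No absolute convergence is built in; where it is
   needed, a dominating array is given separately. *)
Definition double_sum f (s : R) := exists2 r : nat -> R,
  forall j, series (f j) @ \oo --> r j & series r @ \oo --> s.

Lemma eq_double_sum f g s : (forall j i, f j i = g j i) ->
  double_sum f s -> double_sum g s.
Proof.
by move=> fg; have -> : f = g by apply/funext => j; apply/funext => i.
Qed.

Lemma double_sumD f g s t : double_sum f s -> double_sum g t ->
  double_sum (fun j i => f j i + g j i) (s + t).
Proof.
move=> [r fr rs] [r' gr' rt]; exists (r + r'); last first.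
  by rewrite seriesD; exact: cvgD.
move=> j; have -> : series (fun i => f j i + g j i) = series (f j) + series (g j).
  exact: (seriesD (f j) (g j)).
exact: cvgD.
Qed.

Lemma double_sumZ (c : R) f s : double_sum f s ->
  double_sum (fun j i => c * f j i) (c * s).
Proof.
move=> [r fr rs]; exists (c *: r); last by rewrite seriesZ; exact: cvgMl_tmp.
move=> j; have -> : series (fun i => c * f j i) = c *: series (f j).
  exact: (seriesZ (f j) c).
exact: cvgMl_tmp.
Qed.

Lemma double_sum0 : double_sum (fun _ _ => 0) 0.
Proof.
have s0 : series (fun _ : nat => 0 : R) = fun=> 0.
  by apply/funext => n; rewrite /series /= big1.
by exists (fun=> 0) => [j|]; rewrite s0; exact: cvg_cst.
Qed.

Lemma double_sum_cvg (a : nat -> nat -> nat -> R) f D (s : nat -> R) d :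
  (forall j i, a n j i @[n --> \oo] --> f j i) ->
  (forall n j i, `|a n j i| <= D j i) -> double_sum D d ->
  (forall n, double_sum (a n) (s n)) ->
  exists2 t : R, double_sum f t & s @ \oo --> t.
Proof.
move=> af aD [dr Ddr drd] as_.
have [n|r ar] := @choice nat (nat -> R) (fun n q =>
    (forall j, series (a n j) @ \oo --> q j) /\ series q @ \oo --> s n).
  by have [q h1 h2] := as_ n; exists q.
have h j : exists t : R, series (f j) @ \oo --> t /\ r ^~ j @ \oo --> t.
  have cD : cvgn (series (D j)) by apply/cvg_ex; exists (dr j); exact: Ddr.
  have [t ft rt] := dominated_series_cvg (af j) (aD^~ j) cD (fun n => (ar n).1 j).
  by exists t.
have [q hq] := choice h.
have cd : cvgn (series dr) by apply/cvg_ex; exists d.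
have rd n j : `|r n j| <= dr j.
  exact: dominated_series_norm (aD n j) ((ar n).1 j) (Ddr j).
have [t qt st] := dominated_series_cvg (fun j => (hq j).2) rd cd (fun n => (ar n).2).
by exists t => //; exists q => // j; exact: (hq j).1.
Qed.

Lemma double_sum_dominated f D d : (forall j i, `|f j i| <= D j i) ->
  double_sum D d -> exists s, double_sum f s.
Proof.
move=> fD [dr Ddr drd].
have cf j : cvgn (series (f j)).
  by apply: is_cvg_series_dominated (fD j) _; apply/cvg_ex; exists (dr j); exact: Ddr.
pose r j := limn (series (f j)).
have rd j : `|r j| <= dr j by exact: dominated_series_norm (fD j) (cf j) (Ddr j).
have cr : cvgn (series r).
  by apply: is_cvg_series_dominated rd _; apply/cvg_ex; exists d.
by exists (limn (series r)); exists r.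
Qed.

End DoubleSum.

(** * Coefficients of two-sided Laurent series on a real interval *)

(** On a complex annulus the coefficients of a two-sided Laurent series are
   Fourier coefficients of its values on a circle. Here the series is only known
   on the ray [t = e^s] with [s < sigma], where it vanishes. Its coefficient of
   [t^0] is recovered from the moments [sum_n b_n n^k], the iterated logarithmic
   derivatives at one point [e^s0], by means of the polynomials
   [prod_(1 <= k <= K) (1 - x^2 / k^2)]: at each integer these are eventually
   equal to the indicator of 0, and there they are bounded by [e^(2|x|)], a
   growth that the series absorbs since it still converges at [e^(s0 + 2)] and
   at [e^(s0 - 2)]. The series is given as an array of terms [D j i t^(x j i)]
   in which each exponent may occur many times. *)
Section LaurentCoefficient.
Context (R : realType) (D : nat -> nat -> R) (x : nat -> nat -> int) (sigma : R).

Let E s j i : R := D j i * expR ((x j i)%:~R * s).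

Hypothesis E_abs : forall s, s < sigma ->
  exists d, double_sum (fun j i => `|E s j i|) d.
Hypothesis E0 : forall s, s < sigma -> double_sum (E s) 0.

(** The two points [s0 + 2] and [s0 + th] with [th < 1] must stay below [sigma]. *)
Let s0 := sigma - 3.
Let xr j i : R := (x j i)%:~R.
Let w := E s0.
Let bnd j i : R := `|w j i| * expR (2 * `|xr j i|).

(** [e^(2|x|)] is at most [e^(2x) + e^(-2x)]: shift [s0] by 2 in both directions. *)
Let bnd_sum : exists d, double_sum bnd d.
Proof.
have [d1 h1] := @E_abs (s0 + 2) ltac:(rewrite /s0; lra).
have [d2 h2] := @E_abs (s0 - 2) ltac:(rewrite /s0; lra).
apply: double_sum_dominated (double_sumD h1 h2) => j i.
rewrite /bnd /w /E -/(xr j i) !normrM !(gtr0_norm (expR_gt0 _)) normr_id.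
rewrite -mulrA -mulrDr ler_wpM2l// -expRD.
have [x0|x0] := leP 0 (xr j i).
  rewrite (ger0_norm x0) (_ : _ + _ = xr j i * (s0 + 2)); last by ring.
  by rewrite lerDl expR_ge0.
rewrite (ltr0_norm x0) (_ : _ + _ = xr j i * (s0 - 2)); last by ring.
by rewrite lerDr expR_ge0.
Qed.

(** Differentiation in [s] under the sum: a power of [x] is the limit of
   difference quotients of exponentials, along a sequence [h n] tending to 0. *)
Let moment_exp k th : 0 <= th < 1 ->
  double_sum (fun j i => w j i * xr j i ^+ k * expR (th * xr j i)) 0.
Proof.
elim: k th => [|k IHk] th /andP[th0 th1].
  apply: eq_double_sum (E0 (_ : s0 + th < sigma)); last by rewrite /s0; lra.
  by move=> j i; rewrite /w /E -/(xr j i) expr0 mulr1 -mulrA -expRD; congr (_ * expR _); ring.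
pose h n : R := (1 - th) * (n.+2)%:R^-1.
have h01 n : 0 < h n <= 1.
  have n2 : 0 < (n.+2)%:R :> R by rewrite ltr0n.
  rewrite /h divr_gt0 ?subr_gt0//= ler_pdivrMr// mul1r.
  by apply: (@le_trans _ _ 1); [lra|rewrite ler1n].
have thh n : 0 <= th + h n < 1.
  have /andP[hn0 _] := h01 n; apply/andP; split; first by lra.
  suff : h n < 1 - th by lra.
  by rewrite /h gtr_pMr ?subr_gt0// invf_lt1 ?ltr0n// ltr1n.
have h0 : h @ \oo --> 0.
  rewrite -(mulr0 (1 - th)); apply: cvgMl_tmp.
  have := @cvg_harmonic R; rewrite -(cvg_shiftS (@harmonic R)); exact.
pose a n j i := (h n)^-1 * (w j i * xr j i ^+ k * expR ((th + h n) * xr j i))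
  + (- (h n)^-1) * (w j i * xr j i ^+ k * expR (th * xr j i)).
have aE n j i : a n j i = w j i * xr j i ^+ k * expR (th * xr j i) * ((expR (h n * xr j i) - 1)
    / h n).
  by rewrite /a mulrDl expRD; ring.
have [d hd] := bnd_sum.
have [||||t ft st] := @double_sum_cvg R a (fun j i => w j i * xr j i ^+ k.+1 * expR (th * xr j
    i)) (fun j i => (k.+1)`!%:R * bnd j i) (fun=> 0) ((k.+1)`!%:R * d).
- move=> j i; under eq_fun do rewrite aE.
  have -> : w j i * xr j i ^+ k.+1 * expR (th * xr j i) = w j i * xr j i ^+ k * expR (th * xr j
      i) * xr j i by rewrite exprSr; ring.
  by apply: cvgMl_tmp; exact: expRB1_quotient_cvg.
- move=> n j i; rewrite aE /bnd; move: (w j i) => W.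
  rewrite !normrM normrX (gtr0_norm (expR_gt0 (th * _))).
  have /andP[hn0 hn1] := h01 n; rewrite normfV (gtr0_norm hn0).
  set X : R := `|xr j i|; have X0 : 0 <= X by exact: normr_ge0.
  have e1 : `|expR (h n * xr j i) - 1| / h n <= X * expR (h n * X).
    rewrite ler_pdivrMr//; apply: le_trans (norm_expRB1_le _) _.
    rewrite normrM (gtr0_norm hn0) -/X le_eqVlt; apply/orP; left.
    by apply/eqP; ring.
  have e2 : expR (th * xr j i) <= expR (th * X).
    by rewrite ler_expR ler_wpM2l// ler_norm.
  have e3 : expR (th * X) * expR (h n * X) <= expR X.
    rewrite -expRD -mulrDl ler_expR ler_piMl//; have /andP[_ /ltW] := thh n; exact.
  have e4 := pow_le_fact_expR k.+1 X0.
  have -> : `|W| * X ^+ k * expR (th * xr j i) * (`|expR (h n * xr j i) - 1| / h n) = `|W| * (X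
      ^+ k * (expR (th * xr j i) * (`|expR (h n * xr j i) - 1| / h n))) by ring.
  have -> : (k.+1)`!%:R * (`|W| * expR (2 * X)) = `|W| * ((k.+1)`!%:R * expR X * expR X).
    by rewrite -(mulrA _ (expR X)) -expRD (_ : 2 * X = X + X); [ring|lra].
  rewrite ler_wpM2l//.
  apply: (@le_trans _ _ (X ^+ k * (expR (th * X) * (X * expR (h n * X))))).
    rewrite ler_wpM2l ?exprn_ge0//; apply: ler_pM => //.
    by rewrite mulr_ge0// invr_ge0 ltW.
  have -> : X ^+ k * (expR (th * X) * (X * expR (h n * X))) = X ^+ k.+1 * (expR (th * X) * expR
      (h n * X)) by rewrite exprSr; ring.
  apply: ler_pM; [exact: exprn_ge0|by rewrite mulr_ge0 ?expR_ge0|exact: e4|exact: e3].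
- exact: double_sumZ.
- move=> n; rewrite (_ : 0 = (h n)^-1 * 0 + (- (h n)^-1) * 0); last by rewrite !mulr0 addr0.
  apply: double_sumD; apply: double_sumZ; first exact: IHk.
  by apply: IHk; rewrite th0.
- by have <- : t = 0 := cvg_unique _ st (@cvg_cst _ (0 : R) _ _ _).
Qed.

Let moment_poly (p : {poly R}) : double_sum (fun j i => w j i * p.[xr j i]) 0.
Proof.
apply: (@eq_double_sum _ (fun j i => \sum_(k < size p) p`_k * (w j i * xr j i ^+ k * expR (0 *
    xr j i)))).
  move=> j i; rewrite horner_coef mulr_sumr; apply: eq_bigr => k _.
  by rewrite mul0r expR0; ring.
elim: (size p) => [|n IHn].
  by apply: eq_double_sum (@double_sum0 R) => j i; rewrite big_ord0.
apply: (@eq_double_sum _ (fun j i => (\sum_(k < n) p`_k * (w j i * xr j i ^+ k * expR (0 * xr j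
    i))) +  p`_n * (w j i * xr j i ^+ n * expR (0 * xr j i)))).
  by move=> j i; rewrite big_ord_recr.
have m0 : double_sum (fun j i => w j i * xr j i ^+ n * expR (0 * xr j i)) 0.
  by apply: moment_exp; rewrite lexx ltr01.
by have := double_sumD IHn (double_sumZ p`_n m0); rewrite mulr0 addr0.
Qed.

Let sieve K : {poly R} := \prod_(1 <= k < K.+1) (1 - (k%:R ^- 2) *: 'X^2).

Let sieveE K y : (sieve K).[y] = \prod_(1 <= k < K.+1) (1 - (y / k%:R) ^+ 2).
Proof.
rewrite /sieve horner_prod; apply: eq_bigr => k _.
by rewrite hornerD hornerN hornerZ hornerXn -polyC1 hornerC expr_div_n mulrC.
Qed.

Let sieve_int K (m : int) : (`|m| <= K)%N -> (sieve K).[m%:~R] = (m == 0)%:R.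
Proof.
move=> mK; rewrite sieveE; have [->|m0] := eqVneq m 0.
  by rewrite big1// => k _; rewrite mul0r expr0n subr0.
have m1 : (1 <= `|m|)%N by rewrite absz_gt0.
rewrite (bigD1_seq `|m|%N) ?iota_uniq ?mem_index_iota ?m1 ?ltnS//=.
have m2 : (`|m|%N)%:R ^+ 2 = m%:~R ^+ 2 :> R.
  by rewrite natr_absz intr_norm real_normK// num_real.
by rewrite expr_div_n m2 divff ?subrr ?mul0r// expf_neq0// intr_eq0.
Qed.

(** An integer beyond [K] satisfies [|m| / k >= 1] for all [k <= K], so that the
   product is at most [(|m|^K / K!)^2]. *)
Let sieve_le K (m : int) : `|(sieve K).[m%:~R]| <= expR (2 * `|m%:~R|).
Proof.
have [mK|Km] := leqP `|m| K.
  rewrite sieve_int//; case: eqP => _; rewrite ?normr1 ?normr0 ?expR_ge0//.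
  by rewrite expR_ge1// mulr_ge0.
rewrite sieveE; set y : R := m%:~R.
have y0 : 0 <= `|y| by [].
apply: (@le_trans _ _ (\prod_(1 <= k < K.+1) (`|y| / k%:R) ^+ 2)).
  rewrite normr_prod big_nat [leRHS]big_nat; apply: ler_prod => k /andP[k1 kK]; rewrite normr_ge0/=.
  have ky : 1 <= `|y| / k%:R.
    rewrite ler_pdivlMr ?ltr0n// mul1r /y -intr_norm -natr_absz ler_nat.
    by rewrite ltnS in kK; rewrite ltnW// (leq_ltn_trans kK).
  have y2 : (y / k%:R) ^+ 2 = (`|y| / k%:R) ^+ 2.
    by rewrite !expr_div_n real_normK// num_real.
  rewrite y2 ler0_norm; last by rewrite subr_le0 expr_ge1// (le_trans _ ky).
  by rewrite opprB lerBlDr lerDl.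
have -> : \prod_(1 <= k < K.+1) (`|y| / k%:R) ^+ 2 = (`|y| ^+ K / K`!%:R) ^+ 2.
  rewrite prodrXl; congr (_ ^+ 2).
  elim: K {Km} => [|K IHK]; first by rewrite big_nil expr0 fact0 divr1.
  rewrite big_nat_recr//= IHK exprSr factS natrM.
  by rewrite mulf_div; congr (_ / _); rewrite mulrC.
have -> : expR (2 * `|y|) = expR `|y| ^+ 2 by rewrite expr2 -expRD; congr expR; lra.
rewrite lerXn2r ?nnegrE ?expR_ge0 ?divr_ge0 ?exprn_ge0//.
rewrite ler_pdivrMr ?ltr0n ?fact_gt0// mulrC; exact: pow_le_fact_expR.
Qed.

Theorem laurent_coef0 : double_sum (fun j i => D j i * (x j i == 0)%:R) 0.
Proof.
have [d hd] := bnd_sum.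
have [||||t ft st] := @double_sum_cvg R (fun K j i => w j i * (sieve K).[xr j i]) (fun j i => w
    j i * (x j i == 0)%:R) bnd (fun=> 0) d.
- move=> j i; apply: cvgMl_tmp; apply: cvg_near_cst; near=> K.
  apply: sieve_int; near: K; exact: nbhs_infty_ge.
- move=> K j i; rewrite /bnd normrM ler_wpM2l//; exact: sieve_le.
- exact: hd.
- by move=> K; exact: moment_poly.
rewrite (_ : 0 = t); last exact: cvg_unique _ (@cvg_cst _ (0 : R) _ _ _) st.
apply: eq_double_sum ft => j i; rewrite /w /E.
by case: eqP => [->|_]; rewrite ?mulr0// mul0r expR0 !mulr1.
Unshelve. all: by end_near. Qed.

End LaurentCoefficient.

(** * Divided powers and simplex integrals *)

Section IntervalIntegrals.
Context (R : realType).
Notation mu := (@lebesgue_measure R).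

(** Divided powers: the word [X^e] has coefficient [t^e / e!] in [e^(t X)]. *)
Definition dpow (e : nat) (t : R) : R := t ^+ e / e`!%:R.

Lemma dpow0 t : dpow 0 t = 1.
Proof. by rewrite /dpow expr0 fact0 divr1. Qed.

Lemma dpowS0 e : dpow e.+1 0 = 0.
Proof. by rewrite /dpow expr0n mul0r. Qed.

Lemma dpow_ge0 e t : 0 <= t -> 0 <= dpow e t.
Proof. by move=> t0; rewrite /dpow divr_ge0 ?exprn_ge0. Qed.

Lemma is_derive_dpow e (t : R) : is_derive t 1 (dpow e.+1) (dpow e t).
Proof.
have h : is_derive t 1 ((id : R^o -> R^o) ^+ e.+1) ((e.+1%:R * t ^+ e) *: (1 : R^o)).
  exact: is_deriveX.
have h2 : is_derive t 1 ((e.+1)`!%:R^-1 \*: ((id : R^o -> R^o) ^+ e.+1)) ((e.+1)`!%:R^-1 *: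
    ((e.+1%:R * t ^+ e) *: (1 : R^o))).
  exact: is_deriveZ.
have -> : dpow e.+1 = ((e.+1)`!%:R^-1 \*: ((id : R^o -> R^o) ^+ e.+1)).
  by apply/funext => u; rewrite /dpow mulrC exprfctE.
apply: is_derive_eq h2 _; rewrite /dpow factS natrM /GRing.scale /= mulr1.
have e0 : e.+1%:R != 0 :> R by rewrite pnatr_eq0.
have f0 : e`!%:R != 0 :> R by rewrite pnatr_eq0 -lt0n fact_gt0.
move: e0 f0; move: (e.+1%:R) (e`!%:R) => x y x0 y0.
by field; rewrite x0 y0.
Qed.

Lemma continuous_dpow e : continuous (dpow e).
Proof.
move=> t; apply: cvgMr_tmp; exact: exprn_continuous.
Qed.

Let derive_ooLR (F f : R -> R) (a b : R) : (forall t : R, is_derive t 1 F (f t)) ->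
  derivable_oo_LRcontinuous F a b.
Proof.
move=> dF; have cF : continuous F.
  by move=> t; apply: differentiable_continuous; apply/derivable1_diffP.
split; first by move=> t _; exact: ex_derive.
- by apply: cvg_at_right_filter; exact: cF.
- by apply: cvg_at_left_filter; exact: cF.
Qed.

Let continuous_integrable (f : R -> R) (s : R) : continuous f ->
  mu.-integrable `[0, s] (EFin \o f).
Proof.
move=> cf; apply: continuous_compact_integrable; first exact: segment_compact.
exact: continuous_subspaceT.
Qed.

Lemma Rintegral_dpow a s : 0 <= s ->
  \int[mu]_(t in `[0, s]) dpow a t = dpow a.+1 s.
Proof.
rewrite le_eqVlt => /predU1P[<-|s0].
  by rewrite set_itv1 Rintegral_set1 dpowS0.
have dF (t : R) : is_derive t 1 (dpow a.+1) (dpow a t) by exact: is_derive_dpow.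
rewrite /Rintegral (@continuous_FTC2 _ _ (dpow a.+1)) //.
- by rewrite /= dpowS0 subr0.
- by apply: continuous_subspaceT; exact: continuous_dpow.
- exact: derive_ooLR dF.
- by move=> t _; rewrite derive1E; apply: derive_val.
Qed.

Lemma continuous_dpow_sub b s : continuous (fun t => dpow b (s - t)).
Proof.
move=> t; apply: (@continuous_comp _ _ _ (fun t => s - t) (dpow b)); last exact: continuous_dpow.
by apply: cvgB; [exact: cvg_cst|exact: cvg_id].
Qed.

(** Euler's Beta integral, by integration by parts: the divided powers absorb
   the factorials, and an integration moves one unit from [b] to [a]. *)
Lemma Rintegral_dpow_dpow a b s : 0 <= s ->
  \int[mu]_(t in `[0, s]) (dpow a t * dpow b (s - t)) = dpow (a + b).+1 s.
Proof.
rewrite le_eqVlt => /predU1P[<-|s0].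
  by rewrite set_itv1 Rintegral_set1 dpowS0.
elim: b a => [|b IHb] a.
  rewrite addn0 -Rintegral_dpow ?ltW//; apply: eq_Rintegral => t _.
  by rewrite dpow0 mulr1.
rewrite addnS -addSn -IHb.
have dF (t : R) : is_derive t 1 (dpow a.+1) (dpow a t) by exact: is_derive_dpow.
have dG (t : R) : is_derive t 1 (fun t => dpow b.+1 (s - t)) (- dpow b (s - t)).
  have h1 : is_derive t 1 (fun t => s - t) (-1).
    have : is_derive t 1 (cst s - (id : R^o -> R^o)) (0 - (1 : R^o)) by exact: is_deriveB.
    by rewrite sub0r.
  have := @is_derive1_comp _ (dpow b.+1) (fun t => s - t) t _ _ (is_derive_dpow b (s - t)) h1.
  by rewrite /comp => h; apply: is_derive_eq h _; rewrite mulrN1.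
have := @Rintegration_by_parts _ (dpow a.+1) (fun t => dpow b.+1 (s - t)) (dpow a) (fun t => -
    dpow b (s - t)) 0 s s0.
rewrite subrr !dpowS0 mul0r mulr0 subrr sub0r => H.
have {H} H : \int[mu]_(x in `[0, s]) (dpow a.+1 x * - dpow b (s - x)) = - (\int[mu]_(x in `[0,
    s]) (dpow a x * dpow b.+1 (s - x))).
  apply: H.
  - by apply: continuous_subspaceT; exact: continuous_dpow.
  - exact: derive_ooLR dF.
  - by move=> t _; rewrite derive1E; apply: derive_val.
  - by apply: continuous_subspaceT => t; apply: cvgN; exact: continuous_dpow_sub.
  - exact: derive_ooLR dG.
  - by move=> t _; rewrite derive1E; apply: derive_val.
have Hn : \int[mu]_(x in `[0, s]) (dpow a.+1 x * - dpow b (s - x)) = - \int[mu]_(x in `[0, s])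
    (dpow a.+1 x * dpow b (s - x)).
  rewrite -[RHS]mulN1r -RintegralZl//.
    by apply: eq_Rintegral => t _; rewrite mulrN mulN1r.
  by apply: continuous_integrable => t; apply: cvgM; [exact: continuous_dpow|exact:
      continuous_dpow_sub].
by apply: oppr_inj; rewrite -H -Hn.
Qed.

Lemma Rintegral_sum (I : Type) (r : seq I) (c : I -> R) (f : I -> R -> R) s :
  (forall i, continuous (f i)) ->
  \int[mu]_(t in `[0, s]) (\sum_(i <- r) c i * f i t) =
  \sum_(i <- r) c i * \int[mu]_(t in `[0, s]) f i t.
Proof.
move=> cf; elim: r => [|i r IHr].
  rewrite big_nil (@eq_Rintegral _ _ _ mu _ (fun=> 0)); last by move=> t _; rewrite big_nil.
  by rewrite Rintegral_cst// mul0r.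
rewrite big_cons (@eq_Rintegral _ _ _ mu _ (fun t => c i * f i t + \sum_(j <- r) c j * f j t));
    last first.
  by move=> t _; rewrite big_cons.
rewrite RintegralD//.
- by rewrite IHr RintegralZl//; exact: continuous_integrable.
- by apply: continuous_integrable => t; apply: cvgMl_tmp; exact: cf.
- apply: continuous_integrable => t; apply: cvg_big => [|j _]; first exact: (@add_continuous R).
  by apply: cvgMl_tmp; exact: cf.
Qed.

Let measure_segment (s : R) : 0 <= s -> mu `[0, s] = s%:E.
Proof.
move=> s0; rewrite lebesgue_measure_itv/= lte_fin -EFinB.
by case: ltrgtP s0 => // [_ _|<- _]; rewrite ?subr0.
Qed.

Lemma norm_Rintegral_le (f : R -> R) (s C : R) : 0 <= s -> continuous f ->
  (forall t, 0 <= t <= s -> `|f t| <= C) ->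
  `|\int[mu]_(t in `[0, s]) f t| <= C * s.
Proof.
move=> s0 cf fC.
have -> : C * s = \int[mu]_(t in `[0, s]) (cst C t).
  rewrite Rintegral_cst//; congr (_ * _).
  exact: (congr1 fine (esym (measure_segment s0))).
apply: le_trans (le_normr_Rintegral _ _) _ => //; first exact: continuous_integrable.
apply: le_Rintegral => //.
- by apply: continuous_integrable => t; apply: cvg_norm; exact: cf.
- by apply: continuous_integrable => t; exact: cvg_cst.
Qed.

Lemma Rintegral_dominated_cvg (f : nat -> R -> R) (F : R -> R) (s C : R) :
  (forall n, measurable_fun `[0, s] (f n)) ->
  (forall t, 0 < t < s -> f ^~ t @ \oo --> F t) ->
  (forall n t, 0 <= t <= s -> `|f n t| <= C) ->
  (fun n => \int[mu]_(t in `[0, s]) f n t) @ \oo --> \int[mu]_(t in `[0, s]) F t.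
Proof.
move=> mf fF fC.
have mF : measurable_fun `[0, s] F.
  apply: (@measurable_fun_itv_cc _ _ _ false true).
  apply: (@measurable_fun_cvg _ _ _ _ f).
    by move=> n; apply: measurable_funS (mf n) => //; exact: subset_itv_oo_cc.
  by move=> t; rewrite /= in_itv/= => /fF.
have mus : (mu `[0%R, s] < +oo)%E.
  by rewrite lebesgue_measure_itv/=; case: ifP => // _; rewrite ltry.
have iC : mu.-integrable `[0, s] (EFin \o cst C).
  by apply: continuous_integrable => t; exact: cvg_cst.
have [|||||iF _ H] := @dominated_convergence _ _ _ mu `[0, s] (measurable_itv _) (fun n => EFin
    \o f n) (EFin \o F) (EFin \o cst C).
- by move=> n; apply/measurable_EFinP; exact: mf.
- by apply/measurable_EFinP; exact: mF.
- exists ([set 0] `|` [set s]); split.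
  + exact: measurableU.
  + by rewrite null_set_setU//; exact: lebesgue_measure_set1.
  + move=> t /= /not_implyP[]; rewrite in_itv/= => /andP[t0 ts] nF.
    have [->|tn0] := eqVneq t 0; [by left|right].
    apply: contrapT => /eqP tns; apply: nF; apply: cvg_EFin; first exact: nearW.
    by apply: fF; rewrite !lt_neqAle eq_sym tn0 t0 tns ts.
- exact: iC.
- by apply: aeW => t n; rewrite /= in_itv/= lee_fin => /fC.
apply: fine_cvg; rewrite fineK; first exact: H.
exact: integrable_fin_num.
Qed.

End IntervalIntegrals.

Section SimplexIntegrals.
Context (R : realType).
Notation mu := (@lebesgue_measure R).

(** The monomial of exponents [es] in divided powers. It vanishes unless there
   are as many times as exponents, which lets a sum over all words select the
   words with the right number of letters Y. *)
Fixpoint mono (es : seq nat) (ts : seq R) : R :=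
  match es, ts with
  | [::], [::] => 1
  | e :: es', t :: ts' => dpow e t * mono es' ts'
  | _, _ => 0
  end.

(** [simplex_int] integrates over the second time first, hence the removal of the
   exponent in position 1. *)
Let skip1 (es : seq nat) := if es is p :: _ :: es' then p :: es' else [::].

Let mono_skip1 es t0 t ts :
  mono es (t0 :: t :: ts) = dpow (nth 0 es 1)%N t * mono (skip1 es) (t0 :: ts).
Proof. by case: es => [|p [|k es]] /=; rewrite ?mulr0// mulrCA. Qed.

(** Dirichlet's integral, by iteration of the Beta integral. A sum is integrated
   at once because linearity of [simplex_int] would require integrability at
   each of its stages. *)
Lemma simplex_int_mono_sum (I : Type) n (r : seq I) (c : I -> R)
    (es : I -> seq nat) s : 0 <= s ->
  simplex_int n s (fun t0 ts => \sum_(i <- r) c i * mono (es i) (t0 :: ts)) =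
  \sum_(i <- r) c i * ((size (es i) == n.+1)%:R * dpow (sumn (es i) + n) s).
Proof.
elim: n c es s => [|n IHn] c es s s0 /=.
  apply: eq_bigr => i _; congr (_ * _).
  by case: (es i) => [|p [|k q]] /=; rewrite ?mul0r ?mulr0// !addn0 mul1r mulr1.
pose k i := nth 0%N (es i) 1; pose m i := (sumn (skip1 (es i)) + n)%N.
pose b i := (size (skip1 (es i)) == n.+1).
rewrite (@eq_Rintegral _ _ _ mu _ (fun t => \sum_(i <- r) (c i * (b i)%:R) * (dpow (k i) t *
    dpow (m i) (s - t)))); last first.
  move=> t; rewrite inE /= in_itv/= => /andP[t0 ts].
  rewrite (_ : (fun _ => _) = (fun t0 ts => \sum_(i <- r) (c i * dpow (k i) t) * mono (skip1
      (es i)) (t0 :: ts))).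
    rewrite IHn ?subr_ge0//; apply: eq_bigr => i _; rewrite /b /m; ring.
  apply/funext => u; apply/funext => us; apply: eq_bigr => i _.
  by rewrite mono_skip1 mulrA.
rewrite Rintegral_sum; last first.
  by move=> i t; apply: cvgM; [exact: continuous_dpow|exact: continuous_dpow_sub].
apply: eq_bigr => i _; rewrite Rintegral_dpow_dpow// -mulrA; congr (_ * _).
rewrite /b /k /m; case: (es i) => [|p [|q e]] /=; rewrite ?mul0r// !eqSS.
by congr (_ * dpow _ s); rewrite addnS; congr _.+1; rewrite !addnA (addnC q).
Qed.

(** Linear combinations of monomials: a class of integrands that is stable under
   fixing one time and has continuous simplex integrals. *)
Definition mono_comb (f : R -> seq R -> R) := exists r : seq (R * seq nat),
  f = fun t0 ts => \sum_(z <- r) z.1 * mono z.2 (t0 :: ts).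

Lemma mono_comb_cons f t : mono_comb f -> mono_comb (fun t0 ts => f t0 (t :: ts)).
Proof.
move=> [r ->]; exists [seq (z.1 * dpow (nth 0 z.2 1)%N t, skip1 z.2) | z <- r].
apply/funext => u; apply/funext => us; rewrite big_map; apply: eq_bigr => z _ /=.
by rewrite mono_skip1 mulrA.
Qed.

Lemma mono_comb_continuous n f s : mono_comb f -> exists2 g : R -> R,
  continuous g & forall t, t <= s ->
    simplex_int n (s - t) (fun t0 ts => f t0 (t :: ts)) = g t.
Proof.
move=> [r ->]; exists (fun t => \sum_(z <- r) (z.1 * dpow (nth 0 z.2 1)%N t) *
  ((size (skip1 z.2) == n.+1)%:R * dpow (sumn (skip1 z.2) + n) (s - t))).
  move=> t; apply: cvg_big => [|z _]; first exact: (@add_continuous R).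
  apply: cvgM; first by apply: cvgMl_tmp; exact: continuous_dpow.
  by apply: cvgMl_tmp; exact: continuous_dpow_sub.
move=> t ts; rewrite -simplex_int_mono_sum ?subr_ge0//; congr simplex_int.
apply/funext => u; apply/funext => us; apply: eq_bigr => z _.
by rewrite mono_skip1 mulrA.
Qed.

Definition closed_simplex n (s : R) t0 ts :=
  [/\ 0 <= t0, all (fun t => 0 <= t) ts, size ts = n & t0 + \sum_(t <- ts) t = s].

Definition open_simplex n (s : R) t0 ts :=
  [/\ 0 < t0, all (fun t => 0 < t) ts, size ts = n & t0 + \sum_(t <- ts) t = s].

Let closed_simplex_cons n s t t0 ts : 0 <= t ->
  closed_simplex n (s - t) t0 ts -> closed_simplex n.+1 s t0 (t :: ts).
Proof.
move=> tp [t00 tsp sz sm]; split=> //=; rewrite ?tp ?sz//.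
by rewrite big_cons addrCA sm addrC subrK.
Qed.

Let open_simplex_cons n s t t0 ts : 0 < t ->
  open_simplex n (s - t) t0 ts -> open_simplex n.+1 s t0 (t :: ts).
Proof.
move=> tp [t00 tsp sz sm]; split=> //=; rewrite ?tp ?sz//.
by rewrite big_cons addrCA sm addrC subrK.
Qed.

Lemma norm_simplex_int_le n s f C : 0 <= s -> mono_comb f ->
  (forall t0 ts, closed_simplex n s t0 ts -> `|f t0 ts| <= C) ->
  `|simplex_int n s f| <= C * s ^+ n.
Proof.
elim: n s f => [|n IHn] s f s0 cf fC /=.
  by rewrite expr0 mulr1; apply: fC; split=> //; rewrite big_nil addr0.
have C0 : 0 <= C.
  apply: le_trans (normr_ge0 _) (fC s (nseq n.+1 0) _); split=> //.
  - by apply/allP => x /nseqP[->].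
  - by rewrite size_nseq.
  - by rewrite big1_seq ?addr0// => x /nseqP[->].
have [g cg Eg] := mono_comb_continuous n s cf.
rewrite (@eq_Rintegral _ _ _ mu _ g); last first.
  by move=> t; rewrite inE /= in_itv/= => /andP[_ ts]; exact: Eg.
rewrite exprSr mulrA; apply: norm_Rintegral_le => // t /andP[t0 ts].
rewrite -Eg//; apply: le_trans (IHn _ _ _ (mono_comb_cons t cf) _) _.
- by rewrite subr_ge0.
- by move=> u us us_; apply: fC; exact: closed_simplex_cons.
- rewrite ler_wpM2l// lerXn2r ?nnegrE ?subr_ge0//.
  by rewrite lerBlDr lerDl.
Qed.

(** Dominated convergence at each stage of the iterated integral. Pointwise
   convergence is only asked for where all times are positive, since [H] below
   has values at positive times only. The limit need not be a combination of
   monomials: its measurability comes from that of the approximants. *)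
Lemma simplex_int_dominated_cvg n s (f : nat -> R -> seq R -> R)
    (F : R -> seq R -> R) C : 0 < s -> (forall K, mono_comb (f K)) ->
  (forall K t0 ts, closed_simplex n s t0 ts -> `|f K t0 ts| <= C) ->
  (forall t0 ts, open_simplex n s t0 ts -> f K t0 ts @[K --> \oo] --> F t0 ts) ->
  simplex_int n s (f K) @[K --> \oo] --> simplex_int n s F.
Proof.
elim: n s f F => [|n IHn] s f F s0 cf fC fF /=.
  by apply: fF; split=> //; rewrite big_nil addr0.
have C0 : 0 <= C.
  apply: le_trans (normr_ge0 _) (fC 0%N s (nseq n.+1 0) _); split=> //.
  - exact: ltW.
  - by apply/allP => x /nseqP[->].
  - by rewrite size_nseq.
  - by rewrite big1_seq ?addr0// => x /nseqP[->].
apply: (@Rintegral_dominated_cvg _ _ _ _ (C * s ^+ n)).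
- move=> K; have [g cg Eg] := mono_comb_continuous n s (cf K).
  apply: (@eq_measurable_fun _ _ _ _ _ g).
    by move=> t; rewrite inE /= in_itv/= => /andP[_ ts]; rewrite Eg.
  by apply: measurable_funTS; exact: continuous_measurable_fun.
- move=> t /andP[t0 ts]; apply: IHn.
  + by rewrite subr_gt0.
  + by move=> K; exact: mono_comb_cons.
  + by move=> K u us us_; apply: fC; apply: closed_simplex_cons us_; exact: ltW.
  + by move=> u us us_; apply: fF; exact: open_simplex_cons.
- move=> K t /andP[t0 ts].
  apply: le_trans (norm_simplex_int_le _ (mono_comb_cons t (cf K)) (_ : forall u us, _ -> _ <=
      C)) _.
  + by rewrite subr_ge0.
  + by move=> u us us_; apply: fC; exact: closed_simplex_cons.
  + rewrite ler_wpM2l//; apply: lerXn2r; rewrite ?nnegrE ?subr_ge0//; first exact: ltW.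
    by rewrite gerBl.
Qed.

Lemma simplex_int_cst n s (c : R) : 0 <= s ->
  simplex_int n s (fun _ _ => c) = c * dpow n s.
Proof.
elim: n s => [|n IHn] s s0 /=; first by rewrite dpow0 mulr1.
rewrite (@eq_Rintegral _ _ _ mu _ (fun t => \sum_(i <- [:: tt]) c * (dpow 0 t * dpow n (s - t)))).
  rewrite Rintegral_sum ?big_seq1 ?Rintegral_dpow_dpow// => _ t.
  by apply: cvgM; [exact: continuous_dpow|exact: continuous_dpow_sub].
move=> t; rewrite inE /= in_itv/= => /andP[t0 ts].
by rewrite IHn ?subr_ge0// big_seq1 dpow0 mul1r.
Qed.

End SimplexIntegrals.

(** * Words in two letters and their simplex integrals *)

Section Words.
Context (R : realType).

(** The letters [true] and [false] stand for Y and X. *)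
Fixpoint words (j : nat) : seq (seq bool) :=
  if j is j'.+1 then
    [seq true :: w | w <- words j'] ++ [seq false :: w | w <- words j']
  else [:: [::]].

(** The exponents k_0, ..., k_n of [w = X^k_0 Y X^k_1 ... Y X^k_n] *)
Fixpoint exps (w : seq bool) : seq nat :=
  match w with
  | [::] => [:: 0%N]
  | true :: w' => 0%N :: exps w'
  | false :: w' => incr_nth (exps w') 0
  end.

Lemma sum_words (V : zmodType) j (a : seq bool -> V) :
  \sum_(w <- words j.+1) a w =
  \sum_(w <- words j) a (true :: w) + \sum_(w <- words j) a (false :: w).
Proof. by rewrite /= big_cat !big_map. Qed.

Lemma size_words j w : w \in words j -> size w = j.
Proof.
elim: j w => [|j IHj] w /=; first by rewrite inE => /eqP ->.
by rewrite mem_cat => /orP[] /mapP[w' /IHj <- ->].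
Qed.

Lemma size_exps w : size (exps w) = (count id w).+1.
Proof. by elim: w => //= -[|] w /= IHw; rewrite ?size_incr_nth IHw. Qed.

Lemma sumn_exps w : (sumn (exps w) + count id w)%N = size w.
Proof.
elim: w => //= -[|] w IHw /=; first by rewrite add0n addnCA IHw.
by case: (exps w) IHw => /= [|e es]; rewrite ?addSn => ->.
Qed.

(** Letters X in front of a word only change its first exponent. *)
Let addhead k (es : seq nat) := if es is e :: es' then (k + e)%N :: es' else [::].

Let addhead_incr k es :
  addhead k (incr_nth es 0) = if es is [::] then [:: k.+1] else addhead k.+1 es.
Proof. by case: es => //= [|e es]; rewrite ?addnS ?addn0 ?addSn. Qed.

Let exps_neq0 w : exps w != [::].
Proof. by rewrite -size_eq0 size_exps. Qed.

Let words_mono_addhead (V : lmodType R) (t0 t1 : R) ts j k (a : seq bool -> V) :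
  \sum_(w <- words j) mono (addhead k (exps w)) [:: t0, t1 & ts] *: a w =
  \sum_(i < j) dpow (k + i) t0 *: \sum_(w <- words (j - i.+1))
    mono (exps w) (t1 :: ts) *: a (nseq i false ++ true :: w).
Proof.
elim: j k a => [|j IHj] k a.
  by rewrite big_seq1 big_ord0 /= mulr0 scale0r.
rewrite sum_words big_ord_recl /= addn0 subn1 /=; congr (_ + _).
  by rewrite scaler_sumr; apply: eq_bigr => w _; rewrite scalerA.
rewrite (eq_bigr (fun w => mono (addhead k.+1 (exps w)) [:: t0, t1 & ts] *: a (false :: w)));
    last first.
  by move=> w _; rewrite addhead_incr; case: (exps w) (exps_neq0 w).
by rewrite IHj; apply: eq_bigr => i _; rewrite /bump /= add1n addSnnS subSS.
Qed.

Let addhead0 es : addhead 0 es = es. Proof. by case: es. Qed.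

(** Decomposition of a word according to the position [i] of its first letter Y;
   words without Y have no term, as there are two times or more. *)
Lemma words_mono_cons (V : lmodType R) (t0 t1 : R) ts j (a : seq bool -> V) :
  \sum_(w <- words j) mono (exps w) [:: t0, t1 & ts] *: a w =
  \sum_(i < j) dpow i t0 *: \sum_(w <- words (j - i.+1))
    mono (exps w) (t1 :: ts) *: a (nseq i false ++ true :: w).
Proof.
rewrite -(words_mono_addhead t0 t1 ts j 0).
by apply: eq_bigr => w _; rewrite addhead0.
Qed.

Lemma words_mono_nil (V : lmodType R) (t0 : R) j (a : seq bool -> V) :
  \sum_(w <- words j) mono (exps w) [:: t0] *: a w = dpow j t0 *: a (nseq j false).
Proof.
suff h k : \sum_(w <- words j) mono (addhead k (exps w)) [:: t0] *: a w =
    dpow (k + j) t0 *: a (nseq j false).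
  by rewrite -(h 0%N); apply: eq_bigr => w _; rewrite addhead0.
elim: j k a => [|j IHj] k a; first by rewrite big_seq1 /= addn0 mulr1.
rewrite sum_words /= big1 => [|w _]; last first.
  by case: (exps w) (exps_neq0 w) => //= *; rewrite mulr0 scale0r.
rewrite add0r addnS -addSn -(IHj k.+1 (fun w => a (false :: w))).
apply: eq_bigr => w _; rewrite addhead_incr.
by case: (exps w) (exps_neq0 w).
Qed.

Lemma mono_ge0 es (ts : seq R) : all (fun t => 0 <= t) ts -> 0 <= mono es ts.
Proof.
elim: ts es => [|t ts IHts] [|e es] //= /andP[t0 /IHts h].
by rewrite mulr_ge0// dpow_ge0.
Qed.

Lemma dpowD m (x y : R) : dpow m (x + y) = \sum_(k < m.+1) dpow k x * dpow (m - k) y.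
Proof.
rewrite /dpow addrC exprDn mulr_suml; apply: eq_bigr => i _.
have im : (i <= m)%N by rewrite -ltnS.
have e : 'C(m, i)%:R / m`!%:R = i`!%:R^-1 * (m - i)`!%:R^-1 :> R.
  rewrite -(bin_fact im) !natrM invfM mulrA divff ?mul1r ?invfM//.
  by rewrite pnatr_eq0 -lt0n bin_gt0.
rewrite -mulr_natr [LHS](_ : _ = x ^+ i * y ^+ (m - i) * ('C(m, i)%:R / m`!%:R)); last by ring.
by rewrite e; ring.
Qed.

(** The binomial theorem for several times; [j - size ts] is the number of
   letters X. *)
Lemma sum_words_mono j (t0 : R) ts :
  \sum_(w <- words j) mono (exps w) (t0 :: ts) =
  if (size ts <= j)%N then dpow (j - size ts) (t0 + \sum_(t <- ts) t) else 0.
Proof.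
transitivity (\sum_(w <- words j) mono (exps w) (t0 :: ts) *: (1 : R^o)).
  by apply: eq_bigr => w _; rewrite /GRing.scale/= mulr1.
elim: ts t0 j => [|t1 ts IHts] t0 j.
  by rewrite words_mono_nil /= subn0 big_nil addr0 /GRing.scale/= mulr1.
rewrite words_mono_cons; set n := size ts; set s := t1 + \sum_(t <- ts) t.
under eq_bigr do rewrite IHts -/n -/s.
rewrite big_cons -/s /=.
case: (ltnP n j) => [nj|jn]; last first.
  rewrite big1// => i _; have ij := ltn_ord i.
  by case: leqP => [h|_]; [exfalso; lia|rewrite scaler0].
rewrite dpowD subnS prednK ?subn_gt0// (big_ord_widen j (fun k => dpow k t0 * dpow ((j - n).-1
    - k) s)) ?leq_subr//.
rewrite [RHS]big_mkcond; apply: eq_bigr => i _; have ij := ltn_ord i.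
case: leqP => h1; case: ltnP => h2; rewrite ?scaler0//; try (exfalso; lia).
by congr (_ * dpow _ _); lia.
Qed.

Lemma series_words_mono_le K (rho t0 : R) ts : 0 <= rho ->
  0 <= t0 -> all (fun t => 0 <= t) ts ->
  \sum_(0 <= j < K) rho ^+ j * \sum_(w <- words j) mono (exps w) (t0 :: ts) <=
  rho ^+ size ts * expR (rho * (t0 + \sum_(t <- ts) t)).
Proof.
move=> rho0 t00 ts0; set n := size ts; set s := t0 + _.
have s0 : 0 <= s by rewrite addr_ge0// big_seq sumr_ge0// => t /(allP ts0).
have term0 j : 0 <= rho ^+ j * \sum_(w <- words j) mono (exps w) (t0 :: ts).
  by rewrite mulr_ge0 ?exprn_ge0// sumr_ge0// => w _; rewrite mono_ge0//= t00.
apply: (@le_trans _ _ (\sum_(0 <= j < n + K) rho ^+ j * \sum_(w <- words j) mono (exps w) (t0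
    :: ts))).
  rewrite addnC (@big_cat_nat _ _ _ K 0 (K + n))//= ?leq_addr// lerDl.
  by apply: sumr_ge0 => j _; exact: term0.
rewrite (@big_cat_nat _ _ _ n 0 (n + K))//= ?leq_addr//.
rewrite [X in X + _]big_nat_cond [X in X + _]big1 ?add0r; last first.
  by move=> j /andP[/andP[_ jn] _]; rewrite sum_words_mono leqNgt jn mulr0.
rewrite -{1}[n]add0n big_addn addKn.
rewrite (eq_bigr (fun j => rho ^+ n * exp_coeff (rho * s) j)); last first.
  move=> j _; rewrite sum_words_mono leq_addl addnK exprD /exp_coeff /= /dpow exprMn.
  by ring.
rewrite -mulr_sumr ler_wpM2l ?exprn_ge0//.
apply: (@nondecreasing_cvgn_le _ (series (exp_coeff (rho * s)))).
  by apply: nondecreasing_series => j _ _; rewrite exp_coeff_ge0// mulr_ge0.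
exact: is_cvg_series_exp_coeff.
Qed.

Lemma is_cvg_series_words_mono (rho t0 : R) ts : 0 <= rho ->
  0 <= t0 -> all (fun t => 0 <= t) ts ->
  cvgn (series (fun j => rho ^+ j * \sum_(w <- words j) mono (exps w) (t0 :: ts))).
Proof.
move=> rho0 t00 ts0; apply: nondecreasing_is_cvgn.
  apply: nondecreasing_series => j _ _; rewrite mulr_ge0 ?exprn_ge0//.
  by rewrite sumr_ge0// => w _; rewrite mono_ge0//= t00.
by eexists => _ [K _ <-]; exact: series_words_mono_le.
Qed.

Lemma sum_words_cst j (c : R) : \sum_(w <- words j) c = 2 ^+ j * c.
Proof.
elim: j => [|j IHj]; first by rewrite big_seq1 mul1r.
by rewrite sum_words IHj exprS; ring.
Qed.

Lemma words_fact_summable (r : R) : 0 <= r ->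
  cvgn (series (fun j => r ^+ j * \sum_(w <- words j) (size w)`!%:R^-1)).
Proof.
move=> r0; have := @is_cvg_series_exp_coeff R (r * 2).
rewrite (_ : exp_coeff _ = (fun j => r ^+ j * \sum_(w <- words j) (size w)`!%:R^-1))//.
apply/funext => j; rewrite /exp_coeff /= exprMn -mulrA -sum_words_cst; congr (_ * _).
by rewrite big_seq [RHS]big_seq; apply: eq_bigr => w /size_words ->.
Qed.

Section Gathering.
Context (a : seq bool -> R) (C rho : R).
Hypothesis rho0 : 0 <= rho.
Hypothesis a_le : forall w, `|a w| <= C * rho ^+ size w.

Let C0 : 0 <= C.
Proof. by have := a_le [::]; rewrite expr0 mulr1; apply: le_trans. Qed.

Lemma norm_sum_words_le j (p : pred (seq bool)) :
  `|\sum_(w <- words j | p w) a w| <= C * (2 * rho) ^+ j.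
Proof.
apply: (@le_trans _ _ (\sum_(w <- words j) C * rho ^+ j)).
  apply: le_trans (ler_norm_sum _ _ _) _; rewrite big_mkcond big_seq [leRHS]big_seq.
  apply: ler_sum => w /size_words wj; case: ifP => _; first by rewrite -wj.
  by rewrite mulr_ge0// exprn_ge0.
by rewrite sum_words_cst exprMn mulrCA.
Qed.

Let bound j := C * (2 * rho) ^+ j / j`!%:R.

Let is_cvg_bound : cvgn (series bound).
Proof.
have -> : bound = C *: exp_coeff (2 * rho).
  by apply/funext => j; rewrite /bound -mulrA.
by apply: is_cvg_seriesZ; exact: is_cvg_series_exp_coeff.
Qed.

Let norm_bound j (p : pred (seq bool)) :
  `|(\sum_(w <- words j | p w) a w) / j`!%:R| <= bound j.
Proof.
rewrite normrM normfV normr_nat.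
by rewrite ler_wpM2r ?invr_ge0// norm_sum_words_le.
Qed.

Let comb (K : nat) (t0 : R) ts :=
  series (fun j => \sum_(w <- words j) mono (exps w) (t0 :: ts) * a w) K.

Let combE K : comb K = fun t0 ts => \sum_(z <- [seq (a w, exps w) | w <- flatten [seq words j |
    j <- iota 0 K]])
   z.1 * mono z.2 (t0 :: ts).
Proof.
apply/funext => t0; apply/funext => ts; rewrite big_map big_flatten /= big_map.
rewrite /comb /series /= /index_iota subn0; apply: eq_bigr => j _.
by apply: eq_bigr => w _ /=; rewrite mulrC.
Qed.

Let norm_comb_le n K t0 ts : closed_simplex n 1 t0 ts ->
  `|comb K t0 ts| <= C * rho ^+ n * expR rho.
Proof.
move=> [t00 ts0 sz sm].
have -> : C * rho ^+ n * expR rho = C * (rho ^+ size ts * expR (rho * (t0 + \sum_(t <- ts) t))).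
  by rewrite sm sz mulr1 mulrA.
apply: le_trans (ler_wpM2l C0 (series_words_mono_le K rho0 t00 ts0)).
rewrite mulr_sumr; apply: le_trans (ler_norm_sum _ _ _) _; apply: ler_sum => j _.
apply: (@le_trans _ _ (\sum_(w <- words j) mono (exps w) (t0 :: ts) * (C * rho ^+ j))).
  apply: le_trans (ler_norm_sum _ _ _) _; rewrite big_seq [leRHS]big_seq.
  apply: ler_sum => w /size_words wj; rewrite normrM ger0_norm; last first.
    by apply: mono_ge0; rewrite /= t00.
  by rewrite ler_wpM2l ?mono_ge0 ?/= ?t00// -wj.
by rewrite -mulr_suml; lra.
Qed.

Let cvg_simplex_int n (F : R -> seq R -> R) :
  (forall t0 ts, open_simplex n 1 t0 ts ->
     series (fun j => \sum_(w <- words j) mono (exps w) (t0 :: ts) * a w) @ \oo --> F t0 ts) ->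
  series (fun j => (\sum_(w <- words j | count id w == n) a w) / j`!%:R) @ \oo --> simplex_int
      n 1 F.
Proof.
move=> hF.
have := @simplex_int_dominated_cvg _ n 1 comb F _ ltr01 _ (@norm_comb_le n) hF.
have h K : mono_comb (comb K) by rewrite combE; eexists.
move=> /(_ h) lim; suff -> : series (fun j => (\sum_(w <- words j | count id w == n) a w) /
    j`!%:R) =
  fun K => simplex_int n 1 (comb K) by [].
apply/funext => K; rewrite combE simplex_int_mono_sum// big_map big_flatten /= big_map.
rewrite /series /= /index_iota subn0; apply: eq_bigr => j _.
rewrite mulr_suml [LHS]big_mkcond /= [LHS]big_seq [RHS]big_seq; apply: eq_bigr => w /size_words wj.
rewrite size_exps eqSS; case: eqP => [<-|_]; last by rewrite mul0r mulr0.
by rewrite sumn_exps wj mul1r /dpow expr1n div1r.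
Qed.

(** A word of length [j] with [n] letters Y has simplex integral [1 / j!], and the
   words with another number of letters Y have simplex integral 0 over the n-th
   simplex. So the [n]-th integral collects the words with [n] letters Y, and the
   two sums are regroupings of one absolutely convergent sum. *)
Lemma sum_simplex_int (F : nat -> R -> seq R -> R) :
  (forall n t0 ts, open_simplex n 1 t0 ts ->
    series (fun j => \sum_(w <- words j) mono (exps w) (t0 :: ts) * a w) @ \oo
      --> F n t0 ts) ->
  exists2 s : R, series (fun j => (\sum_(w <- words j) a w) / j`!%:R) @ \oo --> s &
    series (fun n => simplex_int n 1 (F n)) @ \oo --> s.
Proof.
move=> hF.
(* the part of the [j]-th term with fewer than [m] letters Y *)
pose c m j := (\sum_(w <- words j | (count id w < m)%N) a w) / j`!%:R.
have := @dominated_series_cvg R R^o c (fun j => (\sum_(w <- words j) a w) / j`!%:R) bound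
  (series (fun n => simplex_int n 1 (F n))).
case.
- move=> j; apply: cvg_near_cst; near=> m; congr (_ / _).
  rewrite big_seq_cond [RHS]big_seq; apply: eq_bigl => w.
  case wj : (w \in _) => //=; have := size_words wj => sj.
  have jm : (j < m)%N by near: m; exact: nbhs_infty_gt.
  by rewrite (leq_ltn_trans (count_size _ _))// sj.
- by move=> m j; exact: norm_bound.
- exact: is_cvg_bound.
- elim=> [|m IHm].
    rewrite [X in _ --> X](_ : _ = 0); last by rewrite /series /= big_geq.
    rewrite (_ : series (c 0%N) = fun=> 0); first exact: cvg_cst.
    apply/funext => K; rewrite /series /= big1// => j _.
    by rewrite /c big_pred0 ?mul0r.
  rewrite seriesSr.
  have -> : series (c m.+1) = series (c m) + series (fun j => (\sum_(w <- words j | count id w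
      == m) a w) / j`!%:R).
    rewrite -seriesD; congr series; apply/funext => j.
    rewrite addrfctE /c -mulrDl; congr (_ / _).
    rewrite (bigID (fun w => count id w == m)) /= addrC; congr (_ + _).
      by apply: eq_bigl => w; rewrite ltnS andbC [RHS]ltn_neqAle.
    by apply: eq_bigl => w; case: eqP => [->|_]; rewrite ?leqnn ?andbT ?andbF// ltnSn.
  by apply: cvgD; [exact: IHm|apply: cvg_simplex_int => t0 ts; exact: hF].
- by move=> s h1 h2; exists s.
Unshelve. all: by end_near. Qed.

End Gathering.

End Words.

(** * Exponentials in Banach algebras *)

Lemma is_cvg_series_mull (R : realType) (c : R) (f : nat -> R) :
  cvgn (series f) -> cvgn (series (fun k => c * f k)).
Proof.
move=> cf; rewrite (_ : (fun k => _) = c *: f); last by apply/funext.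
exact: is_cvg_seriesZ.
Qed.

Section BanachAlgebra.
Context (R : realType) (B : completeNormedModType R).

(** The real Banach algebra underlying an FDGA. The norm of [e] is arbitrary,
   hence the factors [|e|] in the bounds below. *)
Record banach_algebra (mul : B -> B -> B) (e : B) : Prop := BanachAlgebra {
  bmulDl : forall x y z, mul (x + y) z = mul x z + mul y z ;
  bmulDr : forall x y z, mul x (y + z) = mul x y + mul x z ;
  bmulZl : forall (r : R) x y, mul (r *: x) y = r *: mul x y ;
  bmulZr : forall (r : R) x y, mul x (r *: y) = r *: mul x y ;
  bmulA : forall x y z, mul x (mul y z) = mul (mul x y) z ;
  bmul1l : forall x, mul e x = x ;
  bmul1r : forall x, mul x e = x ;
  norm_bmul : forall x y, `|mul x y| <= `|x| * `|y| ;
  bmul_continuous : continuous (fun z : B * B => mul z.1 z.2)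
}.

Context (mul : B -> B -> B) (e : B) (bB : banach_algebra mul e).

Lemma bmul0l y : mul 0 y = 0.
Proof. by have := bmulZl bB 0 0 y; rewrite !scale0r. Qed.

Lemma bmul0r x : mul x 0 = 0.
Proof. by have := bmulZr bB 0 x 0; rewrite !scale0r. Qed.

Lemma bmulBl x y z : mul (x - y) z = mul x z - mul y z.
Proof. by rewrite -scaleN1r (bmulDl bB) (bmulZl bB) scaleN1r. Qed.

Lemma bmulBr x y z : mul x (y - z) = mul x y - mul x z.
Proof. by rewrite -scaleN1r (bmulDr bB) (bmulZr bB) scaleN1r. Qed.

Lemma bmul_suml (I : Type) (r : seq I) (P : pred I) (F : I -> B) y :
  mul (\sum_(i <- r | P i) F i) y = \sum_(i <- r | P i) mul (F i) y.
Proof.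
by apply: (big_morph (mul^~ y)) => [x z|]; [exact: (bmulDl bB)|exact: bmul0l].
Qed.

Lemma bmul_sumr (I : Type) (r : seq I) (P : pred I) (F : I -> B) x :
  mul x (\sum_(i <- r | P i) F i) = \sum_(i <- r | P i) mul x (F i).
Proof.
by apply: (big_morph (mul x)) => [y z|]; [exact: (bmulDr bB)|exact: bmul0r].
Qed.

Lemma cvg_bmul T (F : set_system T) (FF : Filter F) (f g : T -> B) a b :
  f @ F --> a -> g @ F --> b -> (fun t => mul (f t) (g t)) @ F --> mul a b.
Proof.
move=> fa gb.
by apply: (@continuous2_cvg _ _ _ _ _ _ f g mul a b); first exact: (@bmul_continuous _ _ bB (a, b)).
Qed.

Lemma cvg_series_bmulr x (f : nat -> B) s : series f @ \oo --> s ->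
  series (fun n => mul x (f n)) @ \oo --> mul x s.
Proof.
move=> fs; have -> : series (fun n => mul x (f n)) = fun n => mul x (series f n).
  by apply/funext => n; rewrite /series /= bmul_sumr.
by apply: cvg_bmul => //; exact: cvg_cst.
Qed.

(** The partial sums of the product are [sum_(k < n) a_k * (b_0 + ... + b_(n-k-1))];
   dominated convergence in [n], term by term in [k]. *)
Lemma cauchy_product (a b : nat -> B) (al be : nat -> R) s t :
  (forall k, `|a k| <= al k) -> (forall k, `|b k| <= be k) ->
  cvgn (series al) -> cvgn (series be) ->
  series a @ \oo --> s -> series b @ \oo --> t ->
  series (fun n => \sum_(k < n.+1) mul (a k) (b (n - k)%N)) @ \oo --> mul s t.
Proof.
move=> aal bbe cal cbe as_ bt.
have be0 k : 0 <= be k by exact: le_trans (normr_ge0 _) (bbe k).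
have bM n : `|series b n| <= limn (series be).
  apply: (@le_trans _ _ (series be n)).
    by apply: le_trans (ler_norm_sum _ _ _) _; apply: ler_sum.
  by apply: nondecreasing_cvgn_le => //; apply: nondecreasing_series => k _ _.
have M0 : 0 <= limn (series be) by exact: le_trans (normr_ge0 _) (bM 0%N).
pose f n k := if (k < n)%N then mul (a k) (series b (n - k)%N) else 0.
pose c n := \sum_(k < n.+1) mul (a k) (b (n - k)%N).
have cE n : series c n = \sum_(0 <= k < n) f n k.
  elim: n => [|n IHn]; first by rewrite /series /= !big_geq.
  rewrite seriesSr IHn big_nat_recr//= /f ltnSn subSnn.
  rewrite /c big_ord_recr /= subnn addrA; congr (_ + _); last first.
    by rewrite /series /= big_nat1.
  rewrite -(big_mkord xpredT (fun k => mul (a k) (b (n - k)%N))) -big_split /=.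
  rewrite big_nat [RHS]big_nat; apply: eq_bigr => k /andP[_ kn].
  by rewrite kn (ltn_trans kn)// subSn 1?ltnW// seriesSr (bmulDr bB).
have [||||q hq cq] := @dominated_series_cvg R B f (fun k => mul (a k) t) (fun k => limn (series
    be) * al k) (series c).
- move=> k; apply: (@cvg_trans _ ((fun n => mul (a k) (series b (n - k)%N)) @ \oo)).
    apply: near_eq_cvg; near=> n; rewrite /f ifT//; near: n; exact: nbhs_infty_gt.
  apply: cvg_bmul; first exact: cvg_cst.
  apply: (@cvg_comp _ _ _ (fun n => (n - k)%N) (series b) _ \oo) => //.
  exact: cvg_subnr.
- move=> n k; rewrite /f; case: ifP => _; last first.
    by rewrite normr0 mulr_ge0// (le_trans _ (aal k)).
  apply: le_trans (norm_bmul bB _ _) _; rewrite mulrC.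
  by apply: ler_pM.
- exact: is_cvg_series_mull.
- move=> n; rewrite cE; apply: cvg_near_cst; near=> m.
  have nm : (n <= m)%N by near: m; exact: nbhs_infty_ge.
  rewrite /series /= (@big_cat_nat _ _ _ n 0 m)//= [X in _ + X]big1_seq ?addr0//.
  by move=> k /andP[_]; rewrite mem_index_iota /f => /andP[nk _]; rewrite ltnNge nk.
suff <- : q = mul s t by [].
have lim : series (fun k => mul (a k) t) @ \oo --> mul s t.
  have -> : series (fun k => mul (a k) t) = fun n => mul (series a n) t.
    by apply/funext => n; rewrite /series /= bmul_suml.
  by apply: cvg_bmul => //; exact: cvg_cst.
exact: cvg_unique hq lim.
Unshelve. all: by end_near. Qed.

Fixpoint bpow (x : B) n := if n is n'.+1 then mul x (bpow x n') else e.

Lemma bpowD x m n : bpow x (m + n) = mul (bpow x m) (bpow x n).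
Proof. by elim: m => /= [|m ->]; rewrite ?(bmul1l bB)// (bmulA bB). Qed.

Lemma norm_bpow_le x r n : `|x| <= r -> `|bpow x n| <= `|e| * r ^+ n.
Proof.
move=> xr; elim: n => [|n IHn] /=; first by rewrite expr0 mulr1.
apply: le_trans (norm_bmul bB _ _) _; rewrite exprS mulrCA.
exact: ler_pM.
Qed.

Section Exponential.
Variable X : B.

Lemma norm_exp_term_le (u : R) n : 0 <= u ->
  `|dpow n u *: bpow X n| <= `|e| * exp_coeff (u * `|X|) n.
Proof.
move=> u0; rewrite normrZ ger0_norm ?dpow_ge0//.
apply: le_trans (ler_wpM2l (@dpow_ge0 _ n _ u0) (@norm_bpow_le X _ n (lexx _))) _.
by rewrite /dpow /exp_coeff /= exprMn; lra.
Qed.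

Lemma is_cvg_exp_bound v : cvgn (series (fun n => `|e| * exp_coeff (v : R) n)).
Proof. by apply: is_cvg_series_mull; exact: is_cvg_series_exp_coeff. Qed.

(** [e^(u X)] *)
Definition bexp (u : R) : B := limn (series (fun n => dpow n u *: bpow X n)).

Lemma cvg_bexp (u : R) : 0 <= u ->
  series (fun n => dpow n u *: bpow X n) @ \oo --> bexp u.
Proof.
move=> u0; have := is_cvg_series_dominated (fun n => @norm_exp_term_le u n u0)
    (@is_cvg_exp_bound (u * `|X|)).
exact.
Qed.

Lemma norm_bexp_le (u : R) : 0 <= u -> `|bexp u| <= `|e| * expR (u * `|X|).
Proof.
move=> u0; apply: (dominated_series_norm (fun n => @norm_exp_term_le u n u0) (cvg_bexp u0)).
have -> : series (fun n => `|e| * exp_coeff (u * `|X|) n) = `|e| *: series (exp_coeff (u * `|X|)).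
  exact: (seriesZ (exp_coeff (u * `|X|)) `|e|).
by apply: cvgMl_tmp; exact: is_cvg_series_exp_coeff.
Qed.

Lemma bexpD (u v : R) : 0 <= u -> 0 <= v -> bexp (u + v) = mul (bexp u) (bexp v).
Proof.
move=> u0 v0.
have h := cauchy_product (fun n => @norm_exp_term_le u n u0) (fun n => @norm_exp_term_le v n v0)
  (@is_cvg_exp_bound _) (@is_cvg_exp_bound _) (cvg_bexp u0) (cvg_bexp v0).
apply: cvg_unique (cvg_bexp (addr_ge0 u0 v0)) _ => //.
rewrite (_ : (fun n => dpow n (u + v) *: bpow X n) = (fun n => \sum_(k < n.+1)
  mul (dpow k u *: bpow X k) (dpow (n - k) v *: bpow X (n - k))))//.
apply/funext => n; rewrite dpowD scaler_suml; apply: eq_bigr => k _.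
by rewrite (bmulZl bB) (bmulZr bB) scalerA -bpowD subnKC// -ltnS.
Qed.

Lemma bexp0 : bexp 0 = e.
Proof.
apply: (cvg_unique _ (cvg_bexp (lexx 0))) => //.
apply: cvg_near_cst; near=> n.
have n0 : (0 < n)%N by near: n; exact: nbhs_infty_gt.
rewrite /series /= big_ltn// big_nat big1 ?addr0 ?dpow0 ?scale1r//.
by move=> [|k] //= _; rewrite dpowS0 scale0r.
Unshelve. all: by end_near. Qed.

Lemma bexp_quotient_cvg (h : nat -> R) : (forall n, 0 < h n <= 1) -> h @ \oo --> 0 ->
  (fun n => (h n)^-1 *: (bexp (h n) - e)) @ \oo --> X.
Proof.
move=> h01 h0.
pose a n k := ((h n)^-1 * dpow k.+1 (h n)) *: bpow X k.+1.
have [||||t ht st] := @dominated_series_cvg R B a (fun k => if k == 0%N then X else 0)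
  (fun k => `|e| * `|X| * exp_coeff `|X| k) (fun n => (h n)^-1 *: (bexp (h n) - e)).
- move=> k; have aE n : a n k = ((h n) ^+ k / (k.+1)`!%:R) *: bpow X k.+1.
    have /andP[hn0 _] := h01 n.
    by congr (_ *: _); rewrite /dpow exprS mulrA mulKf ?gt_eqF.
  under eq_fun do rewrite aE; case: eqP => [->|/eqP k0].
    rewrite /= (bmul1r bB) factS fact0; apply: cvg_near_cst; apply: nearW => n.
    by rewrite expr0 divr1 scale1r.
  rewrite -(scale0r (bpow X k.+1)); apply: cvgZr_tmp.
  rewrite -(mul0r (k.+1)`!%:R^-1); apply: cvgMr_tmp.
  have -> : 0 = 0 ^+ k :> R by rewrite expr0n (negbTE k0).
  by apply: (@cvg_comp _ _ _ h (fun x => x ^+ k) _ (nbhs 0)) => //; exact: exprn_continuous.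
- move=> n k; have /andP[hn0 hn1] := h01 n.
  rewrite /a.
  have h2 : (h n)^-1 * dpow k.+1 (h n) <= (k`!%:R)^-1.
    rewrite /dpow exprS -mulrA mulKf ?gt_eqF//.
    have f1 : 0 < k`!%:R :> R by rewrite ltr0n fact_gt0.
    have f2 : 0 < (k.+1)`!%:R :> R by rewrite ltr0n fact_gt0.
    apply: (@le_trans _ _ (1 * ((k.+1)`!%:R)^-1)).
      by rewrite ler_wpM2r ?invr_ge0// exprn_ile1// ltW.
    by rewrite mul1r lef_pV2 ?posrE// ler_nat factS leq_pmull.
  have h3 := @norm_bpow_le X _ k.+1 (lexx `|X|).
  have h4 : 0 <= (h n)^-1 * dpow k.+1 (h n).
    by rewrite mulr_ge0// ?dpow_ge0// ?invr_ge0 ltW.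
  have h5 := ler_pM h4 (normr_ge0 _) h2 h3.
  rewrite normrZ (ger0_norm h4); apply: le_trans h5 _.
  by rewrite /exp_coeff /= exprS; lra.
- by apply: is_cvg_series_mull; exact: is_cvg_series_exp_coeff.
- move=> n; have /andP[hn0 _] := h01 n.
  have h1 := cvg_bexp (ltW hn0).
  have -> : series (a n) = fun K => (h n)^-1 *: (series (fun k => dpow k (h n) *: bpow X k)
      K.+1 - e).
    apply/funext => K; rewrite /series /= big_nat_recl//= dpow0 scale1r addrAC subrr add0r
        scaler_sumr.
    by apply: eq_bigr => k _; rewrite scalerA.
  apply: cvgZl_tmp; apply: cvgB; last exact: cvg_cst.
  by rewrite -(cvg_shiftS (series _)) in h1.
have -> : X = t; last exact: st.
apply: (cvg_unique _ _ ht) => //; apply: cvg_near_cst; near=> n.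
have n0 : (0 < n)%N by near: n; exact: nbhs_infty_gt.
rewrite /series /= big_ltn//= big_nat big1 ?addr0//.
by move=> [|k].
Unshelve. all: by end_near. Qed.

(** A semigroup with generator X is the exponential series of X: over a
   subdivision of [0, u] into n steps the two semigroups differ by O(1) times
   [n] times their difference at [u / n], which is [o(1/n)] since both have the
   same derivative at 0. *)
Lemma semigroup_bexp (E : R -> B) : E 0 = e ->
  (forall u v, 0 <= u -> 0 <= v -> E (u + v) = mul (E u) (E v)) ->
  {within `[0, +oo[, continuous E} ->
  u^-1 *: (E u - E 0) @[u --> 0^'+] --> X ->
  forall u, 0 <= u -> E u = bexp u.
Proof.
move=> E0 ED Ec Ed u; rewrite le_eqVlt => /predU1P[<-|u0]; first by rewrite E0 bexp0.
have [C1 C1P] : exists C, forall v, 0 <= v <= u -> `|E v| <= C.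
  have cE : {within `[0, u], continuous E}.
    by apply: continuous_subspaceW Ec => v /=; rewrite !in_itv/= => /andP[-> _].
  have := compact_bounded (continuous_compact cE (@segment_compact R 0 u)).
  case=> M [_ HM]; exists (M + 1) => v vu; apply: (HM (M + 1)); first by rewrite ltrDl.
  by exists v => //; rewrite /= in_itv.
have C10 : 0 <= C1 by apply: le_trans (normr_ge0 _) (C1P 0 _); rewrite lexx ltW.
pose C2 := `|e| * expR (u * `|X|).
have C2P v : 0 <= v <= u -> `|bexp v| <= C2.
  move=> /andP[v0 vu]; apply: le_trans (norm_bexp_le v0) _.
  by rewrite ler_wpM2l// ler_expR ler_wpM2r.
have C20 : 0 <= C2 by rewrite mulr_ge0// expR_ge0.
pose h (n : nat) : R := u / n.+1%:R.
have hp n : 0 < h n by rewrite divr_gt0.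
have main n : `|E u - bexp u| <= u * C1 * C2 * `|(h n)^-1 *: (E (h n) - bexp (h n))|.
  (* telescoping from [T 0 = bexp u] to [T n.+1 = E u] *)
  pose T k := mul (E (k%:R * h n)) (bexp ((n.+1 - k)%:R * h n)).
  have hn : n.+1%:R * h n = u by rewrite /h mulrC divfK// pnatr_eq0.
  have -> : E u - bexp u = \sum_(0 <= k < n.+1) (T k.+1 - T k).
    rewrite telescope_sumr// /T subnn subn0 !mul0r bexp0 E0 hn.
    by rewrite (bmul1l bB) (bmul1r bB).
  apply: le_trans (ler_norm_sum _ _ _) _.
  apply: (@le_trans _ _ (\sum_(0 <= k < n.+1) C1 * `|E (h n) - bexp (h n)| * C2)).
    rewrite big_nat [leRHS]big_nat; apply: ler_sum => k /andP[_ kn].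
    have kh0 : 0 <= k%:R * h n by rewrite mulr_ge0// ltW.
    have kh1 m : (m <= n.+1)%N -> m%:R * h n <= u.
      by move=> mn; rewrite -[leRHS]hn; apply: ler_wpM2r; [exact: ltW|rewrite ler_nat].
    have nk0 : 0 <= (n - k)%:R * h n by rewrite mulr_ge0// ltW.
    have -> : T k.+1 - T k = mul (mul (E (k%:R * h n)) (E (h n) - bexp (h n))) (bexp ((n -
        k)%:R * h n)).
      have kS m : m.+1%:R * h n = m%:R * h n + h n by rewrite -natr1 mulrDl mul1r.
      have hn0 : 0 <= h n by exact: ltW.
      have nk : (n.+1 - k)%N = (n - k).+1 by rewrite subSn// -ltnS.
      rewrite /T subSS nk (kS k) (kS (n - k)%N) (ED _ _ kh0 hn0).
      rewrite (addrC ((n - k)%:R * h n)) (bexpD hn0 nk0).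
      by rewrite bmulBr bmulBl !(bmulA bB).
    apply: le_trans (norm_bmul bB _ _) _; apply: ler_pM => //.
      apply: le_trans (norm_bmul bB _ _) _; rewrite ler_wpM2r//.
      by apply: C1P; rewrite kh0 kh1// ltnW.
    by apply: C2P; rewrite nk0 kh1// (leq_trans (leq_subr _ _)).
  rewrite sumr_const_nat subn0 normrZ gtr0_norm ?invr_gt0//.
  rewrite -[X in X * C1](_ : n.+1%:R * h n = u)// -mulr_natl.
  have h0 := gt_eqF (hp n).
  rewrite le_eqVlt; apply/orP; left; apply/eqP; field.
  by rewrite h0.
have h0 : h @ \oo --> 0.
  rewrite -(mulr0 u); apply: cvgMl_tmp; exact: cvg_harmonic.
(* [bexp_quotient_cvg] asks for steps of length at most 1 *)
have [N hN] : exists N, forall n, h (n + N)%N <= 1.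
  have /cvgrPdist_le /(_ 1 ltr01)[N _ HN] := h0.
  exists N => n; have := HN (n + N)%N (leq_addl _ _).
  by rewrite sub0r normrN gtr0_norm.
pose g n := h (n + N)%N.
have g0 : g @ \oo --> 0 by rewrite (cvg_shiftn N h).
have hE : (fun n => (g n)^-1 *: (E (g n) - e)) @ \oo --> X.
  have Ed' := Ed; rewrite E0 in Ed'.
  apply: (@cvg_comp _ _ _ g (fun u => u^-1 *: (E u - e)) _ (0^'+)) => //.
  move=> U [r /= r0 HU]; have /cvgrPdist_lt /(_ r r0) := g0.
  by apply: filterS => n gn; apply: HU => //; exact: hp.
have hX := @bexp_quotient_cvg g (fun n => introT andP (conj (hp _) (hN n))) g0.
have hD : (fun n => u * C1 * C2 * `|(g n)^-1 *: (E (g n) - bexp (g n))|) @ \oo --> 0.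
  rewrite -(mulr0 (u * C1 * C2)); apply: cvgMl_tmp.
  rewrite -(@normr0 _ B) -(subrr X).
  apply: cvg_norm; rewrite (_ : (fun n => _) = (fun n => (g n)^-1 *: (E (g n) - e) - (g n)^-1
      *: (bexp (g n) - e))).
    exact: cvgB.
  by apply/funext => n; rewrite -scalerBr opprB addrA subrK.
apply/eqP; rewrite -subr_eq0 -normr_le0.
apply: (ler_cvg_to (@cvg_cst _ `|E u - bexp u| _ \oo _) hD).
by apply: nearW => n; exact: main.
Qed.

End Exponential.

End BanachAlgebra.

Section NeumannSeries.
Context (R : realType) (B : completeNormedModType R).
Context (mul : B -> B -> B) (e : B) (bB : banach_algebra mul e).

(** Neumann series [1 + c + c^2 + ...] with [c = e - x]. *)
Lemma left_inverse_near1 x : `|e - x| < 1 -> exists y, mul y x = e.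
Proof.
move=> x1; pose c := e - x.
have cs : cvgn (series (bpow mul e c)).
  apply: (@is_cvg_series_dominated _ _ _ (fun n => `|e| * (1 * `|c| ^+ n))).
    by move=> n; rewrite mul1r; exact: (norm_bpow_le bB).
  apply: is_cvg_series_mull; have := @is_cvg_geometric_series R 1 `|c|.
  by rewrite normr_id => /(_ x1).
exists (limn (series (bpow mul e c))); set y := limn _.
have ys : series (bpow mul e c) @ \oo --> y by [].
have h1 : (fun n => mul (series (bpow mul e c) n) x) @ \oo --> mul y x.
  by apply: (cvg_bmul bB) => //; exact: cvg_cst.
have h2 : (fun n => e - bpow mul e c n) @ \oo --> e - 0.
  by apply: cvgB; [exact: cvg_cst|exact: cvg_series_cvg_0].
rewrite subr0 in h2.
have E n : mul (series (bpow mul e c) n) x = e - bpow mul e c n.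
  elim: n => [|n IHn]; first by rewrite /series /= big_geq// (bmul0l bB) subrr.
  have -> : bpow mul e c n.+1 = mul (bpow mul e c n) c by rewrite -addn1 (bpowD bB) /= (bmul1r bB).
  have xE : x = e - c by rewrite /c opprB addrC subrK.
  rewrite seriesSr (bmulDl bB) IHn [in X in _ + mul _ X]xE (bmulBr bB) (bmul1r bB).
  by rewrite addrA subrK.
have Ef : (fun n => mul (series (bpow mul e c) n) x) = fun n => e - bpow mul e c n.
  exact/funext.
rewrite Ef in h1; exact: cvg_unique h1 h2.
Qed.

End NeumannSeries.

(** * Words in a Banach algebra and Dyson integrands *)

Section WordsInBanachAlgebra.
Context (R : realType) (B : completeNormedModType R).
Context (mul : B -> B -> B) (e : B) (bB : banach_algebra mul e) (X Y : B).

Definition wprod (w : seq bool) : B :=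
  foldr (fun b x => mul (if b then Y else X) x) e w.

Lemma bpow_addE m : bpow mul e (X + Y) m = \sum_(w <- words m) wprod w.
Proof.
elim: m => [|m IHm]; first by rewrite /= big_seq1.
by rewrite sum_words /= IHm (bmulDl bB) !(bmul_sumr bB) addrC.
Qed.

Lemma norm_wprod_le r w : `|X| <= r -> `|Y| <= r ->
  `|wprod w| <= `|e| * r ^+ size w.
Proof.
move=> Xr Yr; elim: w => [|b w IHw] /=; first by rewrite expr0 mulr1.
apply: le_trans (norm_bmul bB _ _) _; rewrite exprS mulrCA.
by apply: ler_pM => //; case: b.
Qed.

Lemma wprod_cat_nseq i w : wprod (nseq i false ++ w) = mul (bpow mul e X i) (wprod w).
Proof. by elim: i => [|i IHi] /=; rewrite ?(bmul1l bB)// IHi (bmulA bB). Qed.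

End WordsInBanachAlgebra.

Section DysonWords.
Context (R : realType) (K : tvsComAlgType R) (B : completeNormedModType R)
  (SB : fdga K B) (e : B).
Hypothesis uB : unital_banach_algebra SB e.

Lemma fdga_banach_algebra : banach_algebra (fmul SB) e.
Proof.
have [[mDl mDr mZl mZr] _ _ _ mc] := fmul_pairing SB.
have [m1 mn] := uB.
split => //.
- by move=> r x y; rewrite -!(kact_real SB) mZl.
- by move=> r x y; rewrite -!(kact_real SB) mZr.
- exact: fmul_assoc.
- by move=> x; have [] := m1 x.
- by move=> x; have [] := m1 x.
Qed.

Let bB := fdga_banach_algebra.

Context (X Y : B) (E : R -> B).
Hypothesis EX : forall u, 0 <= u -> E u = bexp (fmul SB) e X u.

Let rho := Num.max `|X| `|Y|.

Let rho0 : 0 <= rho. Proof. by rewrite le_max normr_ge0. Qed.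

Let hom t0 ts j := \sum_(w <- words j) mono (exps w) (t0 :: ts) *: wprod (fmul SB) e X Y w.

Let norm_hom_le t0 ts j : 0 <= t0 -> all (fun t => 0 <= t) ts ->
  `|hom t0 ts j| <= `|e| * (rho ^+ j * \sum_(w <- words j) mono (exps w) (t0 :: ts)).
Proof.
move=> t00 ts0; apply: le_trans (ler_norm_sum _ _ _) _.
rewrite mulrA mulr_sumr big_seq [leRHS]big_seq; apply: ler_sum => w /size_words wj.
have m0 : 0 <= mono (exps w) (t0 :: ts) by rewrite mono_ge0//= t00.
rewrite normrZ ger0_norm// mulrC ler_wpM2r// -wj.
by apply: (norm_wprod_le bB); rewrite le_max lexx ?orbT.
Qed.

(** Expand each [e^(t X)] in its exponential series and multiply out by Cauchy
   products, one letter Y at a time: the word [X^k_0 Y X^k_1 ... Y X^k_n] collects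
   the divided powers of the times. *)
Lemma cvg_series_dyson_word t0 ts : 0 <= t0 -> all (fun t => 0 <= t) ts ->
  series (fun j => \sum_(w <- words j) mono (exps w) (t0 :: ts) *: wprod (fmul SB) e X Y w)
    @ \oo --> dyson_word SB E Y t0 ts.
Proof.
rewrite -/(hom t0 ts); elim: ts t0 => [|t1 ts IHts] t0 t00 ts0.
  rewrite /= EX//; rewrite (_ : hom t0 [::] = fun n => dpow n t0 *: bpow (fmul SB) e X n).
    exact: cvg_bexp.
  apply/funext => j; rewrite /hom words_mono_nil -[nseq _ _]cats0 (wprod_cat_nseq bB).
  by rewrite (bmul1r bB).
have /andP[t10 ts0'] := ts0.
(* The Cauchy product shifts the letter Y into degree 1 of the second factor. *)
pose b j := if j is j'.+1 then fmul SB Y (hom t1 ts j') else 0.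
pose be j := if j is j'.+1 then `|Y| * (`|e| * (rho ^+ j' * \sum_(w <- words j') mono (exps w)
    (t1 :: ts))) else 0.
have bbe j : `|b j| <= be j.
  case: j => [|j]; rewrite /b /be ?normr0//.
  apply: le_trans (norm_bmul bB _ _) _; rewrite ler_wpM2l//; exact: norm_hom_le.
have shift (V : zmodType) (f g : nat -> V) : g 0%N = 0 -> (forall j, g j.+1 = f j) ->
    [sequence series g n.+1]_n = series f.
  move=> g0 gS; apply/funext => n; rewrite /series /= big_nat_recl// g0 add0r.
  by apply: eq_bigr => k _; rewrite gS.
have cbe : cvgn (series be).
  pose g j := `|Y| * (`|e| * (rho ^+ j * \sum_(w <- words j) mono (exps w) (t1 :: ts))).
  have cg : cvgn (series g).
    by do 2! apply: is_cvg_series_mull; exact: is_cvg_series_words_mono.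
  apply/cvg_ex; exists (limn (series g)); rewrite -(cvg_shiftS (series be)).
  by rewrite (shift _ g).
have cb : series b @ \oo --> fmul SB Y (dyson_word SB E Y t1 ts).
  rewrite -(cvg_shiftS (series b)) (shift _ (fun j => fmul SB Y (hom t1 ts j)))//.
  by apply: (cvg_series_bmulr bB); exact: IHts.
have := cauchy_product bB (fun n => @norm_exp_term_le _ _ _ _ bB X t0 n t00) bbe
  (@is_cvg_exp_bound _ _ e _) cbe (@cvg_bexp _ _ _ _ bB X t0 t00) cb.
rewrite /= EX//; set c := (fun n => \sum_(k < n.+1) _); suff -> : hom t0 (t1 :: ts) = c by [].
apply/funext => j; rewrite /hom words_mono_cons /c big_ord_recr /= subnn /= (bmul0r bB) addr0.
apply: eq_bigr => i _; have ij := ltn_ord i.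
have -> : (j - i = (j - i.+1).+1)%N by lia.
rewrite /b (bmulZl bB); congr (_ *: _).
rewrite /hom !(bmul_sumr bB); apply: eq_bigr => w _.
by rewrite !(bmulZr bB) (wprod_cat_nseq bB).
Qed.

End DysonWords.

(** * Laurent series with values in a Banach algebra *)

Section GradedConvolution.
Context (U V W : zmodType) (m : U -> V -> W).
Hypothesis m0l : forall y, m 0 y = 0.
Hypothesis m0r : forall x, m x 0 = 0.

Lemma gr_convE (c : int -> U) (d : int -> V) (M N : nat) :
  (forall n, n < - M%:Z -> c n = 0) -> (forall n, n < - N%:Z -> d n = 0) ->
  forall k : nat, gr_conv m c d (k%:Z - (M + N)%:Z) =
    \sum_(i < k.+1) m (c (i%:Z - M%:Z)) (d ((k - i)%N%:Z - N%:Z)).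
Proof.
move=> c0 d0 k; rewrite /gr_conv.
pose s := [seq (val i)%:Z - M%:Z | i <- index_enum 'I_k.+1].
have us : uniq s.
  rewrite map_inj_uniq ?index_enum_uniq// => i j /(congr1 (fun z => z + M%:Z)).
  by rewrite !subrK => -[] /val_inj.
rewrite -(@fsbig_widen _ _ _ _ [set` s]) => [||n [_ /= ns]]; last 2 first.
- by [].
- have [n0|n0] := ltP n (- M%:Z); first by rewrite c0.
  have [nk|nk] := leP n (k%:Z - M%:Z); last by rewrite (d0 (k%:Z - (M + N)%:Z - n)) ?m0r//; lia.
  have [q qE] : exists q : nat, n = q%:Z - M%:Z by exists (absz (n + M%:Z)); lia.
  exfalso; apply: ns; apply/mapP; have qk : (q < k.+1)%N by lia.
  by exists (Ordinal qk); rewrite ?mem_index_enum.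
rewrite -fsbig_seq// big_map; apply: eq_bigr => i _; congr (m _ (d _)).
by have := ltn_ord i; rewrite /=; lia.
Qed.

Lemma gr_conv_lt0 (c : int -> U) (d : int -> V) (M N : nat) :
  (forall n, n < - M%:Z -> c n = 0) -> (forall n, n < - N%:Z -> d n = 0) ->
  forall n, n < - (M + N)%N%:Z -> gr_conv m c d n = 0.
Proof.
move=> c0 d0 n nMN; rewrite /gr_conv fsbig1// => i _.
by have [iM|iM] := ltP i (- M%:Z); [rewrite c0|rewrite (d0 (n - i)) ?m0r//; lia].
Qed.

End GradedConvolution.

Section LaurentSeries.
Context (R : realType) (B : completeNormedModType R).

(** Laurent expansion at 0 with pole of order at most [M], written as a power
   series for [t^M a(t)]. Absolute convergence is part of it so that expansions
   can be multiplied. *)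
Definition laurent (a : R -> B) (c : int -> B) (M : nat) (delta : R) :=
  (forall n, n < - M%:Z -> c n = 0) /\ forall t, 0 < t < delta ->
  cvgn (series (fun k => t ^+ k * `|c (k%:Z - M%:Z)|)) /\
  series (fun k => t ^+ k *: c (k%:Z - M%:Z)) @ \oo --> t ^+ M *: a t.

Lemma laurentW a c M d d' : d' <= d -> laurent a c M d -> laurent a c M d'.
Proof.
move=> dd [c0 h]; split=> // t /andP[t0 td]; apply: h.
by rewrite t0 (lt_le_trans td).
Qed.

Lemma series_lead0 (V : zmodType) (f g : nat -> V) d :
  (forall k, (k < d)%N -> f k = 0) -> (forall k, f (k + d)%N = g k) ->
  forall n, series f (n + d)%N = series g n.
Proof.
move=> f0 fg n; rewrite /series /= (@big_cat_nat _ _ _ d 0 (n + d))//= ?leq_addl//.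
rewrite big_nat big1 ?add0r; last by move=> k /andP[_ /f0].
rewrite -{1}[d]add0n big_addn addnK; apply: eq_bigr => k _; exact: fg.
Qed.

(** Abel's lemma: the terms are bounded at [s], so geometric at [t]. *)
Lemma cvg_power_series_inside (c : nat -> B) (t s : R) : 0 < t < s ->
  cvgn (series (fun k => s ^+ k *: c k)) -> cvgn (series (fun k => t ^+ k * `|c k|)).
Proof.
move=> /andP[t0 ts] /cvg_series_cvg_0 c0; have s0 := lt_trans t0 ts.
have [C CP] : exists C, forall k, `|s ^+ k *: c k| <= C.
  have /cvg_seq_bounded[M [_ HM]] : cvgn (fun k => s ^+ k *: c k).
    by apply/cvg_ex; exists 0.
  by exists (M + 1) => k; apply: (HM (M + 1)) => //; rewrite ltrDl.
have cg : cvgn (series (fun k => C * (t / s) ^+ k)).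
  apply: is_cvg_series_mull; have := @is_cvg_geometric_series R 1 (t / s).
  rewrite ger0_norm ?divr_ge0 ?ltW// ltr_pdivrMr// mul1r => /(_ ts).
  by rewrite /geometric /=; under [X in series X]eq_fun do rewrite mul1r.
apply: (@is_cvg_series_dominated R R^o _ _ _ cg) => k.
have ck : `|c k| <= C / s ^+ k.
  rewrite ler_pdivlMr ?exprn_gt0// mulrC.
  by have := CP k; rewrite normrZ normrX (gtr0_norm s0).
rewrite normrM normr_id normrX (gtr0_norm t0) expr_div_n mulrCA.
by rewrite ler_wpM2l// exprn_ge0// ltW.
Qed.

Lemma symbol_laurent (a : R -> B) (c : int -> B) :
  symbol (fun=> setT) a c -> exists M0 : nat, exists2 delta : R, 0 < delta &
    forall M, (M0 <= M)%N -> laurent a c M delta.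
Proof.
move=> [_ [N [eps eps0 [c0 hc]]]]; exists `|N|%N; exists (eps / 2); first by rewrite divr_gt0.
move=> M NM; split=> [n nM|t /andP[t0 te]]; first by apply: c0; lia.
have [d dE] : exists d : nat, d%:Z = N + M%:Z by exists (absz (N + M%:Z)); lia.
have cd k : (k < d)%N -> c (k%:Z - M%:Z) = 0 by move=> kd; apply: c0; lia.
have h s : 0 < s < eps -> series (fun k => s ^+ k *: c (k%:Z - M%:Z)) @ \oo --> s ^+ M *: a s.
  move=> se; rewrite -(cvg_shiftn d (series _)).
  have s0 : 0 < s by case/andP: se.
  have -> : [sequence series (fun k => s ^+ k *: c (k%:Z - M%:Z)) (n + d)%N]_n =
      fun n => s ^+ M *: \sum_(k < n) s ^ (N + k%:Z) *: c (N + k%:Z).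
    apply/funext => n; apply: etrans (@series_lead0 _ _ (fun k => s ^+ M *: (s ^ (N + k%:Z) *:
        c (N + k%:Z))) d _ _ n) _.
    - by move=> k /cd ->; rewrite scaler0.
    - move=> k; have -> : (k + d)%:Z - M%:Z = N + k%:Z by lia.
      rewrite scalerA; congr (_ *: _).
      by rewrite !exprnP -expfzDr ?gt_eqF//; congr (_ ^ _); lia.
    - by rewrite /series /= big_mkord scaler_sumr.
  by apply: cvgZl_tmp; exact: hc.
split; last by apply: h; rewrite t0 (lt_trans te)// ltr_pdivrMr// ltr_pMr// ltr1n.
apply: (@cvg_power_series_inside _ _ (t * 2)); first by rewrite t0 ltr_pMr// ltr1n.
by apply/cvg_ex; eexists; apply: h; rewrite mulr_gt0//= -ltr_pdivlMr.
Qed.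

(** The lowest nonzero coefficient of the difference would be the limit at 0
   of the difference divided by a power of t, which is 0. *)
Lemma laurent_uniq a c d M delta : 0 < delta ->
  laurent a c M delta -> laurent a d M delta -> c = d.
Proof.
move=> delta0 [c0 hc] [d0 hd].
pose b k := c (k%:Z - M%:Z) - d (k%:Z - M%:Z).
suff b0 k : b k = 0.
  apply/funext => n; have [nM|nM] := ltP n (- M%:Z); first by rewrite c0// d0.
  have -> : n = (absz (n + M%:Z))%:Z - M%:Z by lia.
  by apply/eqP; rewrite -subr_eq0; apply/eqP; exact: b0.
have sb t : 0 < t < delta -> series (fun k => t ^+ k *: b k) @ \oo --> 0.
  move=> td; have [_ h1] := hc t td; have [_ h2] := hd t td.
  rewrite -(subrr (t ^+ M *: a t)).
  have -> : series (fun k => t ^+ k *: b k) = series (fun k => t ^+ k *: c (k%:Z - M%:Z)) -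
      series (fun k => t ^+ k *: d (k%:Z - M%:Z)).
    rewrite -seriesN -seriesD; congr series; apply/funext => i.
    by rewrite /b scalerBr.
  exact: cvgB.
have sbn t : 0 < t < delta -> cvgn (series (fun k => t ^+ k * `|b k|)).
  move=> /andP[t0 td]; have tm : t < (t + delta) / 2 by lra.
  apply: (@cvg_power_series_inside _ _ ((t + delta) / 2)); first by rewrite t0.
  by apply/cvg_ex; exists 0; apply: sb; apply/andP; split; lra.
elim/ltn_ind: k => k IHk.
pose t0 := delta / 2; have t0d : 0 < t0 < delta by rewrite /t0; apply/andP; split; lra.
pose t n := t0 / (n.+1)%:R.
have tp n : 0 < t n by rewrite divr_gt0//; case/andP: t0d.
have tle n : t n <= t0 by rewrite ler_pdivrMr// ler_peMr ?ler1n//; case/andP: t0d => /ltW.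
have td n : 0 < t n < delta by rewrite tp (le_lt_trans (tle n))//; case/andP: t0d.
have shift s : 0 < s < delta -> series (fun i => s ^+ i *: b (i + k)%N) @ \oo --> 0.
  move=> sd; have s0 : 0 < s by case/andP: sd.
  have := sb s sd; rewrite -(cvg_shiftn k (series _)).
  have -> : [sequence series (fun k => s ^+ k *: b k) (n + k)%N]_n = fun n => s ^+ k *: series
      (fun i => s ^+ i *: b (i + k)%N) n.
    apply/funext => n; apply: etrans (@series_lead0 _ _ (fun i => s ^+ k *: (s ^+ i *: b (i +
        k)%N)) k _ _ n) _.
    - by move=> i /IHk ->; rewrite scaler0.
    - by move=> i; rewrite scalerA -exprD addnC.
    - by rewrite /series /= scaler_sumr.
  move=> /(@cvgZl_tmp _ _ _ _ _ (s ^- k)); rewrite scaler0.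
  apply: cvg_trans; apply: near_eq_cvg; apply: nearW => n.
  by rewrite /= scalerA mulVf ?scale1r// expf_neq0// gt_eqF.
have [||||q hq cq] := @dominated_series_cvg R B (fun n i => t n ^+ i *: b (i + k)%N) (fun i =>
    if i == 0%N then b k else 0) (fun i => t0 ^- k * (t0 ^+ (i + k) * `|b (i + k)%N|)) (fun=> 0).
- move=> i; case: eqP => [->|/eqP i0].
    by apply: cvg_near_cst; apply: nearW => n; rewrite expr0 scale1r.
  rewrite -(scale0r (b (i + k)%N)); apply: cvgZr_tmp.
  have -> : 0 = 0 ^+ i :> R by rewrite expr0n (negbTE i0).
  apply: (@cvg_comp _ _ _ t (fun x => x ^+ i) _ (nbhs 0)) => //; last exact: exprn_continuous.
  by rewrite -(mulr0 t0); apply: cvgMl_tmp; exact: cvg_harmonic.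
- move=> n i; have t00 : 0 < t0 by case/andP: t0d.
  rewrite normrZ normrX (gtr0_norm (tp n)) mulrA exprD mulrCA mulVf ?mulr1 ?expf_neq0 ?gt_eqF//.
  rewrite ler_wpM2r//; apply: lerXn2r; rewrite ?nnegrE ?tle//; exact: ltW.
- apply: is_cvg_series_mull; have [l hl] := iffLR (cvg_ex _) (sbn t0 t0d).
  apply/cvg_ex; exists (l - series (fun i => t0 ^+ i * `|b i|) k).
  have -> : series (fun i => t0 ^+ (i + k) * `|b (i + k)%N|) = fun n => series (fun i => t0 ^+
      i * `|b i|) (n + k)%N - series (fun i => t0 ^+ i * `|b i|) k.
    apply/funext => n; rewrite sub_series_geq ?leq_addl// -[X in \sum_(X <= _ < _) _]add0n.
    by rewrite big_addn addnK.
  by apply: cvgB; [rewrite (cvg_shiftn k (series _))|exact: cvg_cst].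
- by move=> n; exact: shift.
have q0 : q = 0 by apply: cvg_unique cq (@cvg_cst _ (0 : B) _ _ _).
have : series (fun i => if i == 0%N then b k else 0) @ \oo --> b k.
  apply: cvg_near_cst; near=> n; have n0 : (0 < n)%N by near: n; exact: nbhs_infty_gt.
  by rewrite /series /= big_ltn//= big_nat big1 ?addr0// => -[|i].
by move=> /(cvg_unique _ hq) <-.
Unshelve. all: by end_near. Qed.

End LaurentSeries.

Section NonnegSeries.
Context (R : realType).

Lemma nonneg_series_bounded (f : nat -> R) C : (forall k, 0 <= f k) ->
  (forall n, series f n <= C) -> cvgn (series f) /\ limn (series f) <= C.
Proof.
move=> f0 fC; have cf : cvgn (series f).
  apply: nondecreasing_is_cvgn; first by apply: nondecreasing_series => k _ _.
  by exists C => _ [n _ <-].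
split=> //; apply: ler_cvg_to cf (@cvg_cst _ C _ _ _) _; exact: nearW.
Qed.

Lemma series_le_lim (f : nat -> R) n : (forall k, 0 <= f k) ->
  cvgn (series f) -> series f n <= limn (series f).
Proof.
by move=> f0 cf; apply: nondecreasing_cvgn_le => //; apply: nondecreasing_series => k _ _.
Qed.

Lemma cvg_series_cons (V : normedModType R) (f g : nat -> V) s :
  (forall j, g j.+1 = f j) -> series f @ \oo --> s ->
  series g @ \oo --> g 0%N + s.
Proof.
move=> gf fs; rewrite -(cvg_shiftS (series g)).
have -> : [sequence series g n.+1]_n = fun n => g 0%N + series f n.
  apply/funext => n; rewrite /series /= big_nat_recl//; congr (_ + _).
  by apply: eq_bigr => k _; rewrite gf.
by apply: cvgD => //; exact: cvg_cst.
Qed.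

Lemma cvg_series_behead (V : normedModType R) (g : nat -> V) s :
  series g @ \oo --> s -> series (fun j => g j.+1) @ \oo --> s - g 0%N.
Proof.
rewrite -(cvg_shiftS (series g)) => gs.
have -> : series (fun j => g j.+1) = fun n => series g n.+1 - g 0%N.
  by apply/funext => n; rewrite /series /= big_nat_recl// addrC addKr.
by apply: cvgB => //; exact: cvg_cst.
Qed.

Lemma cvg_series_bigsum (V : normedModType R) (I : Type) (r : seq I)
    (f : I -> nat -> V) (s : I -> V) :
  (forall i, series (f i) @ \oo --> s i) ->
  series (fun k => \sum_(i <- r) f i k) @ \oo --> \sum_(i <- r) s i.
Proof.
move=> fs; have -> : series (fun k => \sum_(i <- r) f i k) = fun n => \sum_(i <- r) series (f i) n.
  by apply/funext => n; rewrite /series /= exchange_big.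
by apply: cvg_big => [|i _]; [exact: (@add_continuous V)|exact: fs].
Qed.

(** It allows Cauchy products of series of norms. *)
Lemma real_banach_algebra : @banach_algebra R R^o *%R 1.
Proof.
split.
- exact: mulrDl.
- exact: mulrDr.
- by move=> r x y; rewrite scalerAl.
- by move=> r x y; rewrite scalerAr.
- exact: mulrA.
- exact: mul1r.
- exact: mulr1.
- by move=> x y; rewrite normrM.
- move=> z; apply: cvgM; [exact: cvg_fst|exact: cvg_snd].
Qed.

End NonnegSeries.

Section LaurentProducts.
Context (R : realType) (B : completeNormedModType R).
Context (mul : B -> B -> B) (e : B) (bB : banach_algebra mul e).

(** The submultiplicative norm of the algebra of Laurent series that converge
   absolutely at [t]. *)
Definition lnorm (c : int -> B) (M : nat) (t : R) : R :=
  limn (series (fun k => t ^+ k * `|c (k%:Z - M%:Z)|)).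

Lemma laurent_mul a b c d M N delta :
  laurent a c M delta -> laurent b d N delta ->
  laurent (fun t => mul (a t) (b t)) (gr_conv mul c d) (M + N) delta /\
  forall t, 0 < t < delta ->
    lnorm (gr_conv mul c d) (M + N) t <= lnorm c M t * lnorm d N t.
Proof.
move=> [c0 hc] [d0 hd].
have cvE := gr_convE (bmul0l bB) (bmul0r bB) c0 d0.
suff h t : 0 < t < delta ->
  [/\ cvgn (series (fun k => t ^+ k * `|gr_conv mul c d (k%:Z - (M + N)%:Z)|)),
     lnorm (gr_conv mul c d) (M + N) t <= lnorm c M t * lnorm d N t &
     series (fun k => t ^+ k *: gr_conv mul c d (k%:Z - (M + N)%:Z)) @ \oo -->
        t ^+ (M + N) *: mul (a t) (b t)].
  split; last by move=> t /h[].
  split; first exact: (gr_conv_lt0 (bmul0l bB) (bmul0r bB) c0 d0).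
  by move=> t /h[].
move=> td; have t0 : 0 <= t by case/andP: td => /ltW.
have [hc1 hc2] := hc t td; have [hd1 hd2] := hd t td.
have nc k : `|t ^+ k *: c (k%:Z - M%:Z)| <= t ^+ k * `|c (k%:Z - M%:Z)|.
  by rewrite normrZ ger0_norm// exprn_ge0.
have nd k : `|t ^+ k *: d (k%:Z - N%:Z)| <= t ^+ k * `|d (k%:Z - N%:Z)|.
  by rewrite normrZ ger0_norm// exprn_ge0.
have nc0 k : 0 <= t ^+ k * `|c (k%:Z - M%:Z)| by rewrite mulr_ge0 ?exprn_ge0.
have nd0 k : 0 <= t ^+ k * `|d (k%:Z - N%:Z)| by rewrite mulr_ge0 ?exprn_ge0.
pose f n : R := \sum_(i < n.+1) (t ^+ i * `|c (i%:Z - M%:Z)|) * (t ^+ (n - i) * `|d ((n -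
    i)%N%:Z - N%:Z)|).
have f0 n : 0 <= f n by apply: sumr_ge0 => i _; exact: mulr_ge0.
have fle n : t ^+ n * `|gr_conv mul c d (n%:Z - (M + N)%:Z)| <= f n.
  rewrite cvE -[t ^+ n]ger0_norm ?exprn_ge0// -normrZ scaler_sumr.
  apply: le_trans (ler_norm_sum _ _ _) _; apply: ler_sum => i _.
  have tn : t ^+ n = t ^+ i * t ^+ (n - i) by rewrite -exprD subnKC// -ltnS.
  rewrite normrZ ger0_norm ?exprn_ge0// tn mulrACA.
  by rewrite ler_wpM2l ?mulr_ge0 ?exprn_ge0//; exact: (norm_bmul bB).
have rnn (g : nat -> R) : (forall k, 0 <= g k) -> forall k, `|g k| <= g k.
  by move=> g0 k; rewrite ger0_norm.
have cf : series f @ \oo --> lnorm c M t * lnorm d N t.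
  exact: (cauchy_product (real_banach_algebra R) (rnn _ nc0) (rnn _ nd0) hc1 hd1 hc1 hd1).
have cb n : series (fun k => t ^+ k * `|gr_conv mul c d (k%:Z - (M + N)%:Z)|) n <= lnorm c M t
    * lnorm d N t.
  apply: (@le_trans _ _ (series f n)); first by apply: ler_sum.
  rewrite -(cvg_lim _ cf)//; apply: series_le_lim => //.
  by apply/cvg_ex; eexists; exact: cf.
have [|c1 c2] := nonneg_series_bounded _ cb.
  by move=> k; rewrite mulr_ge0 ?exprn_ge0.
split=> //.
have := cauchy_product bB nc nd hc1 hd1 hc2 hd2.
rewrite (bmulZl bB) (bmulZr bB) scalerA -exprD; apply: cvg_trans; apply: near_eq_cvg; apply:
    nearW => K.
apply: eq_bigr => n _; rewrite cvE scaler_sumr; apply: eq_bigr => i _.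
rewrite (bmulZl bB) (bmulZr bB) scalerA -exprD.
by rewrite subnKC// -ltnS.
Qed.

Context (X Y : R -> B) (cX cY : int -> B) (M : nat) (delta : R).
Hypothesis lX : laurent X cX M delta.
Hypothesis lY : laurent Y cY M delta.

(** Laurent coefficients of the word w in X and Y *)
Definition cword (w : seq bool) : int -> B :=
  foldr (fun b => gr_conv mul (if b then cY else cX))
    (fun n => if n == 0 then e else 0) w.

Let laurent1 : laurent (fun=> e) (fun n => if n == 0 then e else 0) 0 delta /\
  forall t, 0 < t < delta -> lnorm (fun n => if n == 0 then e else 0) 0 t <= `|e|.
Proof.
pose d1 (n : int) := if n == 0 then e else 0.
have h1 t : series (fun k => t ^+ k * `|d1 (k%:Z - 0%N%:Z)|) @ \oo --> `|e|.
  apply: cvg_near_cst; near=> n; have n0 : (0 < n)%N by near: n; exact: nbhs_infty_gt.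
  rewrite /series /= big_ltn// big_nat big1 => [|[|k]]; rewrite /d1 ?subr0//=.
    by rewrite expr0 mul1r addr0.
  by rewrite normr0 mulr0.
split; last by move=> t _; rewrite /lnorm (cvg_lim _ (h1 t)).
split; first by move=> n; case: eqP => // ->.
move=> t _; split; first by apply/cvg_ex; eexists; exact: h1.
apply: cvg_near_cst; near=> n; have n0 : (0 < n)%N by near: n; exact: nbhs_infty_gt.
rewrite /series /= big_ltn// big_nat big1 => [|[|k]]; rewrite ?subr0//=.
  by rewrite expr0 scale1r addr0.
by rewrite scaler0.
Unshelve. all: by end_near. Qed.

Lemma laurent_word w :
  laurent (fun t => wprod mul e (X t) (Y t) w) (cword w) (size w * M) delta /\
  forall t, 0 < t < delta -> lnorm (cword w) (size w * M) t <=
    `|e| * Num.max (lnorm cX M t) (lnorm cY M t) ^+ size w.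
Proof.
elim: w => [|b w [IHw IHn]] /=.
  by rewrite mul0n; split=> [|t /(laurent1.2 _)]; [exact: laurent1.1|rewrite expr0 mulr1].
have lb : laurent (fun t => if b then Y t else X t) (if b then cY else cX) M delta.
  by case: b.
have [h1 h2] := laurent_mul lb IHw; rewrite mulSn; split=> // t td.
apply: le_trans (h2 t td) _; rewrite exprS mulrCA.
apply: ler_pM.
- have [cv _] := lb.2 t td; apply: le_trans (series_le_lim 0 _ cv).
    by rewrite /series /= big_geq.
  by move=> k; rewrite mulr_ge0// exprn_ge0//; case/andP: td => /ltW.
- have [cv _] := IHw.2 t td; apply: le_trans (series_le_lim 0 _ cv).
    by rewrite /series /= big_geq.
  by move=> k; rewrite mulr_ge0// exprn_ge0//; case/andP: td => /ltW.
- by rewrite le_max; case: b {lb h1 h2}; rewrite lexx ?orbT.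
- exact: IHn.
Qed.

End LaurentProducts.

(** * Laurent coefficients of series of words *)

Section LaurentWordCoefficients.
Context (R : realType) (B : completeNormedModType R).
Context (mul : B -> B -> B) (e : B) (bB : banach_algebra mul e).
Context (X Y : R -> B) (cX cY : int -> B) (M : nat) (delta : R).
Hypothesis delta0 : 0 < delta.
Hypothesis lX : laurent X cX M delta.
Hypothesis lY : laurent Y cY M delta.
Context (l : B -> R) (L : R).
Hypothesis l_lin : forall (a : R) x y, l (a *: x + y) = a * l x + l y.
Hypothesis l_le : forall x, `|l x| <= L * `|x|.

Let l0 : l 0 = 0.
Proof. by have := l_lin (-1) 0 0; rewrite scaler0 addr0; lra. Qed.

Let lZ a x : l (a *: x) = a * l x.
Proof. by have := l_lin a x 0; rewrite l0 !addr0. Qed.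

Let lD x y : l (x + y) = l x + l y.
Proof. by have := l_lin 1 x y; rewrite scale1r mul1r. Qed.

Let lN y : l (- y) = - l y.
Proof. by rewrite -[in LHS]scaleN1r lZ mulN1r. Qed.

Lemma cvg_series_form (f : nat -> B) s : series f @ \oo --> s ->
  series (fun k => l (f k)) @ \oo --> l s.
Proof.
move=> fs; have -> : series (fun k => l (f k)) = fun n => l (series f n).
  apply/funext => n; rewrite /series /=.
  by rewrite (big_morph l lD l0).
apply/cvgrPdist_le => eps eps0.
have C0 : 0 < `|L| + 1 by rewrite ltr_wpDl.
have /cvgrPdist_le /(_ (eps / (`|L| + 1))) := fs.
rewrite divr_gt0// => /(_ isT); apply: filterS => n.
rewrite ler_pdivlMr// => h.
have -> : l s - l (series f n) = l (s - series f n).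
  by rewrite lD lN.
apply: le_trans (l_le _) _; apply: le_trans h; rewrite mulrC ler_wpM2l//.
by apply: le_trans (ler_norm _) _; rewrite lerDl.
Qed.

Context (th : seq bool -> R).
Hypothesis th0 : forall w, 0 <= th w.
Hypothesis th_sum : forall rho, 0 <= rho ->
  cvgn (series (fun j => rho ^+ j * \sum_(w <- words j) th w)).
Context (b : R -> B) (cb : int -> B) (N : nat).
Hypothesis lb : laurent b cb N delta.
Hypothesis sum_b : forall t, 0 < t < delta ->
  series (fun j => \sum_(w <- words j) th w * l (wprod mul e (X t) (Y t) w))
    @ \oo --> l (b t).

Let C w := cword mul e cX cY w.

(** Row 0 is the expansion of [- b], row [j + 1] that of the words of length [j]. *)
Let D j k : R := if j is j'.+1
  then \sum_(w <- words j') th w * l (C w (k%:Z - (j' * M)%:Z))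
  else - l (cb (k%:Z - N%:Z)).

Let x j k : int := if j is j'.+1 then k%:Z - (j' * M)%:Z else k%:Z - N%:Z.

Let sigma := ln delta.

Let small (s : R) : s < sigma -> 0 < expR s < delta.
Proof. by move=> ss; rewrite expR_gt0 -[ltRHS]lnK ?posrE// ltr_expR. Qed.

Let expx (k m : nat) (s : R) : expR ((k%:Z - m%:Z)%:~R * s) = expR s ^- m * expR s ^+ k.
Proof.
rewrite intrD rmorphN /= mulrDl expRD mulNr expRN mulrC.
by rewrite ![_%:~R * s]mulrC !expRM_natr.
Qed.

Let bound (s : R) j := `|L| * `|e| * ((expR s ^- M * Num.max (lnorm cX M (expR s)) (lnorm cY M
    (expR s))) ^+ j *
  \sum_(w <- words j) th w).

(** The norm of the Laurent series of a word is submultiplicative; the factor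
   [expR s ^- M] in [bound] comes from the poles of its letters. *)
Let row_abs s j : s < sigma ->
  cvgn (series (fun k => `|D j.+1 k * expR ((x j.+1 k)%:~R * s)|)) /\
  limn (series (fun k => `|D j.+1 k * expR ((x j.+1 k)%:~R * s)|)) <= bound s j.
Proof.
move=> /small td; set t := expR s in td *; have t0 : 0 < t by case/andP: td.
apply: nonneg_series_bounded => // n.
apply: (@le_trans _ _ (\sum_(0 <= k < n) \sum_(w <- words j) th w * (`|L| * (t ^- (j * M) * (t
    ^+ k * `|C w (k%:Z - (j * M)%:Z)|))))).
  apply: ler_sum => k _; rewrite /D /x expx -/t normrM.
  set q := t ^- (j * M) * t ^+ k.
  have q0 : 0 <= q by rewrite mulr_ge0// ?invr_ge0 exprn_ge0// ltW.
  rewrite (ger0_norm q0).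
  apply: (@le_trans _ _ ((\sum_(w <- words j) th w * (`|L| * `|C w (k%:Z - (j * M)%:Z)|)) * q)).
    rewrite ler_wpM2r//; apply: le_trans (ler_norm_sum _ _ _) _; apply: ler_sum => w _.
    rewrite normrM (ger0_norm (th0 w)) ler_wpM2l//; apply: le_trans (l_le _) _.
    by rewrite ler_wpM2r// ler_norm.
  rewrite mulr_suml le_eqVlt; apply/orP; left; apply/eqP; apply: eq_bigr => w _.
  by rewrite /q; ring.
rewrite exchange_big /bound /= exprMn.
have -> : `|L| * `|e| * ((t ^- M) ^+ j * Num.max (lnorm cX M t) (lnorm cY M t) ^+ j * \sum_(w
    <- words j) th w) =
  \sum_(w <- words j) th w * (`|L| * (t ^- (j * M) * (`|e| * Num.max (lnorm cX M t) (lnorm cY M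
      t) ^+ j))).
  by rewrite -mulr_suml mulnC exprM exprVn; ring.
rewrite big_seq [leRHS]big_seq; apply: ler_sum => w /size_words wj.
rewrite -mulr_sumr ler_wpM2l// -mulr_sumr ler_wpM2l// -mulr_sumr ler_wpM2l ?invr_ge0 ?exprn_ge0
    ?(ltW t0)//.
have [[_ hw] hn] := laurent_word bB lX lY w.
have [cw _] := hw t td; rewrite wj in cw hn.
apply: le_trans (hn t td); apply: series_le_lim cw => k.
by rewrite mulr_ge0// exprn_ge0// ltW.
Qed.

Let max_ge0 t : 0 < t < delta -> 0 <= Num.max (lnorm cX M t) (lnorm cY M t).
Proof.
move=> td; rewrite le_max; apply/orP; left.
have [cv _] := lX.2 t td; apply: le_trans (series_le_lim 0 _ cv).
  by rewrite /series /= big_geq.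
by move=> k; rewrite mulr_ge0// exprn_ge0//; case/andP: td => /ltW.
Qed.

Let D_abs s : s < sigma ->
  exists d, double_sum (fun j k => `|D j k * expR ((x j k)%:~R * s)|) d.
Proof.
move=> ss; have td := small ss; have t0 : 0 < expR s by case/andP: td.
have row0 : cvgn (series (fun k => `|D 0%N k * expR ((x 0%N k)%:~R * s)|)).
  have [cv _] := lb.2 _ td.
  apply: (@is_cvg_series_dominated R R^o _ (fun k => `|L| * (expR s ^- N * (expR s ^+ k * `|cb
      (k%:Z - N%:Z)|)))).
    move=> k; rewrite normr_id /D /x expx normrM normrN.
    rewrite [X in _ * X]ger0_norm; last by rewrite mulr_ge0// ?invr_ge0 exprn_ge0// ltW.
    rewrite mulrC; have -> : `|L| * (expR s ^- N * (expR s ^+ k * `|cb (k%:Z - N%:Z)|)) = expR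
        s ^- N * expR s ^+ k * (`|L| * `|cb (k%:Z - N%:Z)|) by ring.
    rewrite ler_wpM2l ?mulr_ge0 ?invr_ge0 ?exprn_ge0 ?(ltW t0)//.
    by apply: le_trans (l_le _) _; rewrite ler_wpM2r// ler_norm.
  by do 2! apply: is_cvg_series_mull.
pose r j := limn (series (fun k => `|D j k * expR ((x j k)%:~R * s)|)).
have rj j : series (fun k => `|D j k * expR ((x j k)%:~R * s)|) @ \oo --> r j.
  by case: j => [//|j]; have [] := row_abs j ss.
have r0 j : 0 <= r j.
  apply: (@le_trans _ _ (series (fun k => `|D j k * expR ((x j k)%:~R * s)|) 0)).
    by rewrite /series /= big_geq.
  by apply: series_le_lim => //; apply/cvg_ex; exists (r j); exact: rj.
have cbd : cvgn (series (bound s)).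
  apply: is_cvg_series_mull; apply: th_sum.
  by rewrite mulr_ge0 ?max_ge0// invr_ge0 exprn_ge0// ltW.
have cr : cvgn (series (fun j => r j.+1)).
  apply: (@is_cvg_series_dominated R R^o _ _ _ cbd) => j.
  by rewrite ger0_norm//; have [] := row_abs j ss.
exists (r 0%N + limn (series (fun j => r j.+1))); exists r => //.
exact: (cvg_series_cons (f := fun j => r j.+1)).
Qed.

Let D_zero s : s < sigma -> double_sum (fun j k => D j k * expR ((x j k)%:~R * s)) 0.
Proof.
move=> ss; have td := small ss; set t := expR s in td *; have t0 : 0 < t by case/andP: td.
pose r j := if j is j'.+1 then \sum_(w <- words j') th w * l (wprod mul e (X t) (Y t) w) else -
    l (b t).
exists r; last first.
  rewrite (_ : 0 = r 0%N + l (b t)); last by rewrite /= addrC subrr.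
  by apply: (cvg_series_cons (f := fun j => r j.+1)) => //; exact: sum_b.
have scaled (c : int -> B) (m : nat) (y : B) :
    series (fun k => t ^+ k *: c (k%:Z - m%:Z)) @ \oo --> t ^+ m *: y ->
    series (fun k => l (c (k%:Z - m%:Z)) * expR ((k%:Z - m%:Z)%:~R * s)) @ \oo --> l y.
  move=> h; have -> : y = t ^- m *: (t ^+ m *: y).
    by rewrite scalerA mulVf ?scale1r// expf_neq0// gt_eqF.
  rewrite lZ (_ : (fun k => _) = fun k => t ^- m * l (t ^+ k *: c (k%:Z - m%:Z))); last first.
    by apply/funext => k; rewrite expx lZ -/t; ring.
  have -> : series (fun k => t ^- m * l (t ^+ k *: c (k%:Z - m%:Z))) = (fun n => t ^- m *
      series (fun k => l (t ^+ k *: c (k%:Z - m%:Z))) n).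
    by apply/funext => n; rewrite /series /= mulr_sumr.
  by apply: cvgMl_tmp; exact: cvg_series_form.
case=> [|j].
  rewrite /r (_ : (fun k => _) = - (fun k => l (cb (k%:Z - N%:Z)) * expR ((k%:Z - N%:Z)%:~R * s))).
    by rewrite seriesN; apply: cvgN; apply: scaled; have [] := lb.2 t td.
  by apply/funext => k; rewrite /D /x mulNr.
rewrite /r (_ : (fun k => _) = (fun k => \sum_(w <- words j) (if size w == j then th w * (l (C
    w (k%:Z - (j * M)%:Z)) * expR ((k%:Z - (j * M)%:Z)%:~R * s)) else 0))); last first.
  apply/funext => k; rewrite /D /x mulr_suml big_seq [RHS]big_seq; apply: eq_bigr => w
      /size_words ->.
  by rewrite eqxx mulrA.
rewrite (_ : \sum_(w <- words j) _ = \sum_(w <- words j) (if size w == j then th w * l (wprod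
    mul e (X t) (Y t) w) else 0)); last first.
  by rewrite big_seq [RHS]big_seq; apply: eq_bigr => w /size_words ->; rewrite eqxx.
apply: cvg_series_bigsum => w; case: eqP => [wj|_]; last first.
  rewrite (_ : series _ = fun=> 0); first exact: cvg_cst.
  by apply/funext => n; rewrite /series /= big1.
have -> : series (fun k => th w * (l (C w (k%:Z - (j * M)%:Z)) * expR ((k%:Z - (j * M)%:Z)%:~R
    * s))) =
    fun n => th w * series (fun k => l (C w (k%:Z - (j * M)%:Z)) * expR ((k%:Z - (j *
        M)%:Z)%:~R * s)) n.
  by apply/funext => n; rewrite /series /= mulr_sumr.
apply: cvgMl_tmp; apply: scaled; have [[_ hw] _] := laurent_word bB lX lY w.
by have [_] := hw t td; rewrite wj.
Qed.

Let cvg_single (f : nat -> R) m : (forall k, k != m -> f k = 0) ->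
  series f @ \oo --> f m.
Proof.
move=> f0; apply: cvg_near_cst; near=> n.
have mn : (m < n)%N by near: n; exact: nbhs_infty_gt.
rewrite /series /= (bigD1_seq m) ?iota_uniq ?mem_index_iota//= big1 ?addr0//.
Unshelve. all: by end_near. Qed.

(** The Laurent expansion of a series of words in X and Y may be taken word by
   word, although the orders of the poles at [t = 0] are unbounded: with the
   expansion of the sum [b] subtracted, all the terms form an absolutely
   convergent two-sided Laurent series that vanishes near 0. *)
Theorem laurent_word_coef :
  series (fun j => \sum_(w <- words j) th w * l (C w 0)) @ \oo --> l (cb 0).
Proof.
have [r hr rs] := laurent_coef0 D_abs D_zero.
have r0 : r 0%N = - l (cb 0).
  have h : series (fun k => D 0%N k * (x 0%N k == 0)%:R) @ \oo --> D 0%N N * (x 0%N N == 0)%:R.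
    apply: cvg_single => k kN; rewrite /x (_ : _ == 0 = false) ?mulr0//.
    by apply/negP => /eqP kE; move/eqP: kN; apply; lia.
  rewrite (cvg_unique (@norm_hausdorff _ _) (hr 0%N) h) /D /x /=.
  by rewrite subrr eqxx mulr1.
have rS j : r j.+1 = \sum_(w <- words j) th w * l (C w 0).
  have h : series (fun k => D j.+1 k * (x j.+1 k == 0)%:R) @ \oo --> D j.+1 (j * M)%N * (x j.+1
      (j * M)%N == 0)%:R.
    apply: cvg_single => k kN; rewrite /x (_ : _ == 0 = false) ?mulr0//.
    by apply/negP => /eqP kE; move/eqP: kN; apply; lia.
  rewrite (cvg_unique (@norm_hausdorff _ _) (hr j.+1) h) /D /x /=.
  by rewrite subrr eqxx mulr1.
have := cvg_series_behead rs; rewrite r0 sub0r opprK.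
by rewrite (_ : (fun j => r j.+1) = (fun j => \sum_(w <- words j) th w * l (C w 0)))//;
    apply/funext.
Qed.

End LaurentWordCoefficients.

(** * The graded-central action on the associated graded module *)

Section GradedPairing.
Context (R : realType) (K : tvsComAlgType R).

Section Filtration.
Context (C : tvsType R) (SC : filtered_complex K C).

Lemma filtered_kactN1 x : kact SC (-1) x = - x.
Proof.
have := kact_real SC (-1) x.
by rewrite (_ : (-1)%:A = -1 :> K) ?scaleN1r.
Qed.

Lemma filN n x : fil SC n x -> fil SC n (- x).
Proof. by move=> Fx; rewrite -filtered_kactN1; exact: filZ. Qed.

Lemma gr_eq_refl y : gr_eq (fil SC) y y.
Proof. by move=> n; rewrite subrr; exact: fil0. Qed.

Lemma gr_eq_sym y z : gr_eq (fil SC) y z -> gr_eq (fil SC) z y.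
Proof. by move=> yz n; rewrite -[z n - y n]opprB; apply: filN; exact: yz. Qed.

Lemma gr_eq_trans y z w :
  gr_eq (fil SC) y z -> gr_eq (fil SC) z w -> gr_eq (fil SC) y w.
Proof. by move=> yz zw n; rewrite -(subrKA (z n)); exact: filD. Qed.

End Filtration.

Lemma grhat_bound (C : tvsType R) (F : int -> set C) y : grhat F y ->
  exists M : nat, forall n, n < - M%:Z -> y n = 0.
Proof.
by move=> [_ [N yN]]; exists `|N|%N => n nN; apply: yN; lia.
Qed.

Context (C D E : tvsType R) (SC : filtered_complex K C)
  (SD : filtered_complex K D) (SE : filtered_complex K E) (m : C -> D -> E).
Hypothesis mP : filtered_pairing SC SD SE m.

Lemma pairing0l y : m 0 y = 0.
Proof.
have [[mD _ _ _] _ _ _ _] := mP.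
by have /eqP := mD 0 0 y; rewrite addr0 -subr_eq subrr eq_sym => /eqP.
Qed.

Lemma pairing0r x : m x 0 = 0.
Proof.
have [[_ mD _ _] _ _ _ _] := mP.
by have /eqP := mD x 0 0; rewrite addr0 -subr_eq subrr eq_sym => /eqP.
Qed.

Lemma pairingBr x y z : m x (y - z) = m x y - m x z.
Proof.
have [[_ mD _ _] _ _ _ _] := mP.
by apply/eqP; rewrite eq_sym subr_eq -mD subrK.
Qed.

(** Components of a product of Laurent series are finite sums. *)
Lemma gr_conv_in (P : set E) (c : int -> C) (d : int -> D) n :
  P 0 -> (forall x y, P x -> P y -> P (x + y)) ->
  (exists M : nat, forall n, n < - M%:Z -> c n = 0) ->
  (exists M : nat, forall n, n < - M%:Z -> d n = 0) ->
  (forall i, P (m (c i) (d (n - i)))) -> P (gr_conv m c d n).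
Proof.
move=> P0 PD [M c0] [N d0] Pcd.
have [nMN|nMN] := ltP n (- (M + N)%N%:Z).
  by rewrite (gr_conv_lt0 pairing0l pairing0r c0 d0).
pose k := absz (n + (M + N)%N%:Z).
have nE : n = k%:Z - (M + N)%N%:Z by rewrite /k; lia.
rewrite nE (gr_convE pairing0l pairing0r c0 d0); apply: (@big_ind _ P) => // i _.
have -> : (k - i)%N%:Z - N%:Z = n - (i%:Z - M%:Z).
  by have := ltn_ord i; rewrite nE; lia.
exact: Pcd.
Qed.

Lemma grhat_conv c d : grhat (fil SC) c -> grhat (fil SD) d ->
  grhat (fil SE) (gr_conv m c d).
Proof.
move=> gc gd; have [M c0] := grhat_bound gc; have [N d0] := grhat_bound gd.
split; last first.
  exists (- (M + N)%N%:Z) => n; exact: (gr_conv_lt0 pairing0l pairing0r c0 d0).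
move=> n; apply: gr_conv_in.
- exact: fil0.
- exact: filD.
- by exists M.
- by exists N.
move=> i; have [_ _ _ mF _] := mP.
by have := mF _ _ _ _ (gc.1 i) (gd.1 (n - i)); rewrite addrC subrK.
Qed.

Lemma gr_conv_subr c d d' n :
  (exists M : nat, forall n, n < - M%:Z -> c n = 0) ->
  (exists M : nat, forall n, n < - M%:Z -> d n = 0) ->
  (exists M : nat, forall n, n < - M%:Z -> d' n = 0) ->
  gr_conv m c d n - gr_conv m c d' n = gr_conv m c (fun i => d i - d' i) n.
Proof.
move=> [M c0] [N1 d1] [N2 d2]; pose N := maxn N1 N2.
have d1' i : i < - N%:Z -> d i = 0 by move=> iN; apply: d1; rewrite /N in iN *; lia.
have d2' i : i < - N%:Z -> d' i = 0 by move=> iN; apply: d2; rewrite /N in iN *; lia.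
have d3 i : i < - N%:Z -> d i - d' i = 0 by move=> iN; rewrite d1'// d2'// subrr.
have [nMN|nMN] := ltP n (- (M + N)%N%:Z).
  by rewrite !(gr_conv_lt0 pairing0l pairing0r c0 _ nMN)// subrr.
have nE : n = (absz (n + (M + N)%N%:Z))%:Z - (M + N)%N%:Z by lia.
rewrite nE (gr_convE pairing0l pairing0r c0 d1') (gr_convE pairing0l pairing0r c0 d2').
rewrite (gr_convE pairing0l pairing0r c0 d3) -sumrB.
by apply: eq_bigr => i _; rewrite pairingBr.
Qed.

Lemma gr_conv_eq c d d' : grhat (fil SC) c -> grhat (fil SD) d ->
  grhat (fil SD) d' -> gr_eq (fil SD) d d' ->
  gr_eq (fil SE) (gr_conv m c d) (gr_conv m c d').
Proof.
move=> gc gd gd' dd' n; have bc := grhat_bound gc.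
have bd := grhat_bound gd; have bd' := grhat_bound gd'.
rewrite gr_conv_subr//; apply: gr_conv_in => //.
- exact: fil0.
- exact: filD.
- have [N1 d1] := bd; have [N2 d2] := bd'; exists (maxn N1 N2) => i iN.
  by rewrite d1 ?d2 ?subrr//; lia.
move=> i; have [_ _ _ mF _] := mP.
have := mF _ _ _ _ (gc.1 i) (dd' (n - i)).
by rewrite (_ : i + (n - i - 1) = n - 1)//; lia.
Qed.

End GradedPairing.

Lemma gr_conv_map (U V W U' V' W' : zmodType) (m : U -> V -> W)
    (m' : U' -> V' -> W') (f : U -> U') (g : V -> V') (p : W -> W') c d :
  (forall y, m 0 y = 0) -> (forall x, m x 0 = 0) ->
  (forall y, m' 0 y = 0) -> (forall x, m' x 0 = 0) ->
  f 0 = 0 -> g 0 = 0 -> p 0 = 0 -> (forall x y, p (x + y) = p x + p y) ->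
  (forall x y, p (m x y) = m' (f x) (g y)) ->
  (exists M : nat, forall n, n < - M%:Z -> c n = 0) ->
  (exists M : nat, forall n, n < - M%:Z -> d n = 0) ->
  p \o gr_conv m c d = gr_conv m' (f \o c) (g \o d).
Proof.
move=> m0l m0r m0l' m0r' f0 g0 p0 pD pm [M c0] [N d0].
have c0' n : n < - M%:Z -> (f \o c) n = 0 by move=> /c0 /= ->.
have d0' n : n < - N%:Z -> (g \o d) n = 0 by move=> /d0 /= ->.
apply/funext => n /=.
have [nMN|nMN] := ltP n (- (M + N)%N%:Z).
  by rewrite (gr_conv_lt0 m0l m0r c0 d0)// (gr_conv_lt0 m0l' m0r' c0' d0').
have -> : n = (absz (n + (M + N)%N%:Z))%:Z - (M + N)%N%:Z by lia.
rewrite (gr_convE m0l m0r c0 d0) (gr_convE m0l' m0r' c0' d0').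
by rewrite (big_morph p pD p0); apply: eq_bigr => i _; rewrite pm.
Qed.

Section CentralAction.
Context (R : realType) (K : tvsComAlgType R) (A G : tvsType R)
  (SA : fdga K A) (SG : fdga K G) (rho : G -> A -> A).
Hypothesis rho_act : fdga_action SG SA rho.
Context (c1 : int -> G) (gamma : int -> A).
Hypothesis gr_c1 : grhat (fil SG) c1.
Hypothesis c1_central : graded_central SA rho c1.
Hypothesis gamma_c1 : acts_as_central SA rho c1 gamma.

Let mulP := fmul_pairing SA.
Let rhoP := rho_act.1.
Let gr_gamma : grhat (fil SA) gamma := gamma_c1.1.1.

Lemma grhat_iter_gamma k u : grhat (fil SA) u ->
  grhat (fil SA) (iter k (gr_conv (fmul SA) gamma) u).
Proof. by move=> gu; elim: k => [//|k IHk] /=; exact: (grhat_conv mulP). Qed.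

(** [h gamma^k u = gamma^k h u], since [gamma] acts as [c1] and the action of [c1]
   commutes with left multiplications. *)
Let conv_iter_gamma h k u : grhat (fil SA) h -> grhat (fil SA) u ->
  gr_eq (fil SA) (gr_conv (fmul SA) h (iter k (gr_conv (fmul SA) gamma) u))
    (iter k (gr_conv (fmul SA) gamma) (gr_conv (fmul SA) h u)).
Proof.
move=> gh gu; elim: k => [|k IHk] /=; first exact: gr_eq_refl.
set v := iter k _ u in IHk *; have gv : grhat (fil SA) v by exact: grhat_iter_gamma.
have ghv : grhat (fil SA) (gr_conv (fmul SA) h v) by exact: (grhat_conv mulP).
have ghu : grhat (fil SA) (gr_conv (fmul SA) h u) by exact: (grhat_conv mulP).
have h1 : gr_eq (fil SA) (gr_conv (fmul SA) h (gr_conv (fmul SA) gamma v))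
    (gr_conv (fmul SA) h (gr_conv rho c1 v)).
  apply: (gr_conv_eq mulP) => //; first exact: (grhat_conv mulP).
    exact: (grhat_conv rhoP).
  by apply: gr_eq_sym; apply: gamma_c1.2.
apply: gr_eq_trans h1 _.
apply: gr_eq_trans (gr_eq_sym (c1_central gh gv).1) _.
apply: gr_eq_trans (gamma_c1.2 _ ghv) _.
by apply: (gr_conv_eq mulP) => //; exact: grhat_iter_gamma.
Qed.

Context (hh : R -> int -> A).
Hypothesis gr_hh : forall tau, 0 < tau -> grhat (fil SA) (hh tau).

(** Laurent coefficients of [H_t0 (g_1 . (H_t1 (g_1 . ... H_tn)))] *)
Fixpoint word_coef (t0 : R) (ts : seq R) : int -> A :=
  if ts is t1 :: ts' then
    gr_conv (fmul SA) (hh t0) (gr_conv rho c1 (word_coef t1 ts'))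
  else hh t0.

(** Laurent coefficients of [H_t0 H_t1 ... H_tn] *)
Fixpoint prod_coef (t0 : R) (ts : seq R) : int -> A :=
  if ts is t1 :: ts' then gr_conv (fmul SA) (hh t0) (prod_coef t1 ts')
  else hh t0.

Lemma grhat_word_coef t0 ts : 0 < t0 -> all (fun t => 0 < t) ts ->
  grhat (fil SA) (word_coef t0 ts).
Proof.
elim: ts t0 => [|t1 ts IHts] t0 t00 /=; first by move=> _; exact: gr_hh.
move=> /andP[t10 /(IHts _ t10) gt].
by apply: (grhat_conv mulP); [exact: gr_hh|exact: (grhat_conv rhoP)].
Qed.

Lemma grhat_prod_coef t0 ts : 0 < t0 -> all (fun t => 0 < t) ts ->
  grhat (fil SA) (prod_coef t0 ts).
Proof.
elim: ts t0 => [|t1 ts IHts] t0 t00 /=; first by move=> _; exact: gr_hh.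
by move=> /andP[t10 /(IHts _ t10) gt]; apply: (grhat_conv mulP) => //; exact: gr_hh.
Qed.

(** Graded centrality moves each action of [g_1], which is a multiplication by
   [gamma] in the associated graded algebra, to the front of the word. *)
Lemma word_coef_gamma t0 ts : 0 < t0 -> all (fun t => 0 < t) ts ->
  gr_eq (fil SA) (word_coef t0 ts)
    (iter (size ts) (gr_conv (fmul SA) gamma) (prod_coef t0 ts)).
Proof.
elim: ts t0 => [|t1 ts IHts] t0 t00 /=; first by move=> _; exact: gr_eq_refl.
move=> /andP[t10 ts0]; have gh := gr_hh t00.
have gt := grhat_word_coef t10 ts0; have gp := grhat_prod_coef t10 ts0.
have gi := grhat_iter_gamma (size ts) gp.
have ght : grhat (fil SA) (gr_conv (fmul SA) (hh t0) (word_coef t1 ts)).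
  exact: (grhat_conv mulP).
apply: gr_eq_trans (gr_eq_sym (c1_central gh gt).1) _.
apply: gr_eq_trans (gamma_c1.2 _ ght) _.
apply: (gr_conv_eq mulP) => //.
  by apply: grhat_iter_gamma; exact: (grhat_conv mulP).
apply: gr_eq_trans (conv_iter_gamma _ gh gp).
by apply: (gr_conv_eq mulP) => //; exact: IHts.
Qed.

End CentralAction.

(** * Symbols as Laurent series *)

Section HasLaurent.
Context (R : realType) (B : completeNormedModType R).

(** All large bounds [M] on the order of the pole are admitted, so that any two
   expansions have a bound in common. *)
Definition has_laurent (a : R -> B) (c : int -> B) := exists M0 : nat,
  exists2 delta : R, 0 < delta & forall M, (M0 <= M)%N -> laurent a c M delta.

Lemma has_laurent_common a b c d : has_laurent a c -> has_laurent b d ->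
  exists M : nat, exists2 delta : R, 0 < delta &
    laurent a c M delta /\ laurent b d M delta.
Proof.
move=> [M [d1 d10 h1]] [N [d2 d20 h2]].
exists (maxn M N); exists (Num.min d1 d2); first by rewrite lt_min d10.
split; [apply: laurentW (h1 _ (leq_maxl _ _))|apply: laurentW (h2 _ (leq_maxr _ _))].
  by rewrite ge_min lexx.
by rewrite ge_min lexx orbT.
Qed.

Lemma has_laurent_uniq a c d : has_laurent a c -> has_laurent a d -> c = d.
Proof.
move=> hc hd; have [M [delta delta0 [h1 h2]]] := has_laurent_common hc hd.
exact: laurent_uniq h1 h2.
Qed.

Lemma eq_has_laurent a b c : (forall t, 0 < t -> a t = b t) ->
  has_laurent a c -> has_laurent b c.
Proof.
move=> ab [M [delta delta0 h]]; exists M; exists delta => // N MN.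
have [c0 hc] := h N MN; split=> // t td; have [h1 h2] := hc t td; split=> //.
by rewrite -ab//; case/andP: td.
Qed.

Lemma has_laurent_cst z : has_laurent (fun=> z) (fun n => if n == 0 then z else 0).
Proof.
exists 0%N; exists 1 => // M _; split=> [n nM|t _].
  by case: eqP nM => // -> ; lia.
have z0 k : (k < M)%N -> (if k%:Z - M%:Z == 0 then z else 0) = 0.
  by move=> kM; case: eqP => //; lia.
have single (V : normedModType R) (f : nat -> V) : (forall k, k != M -> f k = 0) ->
    series f @ \oo --> f M.
  move=> f0; apply: cvg_near_cst; near=> n.
  have mn : (M < n)%N by near: n; exact: nbhs_infty_gt.
  by rewrite /series /= (bigD1_seq M) ?iota_uniq ?mem_index_iota//= big1 ?addr0.
have kM0 k : k != M -> (if k%:Z - M%:Z == 0 then z else 0) = 0.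
  by move=> kM; case: eqP => // h; move/eqP: kM; lia.
split.
  apply/cvg_ex; eexists; apply: (@single R^o) => k /kM0 ->.
  by rewrite normr0 mulr0.
have := single B (fun k => t ^+ k *: (if k%:Z - M%:Z == 0 then z else 0)).
rewrite subrr eqxx; apply => k /kM0 ->; exact: scaler0.
Unshelve. all: by end_near. Qed.

Lemma has_laurent_symbol (C : tvsType R) (F : int -> set C) (f : C -> B) a c :
  (forall x y, f (x + y) = f x + f y) -> (forall (r : R) x, f (r *: x) = r *: f x) ->
  continuous f -> symbol F a c -> has_laurent (f \o a) (f \o c).
Proof.
move=> fD fZ fc [_ [N [eps eps0 [c0 hc]]]]; apply: symbol_laurent; split=> //.
have f0 : f 0 = 0 by have := fZ 0 0; rewrite !scale0r.
exists N; exists eps => //; split=> [n nN|t te] /=; first by rewrite c0.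
have -> : (fun m => \sum_(k < m) t ^ (N + k%:Z) *: f (c (N + k%:Z))) =
    f \o (fun m => \sum_(k < m) t ^ (N + k%:Z) *: c (N + k%:Z)).
  apply/funext => n /=; rewrite (big_morph f fD f0).
  by apply: eq_bigr => k _; rewrite fZ.
by apply: continuous_cvg; [exact: fc|exact: hc].
Qed.

Context (mul : B -> B -> B) (e : B) (bB : banach_algebra mul e).

Lemma has_laurent_mul a b c d : has_laurent a c -> has_laurent b d ->
  has_laurent (fun t => mul (a t) (b t)) (gr_conv mul c d).
Proof.
move=> [M [d1 d10 h1]] [N [d2 d20 h2]]; exists (M + N)%N.
exists (Num.min d1 d2); first by rewrite lt_min d10.
move=> k kMN; have kM : (k = (k - N) + N)%N by lia.
rewrite kM; apply: (laurent_mul bB _ _).1.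
  by apply: laurentW (h1 _ _); [rewrite ge_min lexx|lia].
by apply: laurentW (h2 _ _); [rewrite ge_min lexx orbT|].
Qed.

End HasLaurent.

(** * Linear forms on Dyson series *)

Section DysonForms.
Context (R : realType) (K : tvsComAlgType R) (B : completeNormedModType R)
  (SB : fdga K B) (e : B).
Hypothesis uB : unital_banach_algebra SB e.
Let bB := fdga_banach_algebra uB.
Context (l : {linear B -> R^o}).
Hypothesis l_cont : continuous l.

Lemma linear_form_bounded : exists L : R, forall x, `|l x| <= L * `|x|.
Proof.
have /linear_boundedP [L [_ HL]] := @continuous_linear_bounded _ _ _ 0 l (@l_cont 0).
by exists (L + 1); apply: HL; rewrite ltrDl.
Qed.

Let l_lin (a : R) x y : l (a *: x + y) = a * l x + l y.
Proof. by rewrite linearP. Qed.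

Lemma cvg_series_linear_form (f : nat -> B) s : series f @ \oo --> s ->
  series (fun k => l (f k)) @ \oo --> l s.
Proof.
have [L Ll] := linear_form_bounded; exact: (cvg_series_form l_lin Ll).
Qed.

Lemma generates_form X E : generates SB e X E ->
  series (fun j => l (bpow (fmul SB) e X j) / j`!%:R) @ \oo --> l (E 1).
Proof.
move=> [E0 ED Ec Ed]; rewrite (semigroup_bexp bB E0 ED Ec Ed ler01).
have := cvg_series_linear_form (@cvg_bexp _ _ _ _ bB X 1 ler01).
rewrite (_ : (fun k => l _) = (fun j => l (bpow (fmul SB) e X j) / j`!%:R))//.
by apply/funext => j; rewrite linearZ /dpow expr1n mul1r mulrC.
Qed.

Lemma dyson_word_form X Y E t0 ts : generates SB e X E ->
  0 <= t0 -> all (fun t => 0 <= t) ts ->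
  series (fun j => \sum_(w <- words j) mono (exps w) (t0 :: ts) * l (wprod (fmul SB) e X Y w))
    @ \oo --> l (dyson_word SB E Y t0 ts).
Proof.
move=> [E0 ED Ec Ed] t00 ts0.
have EX u : 0 <= u -> E u = bexp (fmul SB) e X u by exact: (@semigroup_bexp _ _ _ _ bB X E E0
    ED Ec Ed).
have := cvg_series_linear_form (@cvg_series_dyson_word _ _ _ _ _ uB X Y E EX t0 ts t00 ts0).
rewrite (_ : (fun j => l _) = fun j => \sum_(w <- words j) mono (exps w) (t0 :: ts) * l (wprod
    (fmul SB) e X Y w))//.
apply/funext => j; rewrite linear_sum; apply: eq_bigr => w _.
by rewrite linearZ.
Qed.

(** The integrals of the Dyson series are weak, so the series is expanded into
   words against one linear form at a time. Words of length j receive the weight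
   [1 / j!] that they have in [e^(X + Y)]. *)
Lemma dyson_sum_form X Y E S : generates SB e X E -> is_dyson_sum SB E Y S ->
  series (fun j => (\sum_(w <- words j) l (wprod (fmul SB) e X Y w)) / j`!%:R) @ \oo --> l S.
Proof.
move=> EX [v v_int vS].
have [L Ll] := linear_form_bounded.
pose rho := Num.max `|X| `|Y|.
have rho0 : 0 <= rho by rewrite le_max normr_ge0.
have wle w : `|l (wprod (fmul SB) e X Y w)| <= `|L| * `|e| * rho ^+ size w.
  apply: le_trans (Ll _) _; apply: (@le_trans _ _ (`|L| * `|wprod (fmul SB) e X Y w|)).
    by rewrite ler_wpM2r// ler_norm.
  rewrite -mulrA ler_wpM2l//; apply: (norm_wprod_le bB); by rewrite le_max lexx ?orbT.
have [|s s1 s2] := @sum_simplex_int _ _ _ _ rho0 wle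
  (fun n t0 ts => l (dyson_word SB E Y t0 ts)).
- move=> n t0 ts [t00 ts0 _ _]; apply: (dyson_word_form EX); first exact: ltW.
  by apply: sub_all ts0 => t /ltW.
suff vs : series (fun n => l (v n)) @ \oo --> s.
  by rewrite (cvg_unique (@norm_hausdorff _ _) (cvg_series_linear_form vS) vs).
rewrite (_ : (fun n => l (v n)) = fun n => simplex_int n 1 (fun t0 ts => l (dyson_word SB E Y
    t0 ts)))//.
by apply/funext => n; rewrite v_int.
Qed.

End DysonForms.

Section LinearForms.
Context (R : realType) (K : tvsComAlgType R).

Lemma filtered_morphism_scale (C D : tvsType R) (SC : filtered_complex K C)
    (SD : filtered_complex K D) f (r : R) x :
  filtered_morphism SC SD f -> f (r *: x) = r *: f x.
Proof. by case=> _ fZ _ _ _; rewrite -(kact_real SC) fZ kact_real. Qed.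

Lemma fdga_morphism_symbol (C : tvsType R) (B : completeNormedModType R)
    (SC : fdga K C) (SB : fdga K B) f F a c :
  fdga_morphism SC SB f -> symbol F a c -> has_laurent (f \o a) (f \o c).
Proof.
move=> [fm _ f_cont]; apply: has_laurent_symbol => //; first by case: fm.
by move=> r x; exact: filtered_morphism_scale fm.
Qed.

Lemma linear_form_pack (B : tvsType R) (f : B -> R) :
  (forall (a : R) x y, f (a *: x + y) = a * f x + f y) -> continuous f ->
  exists2 l : {linear B -> R^o}, continuous l & forall x, l x = f x.
Proof.
move=> f_lin fc; pose g : B -> R^o := f.
have g_lin : linear g by move=> a x y; exact: f_lin.
pose l : {linear B -> R^o} := HB.pack g (GRing.isLinear.Build _ _ _ _ _ g_lin).
by exists l.
Qed.

Section TraceOnBanach.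
Context (B : completeNormedModType R) (SB : fdga K B) (e : B).
Hypothesis uB : unital_banach_algebra SB e.
Let bB := fdga_banach_algebra uB.

Lemma generates_near1 X E : generates SB e X E -> exists2 u, 0 < u & `|e - E u| < 1.
Proof.
move=> [E0 _ Ec _].
have /continuous_within_itvcyP [_ /cvgrPdist_lt/(_ 1 ltr01)] := Ec.
rewrite E0 => h; have pr : \forall u \near (0 : R)^'+, 0 < u by exact: nbhs_right_gt.
by have [u [u0 hu]] := filter_ex (filterI pr h); exists u.
Qed.

(** Elements near [e] have a left inverse, and an ideal that contains [e] is
   everything. So the trace of B is defined on all of B. *)
Lemma trdom_full P (SP : filtered_complex K P) (TB : fdga_trace SB SP) x :
  trdom TB x -> `|e - x| < 1 -> forall z, trdom TB z.
Proof.
move=> Tx /(left_inverse_near1 bB)[y yx] z.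
rewrite -(bmul1r bB z) -yx; do 2! apply: trdom_mull; exact: Tx.
Qed.

End TraceOnBanach.
End LinearForms.

(** * The trace of the exponential *)

Section TraceOfExponential.
Context (R : realType) (K : tvsComAlgType R)
  (A G : tvsType R) (B : completeNormedModType R)
  (SA : fdga K A) (SG : fdga K G) (SB : fdga K B) (oneB : B).
Hypothesis banachB : unital_banach_algebra SB oneB.
Context (TA : fdga_trace SA (ground_I K)) (TB : fdga_trace SB (ground_c K))
  (phi : A -> B) (rho : G -> A -> A) (i : G -> B).
Hypothesis phi_tr : trace_morphism TA TB phi (fun x : K => x).
Hypothesis rho_act : fdga_action SG SA rho.
Hypothesis i_mor : fdga_morphism SG SB i.
Hypothesis phi_rho : forall g a, phi (rho g a) = fmul SB (i g) (phi a).
Context (g0 g1 : R -> G) (E0 : R -> R -> B) (H : R -> R -> A).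
Hypothesis E0_exp : rees_generates SB oneB (fun t => i (g0 t)) E0.
Hypothesis H_phi : forall tau, 0 < tau -> forall t, 0 < t ->
  phi (H tau t) = E0 tau t.
Context (c0 c1 : int -> G) (gamma : int -> A) (hh : R -> int -> A).
Hypothesis c1_symbol : symbol (fil SG) g1 c1.
Hypothesis c1_central : graded_central SA rho c1.
Hypothesis gamma_c1 : acts_as_central SA rho c1 gamma.
Hypothesis hh_symbol : forall tau, 0 < tau -> symbol (trfil TA) (H tau) (hh tau).
Context (l : {linear B -> R^o}).
Hypothesis l_cont : continuous l.
Context (lam : K -> R).
Hypothesis lam_lin : forall (a : R) x y, lam (a *: x + y) = a * lam x + lam y.
Hypothesis lam_cont : continuous lam.
Hypothesis l_lam : forall x, l x = lam (trf TB x).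

Let bB := fdga_banach_algebra banachB.
Let mul := fmul SB.
Let mulP := fmul_pairing SA.
Let cX := i \o c0.
Let cY := i \o c1.

Let phiD x y : phi (x + y) = phi x + phi y.
Proof. by have [[[]]] := phi_tr. Qed.

Let phiZ (r : R) x : phi (r *: x) = r *: phi x.
Proof. by have [[fm _ _] _ _ _] := phi_tr; exact: filtered_morphism_scale fm. Qed.

Let phi0 : phi 0 = 0.
Proof. by have := phiZ 0 0; rewrite !scale0r. Qed.

Let phiN x : phi (- x) = - phi x.
Proof. by rewrite -scaleN1r phiZ scaleN1r. Qed.

Let phiM x y : phi (fmul SA x y) = mul (phi x) (phi y).
Proof. by have [[]] := phi_tr. Qed.

Let i0 : i 0 = 0.
Proof. by have [fm _ _] := i_mor; have := filtered_morphism_scale 0 0 fm; rewrite !scale0r. Qed.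

Let Y_laurent : has_laurent (i \o g1) cY.
Proof. exact: fdga_morphism_symbol i_mor c1_symbol. Qed.

Let gr_c1 : grhat (fil SG) c1.
Proof. by have [? [N [eps _ []]]] := c1_symbol; split=> //; exists N. Qed.

Let gr_hh tau : 0 < tau -> grhat (fil SA) (hh tau).
Proof.
move=> tau0; have [hT [N [eps _ []]]] := hh_symbol tau0.
by split; [move=> n; have [] := hT n|exists N].
Qed.

Let hh_tr tau n : 0 < tau -> trdom TA (hh tau n).
Proof. by move=> tau0; have [hT _] := hh_symbol tau0; have [] := hT n. Qed.

Let hh_laurent tau : 0 < tau -> has_laurent (E0 tau) (phi \o hh tau).
Proof.
move=> tau0; apply: (@eq_has_laurent _ _ (phi \o H tau)).
  by move=> t t0 /=; rewrite H_phi.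
have [pm _ _ _] := phi_tr; exact: fdga_morphism_symbol pm (hh_symbol tau0).
Qed.

Let phi_conv_mul c d : grhat (fil SA) c -> grhat (fil SA) d ->
  phi \o gr_conv (fmul SA) c d = gr_conv mul (phi \o c) (phi \o d).
Proof.
move=> gc gd; apply: gr_conv_map => //.
- exact: (pairing0l mulP).
- exact: (pairing0r mulP).
- exact: (bmul0l bB).
- exact: (bmul0r bB).
- exact: grhat_bound gc.
- exact: grhat_bound gd.
Qed.

Let phi_conv_rho d : grhat (fil SA) d ->
  phi \o gr_conv rho c1 d = gr_conv mul cY (phi \o d).
Proof.
move=> gd; apply: gr_conv_map => //.
- exact: (pairing0l rho_act.1).
- exact: (pairing0r rho_act.1).
- exact: (bmul0l bB).
- exact: (bmul0r bB).
- exact: grhat_bound gr_c1.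
- exact: grhat_bound gd.
Qed.

Let wcoef := word_coef SA rho c1 hh.
Let pcoef := prod_coef SA hh.

(** [phi] sends [H_tau] to [e^(tau F_0)] and turns the action of [g_1] into
   multiplication by [F_1]. *)
Lemma dyson_word_laurent t0 ts : 0 < t0 -> all (fun t => 0 < t) ts ->
  has_laurent (fun t => dyson_word SB (fun u => E0 u t) (i (g1 t)) t0 ts)
    (phi \o wcoef t0 ts).
Proof.
elim: ts t0 => [|t1 ts IHts] t0 t00 /=; first by move=> _; exact: hh_laurent.
move=> /andP[t10 ts0]; have gt := grhat_word_coef rho_act gr_c1 gr_hh t10 ts0.
rewrite /wcoef /= phi_conv_mul//; [|exact: gr_hh|exact: (grhat_conv rho_act.1)].
rewrite phi_conv_rho//; apply: (has_laurent_mul bB); first exact: hh_laurent.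
by apply: (has_laurent_mul bB) => //; exact: IHts.
Qed.

(** Both are the Laurent coefficients of [e^(F_0)], by the semigroup law. *)
Lemma phi_prod_coef t0 ts : open_simplex (size ts) 1 t0 ts ->
  phi \o pcoef t0 ts = phi \o hh 1.
Proof.
move=> [t00 ts0 _ sum1]; apply: has_laurent_uniq (hh_laurent ltr01).
rewrite -sum1 {sum1}; elim: ts t0 t00 ts0 => [|t1 ts IHts] t0 t00 /=.
  by move=> _; rewrite big_nil addr0; exact: hh_laurent.
move=> /andP[t10 ts0]; have gp := grhat_prod_coef gr_hh t10 ts0.
rewrite /pcoef /= phi_conv_mul//; last exact: gr_hh.
rewrite big_cons; set s := t1 + _; have s0 : 0 <= s.
  by apply: addr_ge0; [exact: ltW|rewrite big_seq; apply: sumr_ge0 => t /(allP ts0)/ltW].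
apply: (@eq_has_laurent _ _ (fun t => mul (E0 t0 t) (E0 s t))).
  by move=> t tpos; have [_ ED _ _] := E0_exp.2 t tpos; rewrite /mul -ED // ltW.
by apply: (has_laurent_mul bB); [exact: hh_laurent|exact: IHts].
Qed.

Lemma phi_iter_gamma n u v : grhat (fil SA) u -> grhat (fil SA) v ->
  phi \o u = phi \o v ->
  phi \o iter n (gr_conv (fmul SA) gamma) u = phi \o iter n (gr_conv (fmul SA) gamma) v.
Proof.
move=> gu gv uv; elim: n => [//|n IHn] /=.
rewrite !phi_conv_mul ?IHn//; try exact: gamma_c1.1.1.
- exact: (grhat_iter_gamma gamma_c1).
- exact: (grhat_iter_gamma gamma_c1).
Qed.

Let lam0 : lam 0 = 0.
Proof. by have := lam_lin (-1) 0 0; rewrite scaler0 addr0; lra. Qed.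

Let l_phi x : trdom TA x -> l (phi x) = lam (trf TA x).
Proof. by move=> Tx; have [_ _ _ pT] := phi_tr; rewrite l_lam -pT. Qed.

(** The target [K_I] of the trace of A has no elements of negative filtration. *)
Let l_phi_fil x : trfil TA (-1) x -> l (phi x) = 0.
Proof.
move=> [Tx Fx]; rewrite l_phi//.
by have [//|->] := trf_fil Tx Fx.
Qed.

Let trdom_conv c d n : grhat (fil SA) c -> grhat (fil SA) d ->
  (forall i, trdom TA (c i)) \/ (forall i, trdom TA (d i)) ->
  trdom TA (gr_conv (fmul SA) c d n).
Proof.
move=> gc gd Tcd; apply: (gr_conv_in mulP).
- exact: trdom0.
- exact: trdomD.
- exact: grhat_bound gc.
- exact: grhat_bound gd.
- by move=> j; case: Tcd => h; [exact: trdom_mulr|exact: trdom_mull].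
Qed.

Let trdom_wcoef t0 ts n : 0 < t0 -> all (fun t => 0 < t) ts ->
  trdom TA (wcoef t0 ts n).
Proof.
case: ts => [|t1 ts] t00; first by move=> _; exact: hh_tr.
move=> /= /andP[t10 ts0]; apply: trdom_conv; first exact: gr_hh.
  apply: (grhat_conv rho_act.1) => //.
  exact: (grhat_word_coef rho_act gr_c1 gr_hh t10 ts0).
by left => j; exact: hh_tr.
Qed.

Let trdom_pcoef t0 ts n : 0 < t0 -> all (fun t => 0 < t) ts ->
  trdom TA (pcoef t0 ts n).
Proof.
case: ts => [|t1 ts] t00; first by move=> _; exact: hh_tr.
move=> /= /andP[t10 ts0]; apply: trdom_conv; first exact: gr_hh.
  exact: (grhat_prod_coef gr_hh t10 ts0).
by left => j; exact: hh_tr.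
Qed.

Let trdom_iter_gamma k u n : grhat (fil SA) u -> (forall n, trdom TA (u n)) ->
  trdom TA (iter k (gr_conv (fmul SA) gamma) u n).
Proof.
move=> gu Tu; elim: k n => [//|k IHk] n /=.
apply: trdom_conv; [exact: gamma_c1.1.1| |by right].
exact: (grhat_iter_gamma gamma_c1).
Qed.

(** The trace of [gamma^n h], seen through [lam]; see [l_phi]. *)
Let kappa n := l (phi (iter n (gr_conv (fmul SA) gamma) (hh 1) 0)).

(** The coefficients of the word and of [gamma^n h] agree up to [F^(-1) A_tr],
   which the trace does not see. The value is the same for all times in the
   simplex. *)
Lemma form_word_coef t0 ts : open_simplex (size ts) 1 t0 ts ->
  l (phi (wcoef t0 ts 0)) = kappa (size ts).
Proof.
move=> simp; have [t00 ts0 _ _] := simp.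
have gp := grhat_prod_coef gr_hh t00 ts0; have gh := gr_hh ltr01.
have := congr1 (fun f => f 0) (phi_iter_gamma (size ts) gp gh (phi_prod_coef simp)).
rewrite /= /kappa => <-; apply/eqP; rewrite -subr_eq0 -linearB -phiN -phiD.
apply/eqP; apply: l_phi_fil; split; last first.
  have := word_coef_gamma rho_act gr_c1 c1_central gamma_c1 gr_hh t00 ts0.
  by move=> /(_ 0); rewrite sub0r.
rewrite -(filtered_kactN1 SA); apply: trdomD; first exact: trdom_wcoef.
apply: trdomZ; apply: trdom_iter_gamma => // n; exact: trdom_pcoef.
Qed.

Context (S : R -> B).
Hypothesis S_sum : forall t, 0 < t ->
  is_dyson_sum SB (fun u => E0 u t) (i (g1 t)) (S t).
Hypothesis S_tr : constant_trace TB S.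

(** This is where the constancy of the trace enters. *)
Let lS t : 0 < t -> l (S t) = l (S 1).
Proof. by move=> t0; rewrite !l_lam (S_tr t0 ltr01). Qed.

Let sum_words_S t : 0 < t ->
  series (fun j => (\sum_(w <- words j) l (wprod mul oneB (i (g0 t)) (i (g1 t)) w)) / j`!%:R)
    @ \oo --> l (S 1).
Proof.
move=> t0; rewrite -(lS t0).
exact: (dyson_sum_form banachB l_cont (E0_exp.2 t t0) (S_sum t0)).
Qed.

(** At [t = 1], the expansion of [S] into words is the exponential series of
   [f_0 + f_1]. *)
Lemma form_exp_dyson E : generates SB oneB (i (g0 1) + i (g1 1)) E ->
  l (E 1) = l (S 1).
Proof.
move=> /(generates_form banachB l_cont) h.
have := sum_words_S ltr01.
rewrite (_ : (fun j => _ / _) = fun j => l (bpow mul oneB (i (g0 1) + i (g1 1)) j) / j`!%:R).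
  by move=> h'; rewrite (cvg_unique (@norm_hausdorff _ _) h h').
by apply/funext => j; rewrite (bpow_addE bB) linear_sum.
Qed.

Let l_lin (a : R) x y : l (a *: x + y) = a * l x + l y.
Proof. by rewrite linearP. Qed.

Context (M : nat) (delta : R).
Hypothesis delta0 : 0 < delta.
Hypothesis lX : laurent (i \o g0) cX M delta.
Hypothesis lY : laurent (i \o g1) cY M delta.

Let cw w := cword mul oneB cX cY w 0.

Let common_laurent (b : R -> B) (cb : int -> B) : has_laurent b cb -> exists N : nat, exists2 d
    : R, 0 < d &
  [/\ laurent (i \o g0) cX M d, laurent (i \o g1) cY M d & laurent b cb N d].
Proof.
move=> [N [d d0 /(_ N (leqnn _)) lb]]; exists N, (Num.min delta d).
  by rewrite lt_min delta0.
by split; [apply: laurentW lX|apply: laurentW lY|apply: laurentW lb];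
  rewrite ge_min lexx ?orbT.
Qed.

(** The coefficient of [t^0] in the expansion of [l (S t)] into words, this
   function being constant. *)
Lemma sum_cword_S :
  series (fun j => (\sum_(w <- words j) l (cw w)) / j`!%:R) @ \oo --> l (S 1).
Proof.
have [L Ll] := linear_form_bounded l_cont.
have [N [d d0 [lX' lY' lb]]] := common_laurent (has_laurent_cst (S 1)).
have mulE (a : seq bool -> R) : (fun j => (\sum_(w <- words j) a w) / j`!%:R) =
    fun j => \sum_(w <- words j) (size w)`!%:R^-1 * a w.
  apply/funext => j; rewrite mulr_suml big_seq [RHS]big_seq.
  by apply: eq_bigr => w /size_words ->; rewrite mulrC.
rewrite mulE.
have := laurent_word_coef bB d0 lX' lY' l_lin Ll _ (@words_fact_summable R) lb.
rewrite eqxx; apply => [w|t /andP[t0 _]]; first by rewrite invr_ge0.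
rewrite -(mulE (fun w => l (wprod mul oneB (i (g0 t)) (i (g1 t)) w))).
exact: sum_words_S.
Qed.

(** The coefficient of [t^0] in the integrand of the Dyson series. *)
Lemma sum_cword_simplex n t0 ts : open_simplex n 1 t0 ts ->
  series (fun j => \sum_(w <- words j) mono (exps w) (t0 :: ts) * l (cw w)) @ \oo
    --> kappa n.
Proof.
move=> simp; have [t00 ts0 ts_n _] := simp.
rewrite -ts_n in simp *; rewrite -(form_word_coef simp).
have [L Ll] := linear_form_bounded l_cont.
have [N [d d0 [lX' lY' lb]]] := common_laurent (dyson_word_laurent t00 ts0).
have ts0' : all (fun t => 0 <= t) ts by apply: sub_all ts0 => t /ltW.
apply: (laurent_word_coef bB d0 lX' lY' l_lin Ll _ _ lb) => [w|r r0|t /andP[t0' _]].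
- by rewrite mono_ge0//= ltW.
- by apply: is_cvg_series_words_mono => //; exact: ltW.
- by apply: (dyson_word_form banachB l_cont (E0_exp.2 t t0')) => //; exact: ltW.
Qed.

(** A Laurent coefficient is bounded by the norm of its series at one point, here
   [delta / 2], and this norm is submultiplicative. *)
Lemma form_cword_le : exists C r : R, 0 <= r /\ forall w, `|l (cw w)| <= C * r ^+ size w.
Proof.
have [L Ll] := linear_form_bounded l_cont.
pose t := delta / 2; have td : 0 < t < delta by rewrite /t; have := delta0; move=> ?;
    apply/andP; split; lra.
have t0 : 0 < t by case/andP: td.
pose q := Num.max (lnorm cX M t) (lnorm cY M t).
exists (`|L| * `|oneB|), (t ^- M * q); split=> [|w].
  rewrite mulr_ge0 ?invr_ge0 ?exprn_ge0 ?(ltW t0)// le_max; apply/orP; left.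
  have [cv _] := lX.2 t td; apply: le_trans (series_le_lim 0 _ cv).
    by rewrite /series /= big_geq.
  by move=> k; rewrite mulr_ge0// exprn_ge0// ltW.
apply: le_trans (Ll _) _; apply: (@le_trans _ _ (`|L| * `|cw w|)).
  by rewrite ler_wpM2r// ler_norm.
rewrite -mulrA ler_wpM2l//; have [[_ hw] hn] := laurent_word bB lX lY w.
have [cv _] := hw t td; have le_q := hn t td.
have := series_le_lim (size w * M).+1 _ cv; rewrite -/(lnorm _ _ _) => h.
have tn0 n : 0 < t ^+ n by rewrite exprn_gt0.
rewrite exprMn exprVn -exprM mulrCA mulrC ler_pdivlMr// mulrC mulnC.
apply: le_trans le_q; apply: le_trans (h _); last first.
  by move=> k; rewrite mulr_ge0// ltW.
rewrite seriesSr subrr lerDr /series /= sumr_ge0// => k _.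
by rewrite mulr_ge0// ltW.
Qed.

(** Integration of the constant [kappa n] over the simplex gives [1 / n!]. *)
Lemma sum_kappa : series (fun n => kappa n / n`!%:R) @ \oo --> l (S 1).
Proof.
have [C [r [r0 cw_le]]] := form_cword_le.
have [s s1 s2] := sum_simplex_int r0 cw_le sum_cword_simplex.
rewrite (cvg_unique (@norm_hausdorff _ _) sum_cword_S s1).
rewrite (_ : (fun n => _ / _) = fun n => simplex_int n 1 (fun _ _ => kappa n))//.
by apply/funext => n; rewrite simplex_int_cst// /dpow expr1n div1r.
Qed.

(** Convergence in the associated graded module is convergence up to
   [F^(-1) A_tr], on which the trace vanishes. *)
Lemma sum_kappa_exp_times y : is_exp_times TA gamma (hh 1) y ->
  series (fun n => kappa n / n`!%:R) @ \oo --> lam (gr_tr TA y).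
Proof.
move=> [[Fy _] uy]; have [Ty _] := Fy 0.
have gh := gr_hh ltr01.
pose u m := \sum_(k < m) (k`!%:R^-1 : R) *: iter k (gr_conv (fmul SA) gamma) (hh 1) 0.
have Tu m : trdom TA (u m).
  apply: (@big_ind _ (trdom TA)); [exact: trdom0|exact: trdomD|move=> k _].
  rewrite -(kact_real SA); apply: trdomZ; apply: trdom_iter_gamma => // n.
  exact: hh_tr.
have uE m : series (fun n => kappa n / n`!%:R) m = lam (trf TA (u m)).
  rewrite -l_phi// /u (big_morph phi phiD phi0) linear_sum /series /= big_mkord.
  by apply: eq_bigr => k _; rewrite phiZ linearZ mulrC.
have h1 : lam (trf TA x) @[x --> within (trdom TA) (nbhs (y 0))] --> lam (gr_tr TA y).
  have /subspace_continuousP/(_ _ Ty) := @trf_cont _ _ _ _ _ _ TA.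
  by move=> h1; apply: continuous_cvg h1; exact: lam_cont.
move=> V /h1 hV; have := uy 0 _ hV; apply: filterS => m [z [Tz Fz]] /=.
rewrite uE trfD//; last exact: Tu.
have -> : trf TA z = 0 by have [|] := trf_fil Tz Fz.
by rewrite addr0 => hu; apply: hu; apply: trdomD => //; exact: Tu.
Qed.

End TraceOfExponential.

Theorem corollary3p11 (R : realType) (K : tvsComAlgType R)
    (A G : tvsType R) (B : completeNormedModType R)
    (SA : fdga K A) (SG : fdga K G) (SB : fdga K B)
    (hausK : hausdorff_space K) (hausA : hausdorff_space A)
    (hausG : hausdorff_space G)
    (oneB : B) (banachB : unital_banach_algebra SB oneB)
    (constB : constant_filtration SB)
    (TA : fdga_trace SA (ground_I K)) (TB : fdga_trace SB (ground_c K))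
    (phi : A -> B) (phi_tr : trace_morphism TA TB phi (fun x : K => x))
    (rho : G -> A -> A) (rho_act : fdga_action SG SA rho)
    (i : G -> B) (i_mor : fdga_morphism SG SB i)
    (phi_rho : forall g a, phi (rho g a) = fmul SB (i g) (phi a))
    (* the elements g_0, g_1, with F_j = i(g_j) *)
    (g0 g1 : R -> G) (g0_rees : Rees SG g0) (g1_rees : Rees SG g1)
    (* e^(u F_0) *)
    (E0 : R -> R -> B) (E0_exp : rees_generates SB oneB (fun t => i (g0 t)) E0)
    (H : R -> R -> A)
    (H_rees : forall tau, 0 < tau -> Rees_of_trdom TA (H tau))
    (H_mul : forall sigma tau, 0 < sigma -> 0 < tau -> forall t, 0 < t ->
       H (sigma + tau) t = fmul SA (H sigma t) (H tau t))
    (H_phi : forall tau, 0 < tau -> forall t, 0 < t ->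
       phi (H tau t) = E0 tau t)
    (* g_1|_0, and gamma = z_{g_1} *)
    (c1 : int -> G) (c1_symbol : symbol (fil SG) g1 c1)
    (c1_central : graded_central SA rho c1)
    (gamma : int -> A) (gamma_c1 : acts_as_central SA rho c1 gamma)
    (* h = H_1|_0 *)
    (h : int -> A) (h_symbol : symbol (trfil TA) (H 1) h)
    (* the sum over n of the integrals over \Delta_n *)
    (S : R -> B)
    (S_sum : forall t, 0 < t ->
       is_dyson_sum SB (fun u => E0 u t) (i (g1 t)) (S t))
    (S_rees : Rees_tr TB S) (S_tr : constant_trace TB S)
    (* e^(u (f_0 + f_1)) *)
    (E : R -> B) (E_exp : generates SB oneB (i (g0 1) + i (g1 1)) E)
    (* e^gamma h *)
    (y : int -> A) (y_exp : is_exp_times TA gamma h y) :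
  trf TB (E 1) = gr_tr TA y.
Proof.
(* [e^(u F_0)] lies in the domain of the trace, and tends to 1 with u. *)
have full : forall z, trdom TB z.
  have [u u0 Eu] := generates_near1 (E0_exp.2 1 ltr01).
  apply: (trdom_full banachB _ Eu); rewrite -H_phi//.
  have [_ phiT _ _] := phi_tr; apply: phiT.
  by have [[D [D0 hD]] _] := H_rees u u0; rewrite -D0//; have [] := hD 0%N 1 ltr01.
have [] := pselect (trf TB (E 1) = gr_tr TA y) => // /eqP; rewrite -subr_eq0.
move=> /(separating_form hausK)[lam [lam_lin lam_cont /eqP lam_neq]]; case: lam_neq.
have lam_lin' (a : R) x z : lam (trf TB (a *: x + z)) = a * lam (trf TB x) + lam (trf TB z).
  rewrite trfD// -(kact_real SB) trfZ//; first by rewrite kact_real lam_lin.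
have lam_cont' : continuous (fun x => lam (trf TB x)).
  move=> x; apply: continuous_comp; last exact: lam_cont.
  have /subspace_continuousP/(_ _ (full x)) := @trf_cont _ _ _ _ _ _ TB.
  have -> : trdom TB = setT by apply/seteqP; split=> // z _; exact: full.
  by rewrite withinET.
have [l l_cont l_lam] := linear_form_pack lam_lin' lam_cont'.
have hh_ex tau : exists c, 0 < tau -> symbol (trfil TA) (H tau) c /\ (tau = 1 -> c = h).
  have [->|/eqP tau1] := eqVneq tau 1; first by exists h.
  have [tau0|tau0] := ltP 0 tau; last by exists h.
  by have [_ [c hc]] := H_rees tau tau0; exists c => _; split=> // /esym.
have [hh hhP] := choice hh_ex.
have hh_symbol tau (tau0 : 0 < tau) := (hhP tau tau0).1.
have hh1 : hh 1 = h := (hhP 1 ltr01).2 erefl.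
rewrite -hh1 in y_exp.
have [_ [c0 c0_symbol]] := g0_rees.
have [M [delta delta0 [lX lY]]] :=
  has_laurent_common (fdga_morphism_symbol i_mor c0_symbol)
    (fdga_morphism_symbol i_mor c1_symbol).
have to_S := sum_kappa banachB phi_tr rho_act i_mor phi_rho E0_exp H_phi c1_symbol
  c1_central gamma_c1 hh_symbol l_cont lam_lin l_lam S_sum S_tr delta0 lX lY.
have to_tr := sum_kappa_exp_times phi_tr gamma_c1 hh_symbol lam_cont l_lam y_exp.
have ES := form_exp_dyson banachB E0_exp l_cont l_lam S_sum S_tr E_exp.
rewrite addrC -scaleN1r lam_lin -l_lam ES.
by rewrite (cvg_unique (@norm_hausdorff _ _) to_S to_tr) mulN1r addNr.
Qed.
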